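(* Let $M$ be a space-like surface in $\mathbb E^1_1\times \mathbb S^4$. Then $M$ is biconservative and PMCV if and only if it is congruent to the surface locally parametrized by $$\begin{aligned}\phi(u,v)=\Bigg(&-b_1u,\ \frac{\sqrt{b_1^2+1}\, \cos \left(\sqrt{b_1^2+2}\, u\right)}{\sqrt{b_1^2+2}},\ \frac{\sqrt{b_1^2+1}\, \sin \left(\sqrt{b_1^2+2}\, u\right)}{\sqrt{b_1^2+2}},\ b_2,\\ &\ b_3 \sin\frac{v}{b_3},\ b_3 \cos\frac{v}{b_3}\Bigg)\end{aligned}$$ for some non-zero constants $b_1,b_2,b_3$ satisfying $b_2^2+b_3^2=\frac{1}{b_1^2+2}$.
   Context: $\mathbb E^1_1\times\mathbb S^4$ is $\mathbb R\times \mathbb S^4$ with the Lorentzian product metric $\langle\cdot,\cdot\rangle=-dt^2+g_{\mathbb S^4}$, regarded as a hypersurface of $\mathbb E^6_1$ (metric $-dx_1^2+dx_2^2+\dots+dx_6^2$) via $\mathbb S^4\subset\mathbb E^5$ the unit sphere; the parametrization is written in the coordinates of $\mathbb E^6_1$. $\widetilde\nabla$ is the Levi-Civita connection of $\mathbb E^1_1\times\mathbb S^4$ and $\widetilde R(X,Y)Z=\widetilde\nabla_X\widetilde\nabla_YZ-\widetilde\nabla_Y\widetilde\nabla_XZ-\widetilde\nabla_{[X,Y]}Z$. Let $M$ be a space-like surface (isometrically immersed by $\phi$, with positive definite induced metric), with second fundamental form $h$, shape operators $A$, normal connection $\nabla^\perp$ and mean curvature vector $H=\frac12\mathrm{tr}\,h$.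 $M$ is PMCV if $\nabla^\perp H=0$. $M$ is biconservative if the tangential part of the bitension field $\tau_2(\phi)=\Delta\tau(\phi)-\mathrm{tr}\,\widetilde R(d\phi,\tau(\phi))d\phi$ vanishes, where $\tau(\phi)=\mathrm{tr}\,\nabla d\phi=2H$ and $\Delta$ is the rough Laplacian; equivalently $2\nabla\|H\|^2+4\,\mathrm{tr}\,A_{\nabla^\perp_\cdot H}(\cdot)+4\,\mathrm{tr}(\widetilde R(\cdot,H)\cdot)^T=0$. Standing assumptions: writing $\frac{\partial}{\partial t}|_M=T+\eta$ with $T$ tangent and $\eta$ normal to $M$, $T$ vanishes nowhere on $M$; surfaces are connected and oriented, all objects are smooth; $H\neq0$. *)

(* Defs.v *)
From HB Require Import structures.
From mathcomp Require Import all_boot all_order all_algebra.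
From mathcomp Require Import all_classical all_reals all_analysis.
Set Implicit Arguments.
Unset Strict Implicit.
Unset Printing Implicit Defensive.
Import Order.TTheory GRing.Theory Num.Theory.
Import numFieldNormedType.Exports.
Local Open Scope classical_set_scope.
Local Open Scope ring_scope.

Notation E2 R := 'rV[R]_2.
Notation E6 R := 'rV[R]_6.

Section Smooth.
Context {R : realType} {V W : normedModType R}.

(* C^k on an open set U of a finite-dimensional V: f is differentiable on U and
   all its directional derivatives are C^(k-1) on U. *)
Fixpoint Ck (U : set V) (k : nat) (f : V -> W) : Prop :=
  if k is k'.+1 then
    (forall x, U x -> differentiable f x) /\ (forall v, Ck U k' ('D_v f))
  else forall x, U x -> {for x, continuous f}.

Definition smooth_on (U : set V) (f : V -> W) : Prop := forall k, Ck U k f.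

End Smooth.

Section Surface.
Context {R : realType}.

(* chart_to is only meaningful on chart_dom, chart_from only on chart_cod. *)
Record chart (M : topologicalType) := Chart {
  chart_dom : set M;
  chart_cod : set (E2 R);
  chart_to : M -> E2 R;
  chart_from : E2 R -> M;
  chart_dom_open : open chart_dom;
  chart_cod_open : open chart_cod;
  chart_to_cod : forall p, chart_dom p -> chart_cod (chart_to p);
  chart_from_dom : forall q, chart_cod q -> chart_dom (chart_from q);
  chart_toK : forall p, chart_dom p -> chart_from (chart_to p) = p;
  chart_fromK : forall q, chart_cod q -> chart_to (chart_from q) = q;
  chart_to_continuous : forall p, chart_dom p -> {for p, continuous chart_to};
  chart_from_continuous :
    forall q, chart_cod q -> {for q, continuous chart_from} }.

Definition transition (M : topologicalType) (c d : chart M) : E2 R -> E2 R :=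
  chart_to d \o chart_from c.

Definition transition_dom (M : topologicalType) (c d : chart M) : set (E2 R) :=
  chart_cod c `&` chart_from c @^-1` chart_dom d.

Definition compatible (M : topologicalType) (c d : chart M) : Prop :=
  smooth_on (transition_dom c d) (transition c d) /\
  smooth_on (transition_dom d c) (transition d c).

Record surface := Surface {
  surface_carrier :> topologicalType;
  atlas : set (chart surface_carrier);
  surface_hausdorff : hausdorff_space surface_carrier;
  surface_second_countable : @second_countable surface_carrier;
  surface_connected : connected [set: surface_carrier];
  atlas_cover : forall p, exists2 c, atlas c & chart_dom c p;
  atlas_compatible : forall c d, atlas c -> atlas d -> compatible c d;
  atlas_oriented : forall c d, atlas c -> atlas d ->
    forall q, transition_dom c d q ->
      0 < \det (jacobian (transition c d) q) }.

(* Local coordinate systems, i.e. the charts of the maximal smooth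
   (not necessarily oriented) atlas of M. *)
Definition coordinate_system (M : surface) (c : chart M) : Prop :=
  forall d, atlas d -> compatible c d.

End Surface.
Arguments chart R M : clear implicits.
Arguments surface R : clear implicits.

Section Ambient.
Context {R : realType}.
Implicit Types (p x y z v : E6 R) (X Y Z : E6 R -> E6 R).

Definition mink x y : R :=
  - (x 0 0 * y 0 0) + \sum_(i < 5) x 0 (lift 0 i) * y 0 (lift 0 i).

Definition RxS4 : set (E6 R) :=
  [set p | \sum_(i < 5) p 0 (lift 0 i) ^+ 2 = 1].

(* At p = (t, x) in RxS4, the vector (0, x) is the unit normal of RxS4. *)
Definition unormal p : E6 R := \row_i (if i == 0 then 0 else p 0 i).

Definition tangent_RxS4 p v : Prop := mink v (unormal p) = 0.

Definition proj p v : E6 R := v - mink v (unormal p) *: unormal p.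

Definition dt : E6 R := delta_mx 0 0.

(* Vector fields on RxS4 are (restrictions to RxS4 of) maps E6 -> E6 which are
   tangent to RxS4 along RxS4. The Levi-Civita connection of the product metric,
   which is the metric induced by mink, is the tangential part of the flat
   connection of E^6_1. *)
Definition covd X Y : E6 R -> E6 R := fun p => proj p ('D_(X p) Y p).

Definition lie X Y : E6 R -> E6 R := fun p => 'D_(X p) Y p - 'D_(Y p) X p.

Definition curvature_field X Y Z : E6 R -> E6 R := fun p =>
  covd X (covd Y Z) p - covd Y (covd X Z) p - covd (lie X Y) Z p.

(* The vector field p |-> proj p v extends a tangent vector v; the curvature
   being tensorial, its value at p may be computed with these extensions. *)
Definition extend v : E6 R -> E6 R := fun p => proj p v.

Definition curvature p x y z : E6 R :=
  curvature_field (extend x) (extend y) (extend z) p.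

(* Isometries of RxS4: diffeomorphisms of RxS4 (smooth maps on RxS4 being
   restrictions of smooth maps on open neighbourhoods of it) that preserve the
   metric. *)
Definition isometry_RxS4 (F : E6 R -> E6 R) : Prop :=
  exists (G : E6 R -> E6 R) (O : set (E6 R)),
    [/\ open O /\ RxS4 `<=` O,
        smooth_on O F /\ smooth_on O G,
        (forall p, RxS4 p -> RxS4 (F p) /\ RxS4 (G p)),
        (forall p, RxS4 p -> G (F p) = p /\ F (G p) = p) &
        forall p, RxS4 p -> forall x y, tangent_RxS4 p x -> tangent_RxS4 p y ->
          mink ('D_x F p) ('D_y F p) = mink x y].

End Ambient.

Section Parametrized.
Context {R : realType}.
Variable f : E2 R -> E6 R.
Implicit Types (i j k l : 'I_2) (q : E2 R) (w : E6 R) (V : E2 R -> E6 R).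

Definition pd {W : normedModType R} i (V : E2 R -> W) : E2 R -> W :=
  'D_(delta_mx 0 i : E2 R) V.

Definition fform q : 'M[R]_2 := \matrix_(i, j) mink (pd i f q) (pd j f q).

Definition fform_inv q : 'M[R]_2 := invmx (fform q).

Definition trace_g q (B : 'I_2 -> 'I_2 -> E6 R) : E6 R :=
  \sum_i \sum_j fform_inv q i j *: B i j.

(* Gamma^k_ij of the induced metric *)
Definition christoffel k i j q : R :=
  2^-1 * \sum_l fform_inv q k l *
    (pd i (fun r => fform r j l) q + pd j (fun r => fform r i l) q
     - pd l (fun r => fform r i j) q).

(* Levi-Civita connection of RxS4 acting on vector fields along f *)
Definition nabla i V : E2 R -> E6 R := fun q => proj (f q) (pd i V q).

Definition tang q w : E6 R :=
  trace_g q (fun i j => mink w (pd i f q) *: pd j f q).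

Definition norm_part q w : E6 R := w - tang q w.

Definition sff i j q : E6 R := norm_part q (nabla i (pd j f) q).

Definition mean_curvature q : E6 R := 2^-1 *: trace_g q (fun i j => sff i j q).

Definition nabla_perp i V : E2 R -> E6 R := fun q => norm_part q (nabla i V q).

Definition tension q : E6 R :=
  trace_g q (fun i j =>
    nabla i (pd j f) q - \sum_k christoffel k i j q *: pd k f q).

(* The sign convention is Delta = tr nabla^2. *)
Definition rough_laplacian V q : E6 R :=
  trace_g q (fun i j =>
    nabla i (nabla j V) q - \sum_k christoffel k i j q *: nabla k V q).

Definition bitension q : E6 R :=
  rough_laplacian tension q -
  trace_g q (fun i j => curvature (f q) (pd i f q) (tension q) (pd j f q)).

End Parametrized.

Section Immersed.
Context {R : realType} {M : surface R}.
Variable phi : M -> E6 R.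

Definition local_expr (c : chart R M) : E2 R -> E6 R := phi \o chart_from c.

(* M carries the induced metric, so that phi is isometric; positive definiteness
   implies that phi is an immersion. *)
Definition spacelike_surface : Prop :=
  (forall p, RxS4 (phi p)) /\
  forall c, atlas c ->
    smooth_on (chart_cod c) (local_expr c) /\
    forall q, chart_cod c q -> forall v : E2 R, v != 0 ->
      0 < mink ('D_v (local_expr c) q) ('D_v (local_expr c) q).

Definition T_nowhere_zero : Prop :=
  forall c, atlas c -> forall q, chart_cod c q -> tang (local_expr c) q dt != 0.

Definition H_nonzero : Prop :=
  exists2 c, atlas c &
    exists2 q, chart_cod c q & mean_curvature (local_expr c) q != 0.

Definition PMCV : Prop :=
  forall c, atlas c -> forall q, chart_cod c q -> forall i,
    nabla_perp (local_expr c) i (mean_curvature (local_expr c)) q = 0.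

Definition biconservative : Prop :=
  forall c, atlas c -> forall q, chart_cod c q ->
    tang (local_expr c) q (bitension (local_expr c) q) = 0.

(* M is congruent, by one isometry of RxS4, to a surface which around each of
   its points has local coordinates (u, v) in which it is given by Phi. *)
Definition congruent_to_local (Phi : E2 R -> E6 R) : Prop :=
  exists2 F : E6 R -> E6 R, isometry_RxS4 F &
    forall p : M, exists c : chart R M,
      [/\ coordinate_system c, chart_dom c p &
          forall q, chart_cod c q -> F (phi (chart_from c q)) = Phi q].

End Immersed.

Definition model_surface {R : realType} (b1 b2 b3 : R) (q : E2 R) : E6 R :=
  let u := q 0 0 in
  let v := q 0 1 in
  let s := Num.sqrt (b1 ^+ 2 + 2) in
  let r := Num.sqrt (b1 ^+ 2 + 1) in
  \row_(i < 6) nth 0 [:: - b1 * u;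
                         r * cos (s * u) / s;
                         r * sin (s * u) / s;
                         b2;
                         b3 * sin (v / b3);
                         b3 * cos (v / b3)] i.

(* Main.v *)
(* Write d/dt = T + eta along the surface, t_i = <d_i f, dt>, and let N be the unit normal
   of R x S^4 in E^6_1.

   For a PMCV surface the tangential part of the bitension field is 4 <H, dt> T; as T
   vanishes nowhere, biconservative means <H, dt> = 0. Then |H|^2 = c is constant, and
   c > 0 since H is orthogonal to the timelike vector eta. The shape operator A_H kills T
   and has trace 2c, hence d_i H = - 2c (d_i f - t_i T / |T|^2). Symmetry of the second
   derivatives of H, then of T, together with the trace formula for H, shows that
   th = |T|^2 is constant, d_i T = t_i C and d_i C = - (2 + th) t_i (T / th + dt). So T, C
   and dt describe a helix in a fixed subspace, and what remains of f is a vector of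
   constant length in a fixed plane: this gives the coordinates u = - t / b1 and v of the
   model, with b1^2 = th and 1 / b3^2 = 4c + th + 2.

   Conversely, the model is computed in an arbitrary orthonormal frame containing dt. By
   the Koszul formula and the Gauss equation an isometry G of R x S^4 respects the second
   fundamental form of R x S^4 in E^6_1, whose kernel is spanned by dt; so dG maps dt to
   + dt or - dt, and G is locally the restriction of an affine isometry of E^6_1, which
   maps the model to the model in another frame. *)
Require Import Defs.
From mathcomp Require Import all_boot all_order all_algebra.
From mathcomp Require Import all_classical all_reals all_analysis.
From mathcomp Require Import ring lra.
Set Implicit Arguments.
Unset Strict Implicit.
Unset Printing Implicit Defensive.
Import Order.TTheory GRing.Theory Num.Theory.
Import numFieldNormedType.Exports.
Local Open Scope classical_set_scope.
Local Open Scope ring_scope.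
Local Opaque derive.

(** * Directional derivatives and maps of class C^k *)

Section DirectionalDerivatives.
Context {R : realType} {V : normedModType R}.
Implicit Types (x v : V) (U : set V).

(** No orthonormal frame is moved along the surface. The engine is a division: an identity t_0 X_1 =
    t_1 X_0 makes both X_i multiples t_i Q of one smooth field Q. It applies to the derivatives of T
    / |T|^2 and then to those of C, so that these fields vary with the time coordinate alone; the
    trace formula for H, tested on dt - T and on C, fixes the scalars that the symmetries leave
    open. Two obstacles are global. The constants and the frame found in one chart must be the same
    in all charts: they are built from quantities that agree on overlaps, and connectedness does the
    rest. And the congruence asks for genuine charts in which the surface is the model, whence the
    inverse function theorem. In the converse an isometry is constrained on R x S^4 only, whereas
    derivatives are taken in E^6_1; it is therefore composed with a retraction onto R x S^4. A sign
    in its action on dt and a time translation survive, and this is why the model is studied with an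
    arbitrary slope of square b1^2 and an arbitrary origin of time. *)

Lemma differentiable_rVP n (f : V -> 'rV[R]_n) x :
  differentiable f x <-> forall i, differentiable (fun y => f y 0 i) x.
Proof.
split=> [df i|df].
  exact: (differentiable_comp df (differentiable_coord _ _ _)).
have -> : f = \sum_(i < n) (fun y => f y 0 i *: (delta_mx 0 i : 'rV[R]_n)).
  by apply/funext => y; rewrite fct_sumE -row_sum_delta.
by apply: differentiable_sum => i; exact: differentiableZl.
Qed.

Lemma derivable_rV n (f : V -> 'rV[R]_n) x v i :
  derivable f x v -> derivable (fun y => f y 0 i) x v.
Proof. by move=> /derivable_mxP/(_ 0 i). Qed.

Lemma derive_rV n (f : V -> 'rV[R]_n) x v i :
  derivable f x v -> 'D_v f x 0 i = 'D_v (fun y => f y 0 i) x.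
Proof. by move=> /derive_mx ->; rewrite mxE. Qed.

Lemma is_derive_rVP n (f : V -> 'rV[R]_n) x v df :
  is_derive x v f df <-> forall i, is_derive x v (fun y => f y 0 i) (df 0 i).
Proof.
split=> [[dfx <-] i|H].
  by rewrite derive_rV//; apply: derivableP; exact: derivable_rV.
have dfx : derivable f x v.
  by apply/derivable_mxP => i j; rewrite ord1; case: (H j).
apply: DeriveDef => //; apply/rowP => i; rewrite derive_rV//.
by case: (H i).
Qed.

Lemma near_eq_deriveU (W : normedModType R) U (f g : V -> W) x v :
  open U -> U x -> (forall y, U y -> f y = g y) -> 'D_v f x = 'D_v g x.
Proof.
move=> oU Ux fg; have [->|v0] := eqVneq v 0; first by rewrite !derive0.
apply: near_eq_derive => //; near=> y.
by apply: fg; near: y; exact: open_nbhs_nbhs.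
Unshelve. all: by end_near. Qed.

(** Differentiability is a little-o expansion whose linear part is the differential: the expansion
    of [f] serves for [g], and [diff_unique] identifies ['d g x] with the linear map found in it. *)
Lemma near_eq_differentiable (W : normedModType R) U (f g : V -> W) x :
  open U -> U x -> (forall y, U y -> f y = g y) ->
  differentiable f x -> differentiable g x.
Proof.
move=> oU Ux fg df.
have [dc /eqaddoP fE] := (diff_locallyP _ _).1 df.
have gE : g \o shift x = cst (g x) + 'd f x +o_ 0 id.
  apply/eqaddoP => e e0; have := fE e e0.
  have nx : \forall h \near (0 : V), U (h + x).
    have sc : shift x @ (0 : V) --> x.
      rewrite -{2}[x]add0r; apply: cvgD; [exact: cvg_id|exact: cvg_cst].
    by apply: sc; exact: open_nbhs_nbhs.
  apply: filterS2 nx => h Uh.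
  by rewrite !fctE/= -(fg _ Ux) -(fg _ Uh).
have dE := diff_unique dc gE.
by apply/diff_locallyP; rewrite dE.
Qed.

Lemma derive_lin (W : normedModType R) (f : V -> W) x : differentiable f x ->
  linear (fun v => 'D_v f x).
Proof. by move=> df a u v; rewrite !deriveE// linearP. Qed.

Lemma derive_compE (W Z : normedModType R) (f : V -> W) (g : W -> Z) x v :
  differentiable f x -> differentiable g (f x) ->
  'D_v (g \o f) x = 'D_('D_v f x) g (f x).
Proof.
move=> df dg; rewrite !deriveE//; last exact: differentiable_comp.
by rewrite diff_comp.
Qed.

End DirectionalDerivatives.

(** * Closure of C^k under algebraic operations and composition *)

Section CkClosure.
Context {R : realType} {V : normedModType R}.
Implicit Types (x v : V) (U : set V) (k : nat).

Lemma Ck_ext (W : normedModType R) U k (f g : V -> W) : open U ->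
  (forall y, U y -> f y = g y) -> Ck U k f -> Ck U k g.
Proof.
move=> oU; elim: k f g => [|k IH] f g fg /=.
  move=> cf x Ux.
  have gf : {near x, f =1 g}.
    by near=> y; apply: fg; near: y; exact: open_nbhs_nbhs.
  rewrite /prop_for /continuous_at -(fg _ Ux).
  apply: cvg_trans (cf x Ux); exact: near_eq_cvg.
move=> [df cf]; split=> [x Ux|v].
  exact: (near_eq_differentiable oU Ux fg (df x Ux)).
by apply: (IH ('D_v f)) => [y Uy|//]; exact: (near_eq_deriveU _ oU Uy fg).
Unshelve. all: by end_near. Qed.

Lemma Ck_sub (W : normedModType R) U U' k (f : V -> W) :
  U' `<=` U -> Ck U k f -> Ck U' k f.
Proof.
move=> UU'; elim: k f => [|k IH] f /=; first by move=> cf x /UU'; exact: cf.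
by move=> [df cf]; split=> [x /UU'/df//|v]; exact: IH.
Qed.

Lemma CkW (W : normedModType R) U k (f : V -> W) : Ck U k.+1 f -> Ck U k f.
Proof.
elim: k f => [|k IH] f.
  by move=> [df _] x Ux; exact/differentiable_continuous/df.
by move=> [df cf]; split=> // v; exact: IH (cf v).
Qed.

Lemma Ck_differentiable (W : normedModType R) U k (f : V -> W) x :
  Ck U k.+1 f -> U x -> differentiable f x.
Proof. by move=> [df _]; exact: df. Qed.

Lemma Ck_continuous (W : normedModType R) U k (f : V -> W) x :
  Ck U k f -> U x -> {for x, continuous f}.
Proof.
by elim: k f => [|k IH] f cf Ux; [exact: cf|exact: (IH f (CkW cf) Ux)].
Qed.

Lemma Ck_cst (W : normedModType R) U k (w : W) : Ck U k (cst w : V -> W).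
Proof.
elim: k w => [|k IH] w /=; first by move=> x _; exact: cvg_cst.
split=> [x _|v]; first exact: differentiable_cst.
have -> : 'D_v (cst w : V -> W) = cst 0 by apply/funext => x; exact: derive_cst.
exact: IH.
Qed.

Lemma CkD U k (f g : V -> R) : open U ->
  Ck U k f -> Ck U k g -> Ck U k (fun y => f y + g y).
Proof.
move=> oU; elim: k f g => [|k IH] f g /=.
  by move=> cf cg x Ux; apply: cvgD; [exact: cf|exact: cg].
move=> [df cf] [dg cg]; split=> [x Ux|v].
  by apply: differentiableD; [exact: df|exact: dg].
apply: Ck_ext (IH _ _ (cf v) (cg v)) => // y Uy.
by rewrite -deriveD//; apply: diff_derivable; [exact: df|exact: dg].
Qed.

Lemma CkM U k (f g : V -> R) : open U ->
  Ck U k f -> Ck U k g -> Ck U k (fun y => f y * g y).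
Proof.
move=> oU; elim: k f g => [|k IH] f g.
  by move=> cf cg x Ux; apply: cvgM; [exact: cf|exact: cg].
move=> cf cg; split=> [x Ux|v].
  by apply: differentiableM; [exact: Ck_differentiable cf _|
                              exact: Ck_differentiable cg _].
have := CkD oU (IH _ _ (CkW cf) (cg.2 v)) (IH _ _ (CkW cg) (cf.2 v)).
apply: Ck_ext => // y Uy; rewrite deriveM//.
- by apply: diff_derivable; exact: Ck_differentiable cf _.
- by apply: diff_derivable; exact: Ck_differentiable cg _.
Qed.

Lemma CkV U k (f : V -> R) : open U -> (forall x, U x -> f x != 0) ->
  Ck U k f -> Ck U k (fun y => (f y)^-1).
Proof.
move=> oU f0; elim: k => [|k IH].
  by move=> cf x Ux; apply: cvgV; [exact: f0|exact: cf].
move=> cf; split=> [x Ux|v].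
  by apply: differentiableV; [exact: Ck_differentiable cf _|exact: f0].
have iC := IH (CkW cf).
have := CkM oU (CkM oU (Ck_cst _ _ (-1 : R)) (CkM oU iC iC)) (cf.2 v).
apply: Ck_ext => // y Uy; rewrite deriveV//; last 2 first.
- exact: f0.
- by apply: diff_derivable; exact: Ck_differentiable cf _.
by rewrite /cst mulN1r expr2 invfM.
Qed.

Lemma Ck_rVP n U k (f : V -> 'rV[R]_n) : open U ->
  Ck U k f <-> forall i, Ck U k (fun y => f y 0 i).
Proof.
move=> oU; elim: k f => [|k IH] f; split.
- move=> cf i x Ux.
  apply: (@continuous_comp _ _ _ f (fun N : 'rV[R]_n => N 0 i)); first exact: cf.
  exact: coord_continuous.
- move=> H x Ux.
  have -> : f = fun y => \sum_(i < n) f y 0 i *: (delta_mx 0 i : 'rV[R]_n).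
    by apply/funext => y; rewrite -row_sum_delta.
  apply: cvg_big => [|i _]; first exact: add_continuous.
  by apply: cvgZr_tmp; exact: H.
- move=> [df cf] i; split=> [x Ux|v].
    exact: (differentiable_rVP _ _).1 (df x Ux) i.
  apply: Ck_ext ((IH _).1 (cf v) i) => // y Uy.
  by rewrite derive_rV//; exact/diff_derivable/df.
- move=> H; have df x : U x -> differentiable f x.
    by move=> Ux; apply/differentiable_rVP => i; exact: (H i).1.
  split=> // v; apply/IH => i; apply: Ck_ext ((H i).2 v) => // y Uy.
  by rewrite derive_rV//; exact/diff_derivable/df.
Qed.

End CkClosure.

Lemma derive_sum_coord {R : realType} n (W : normedModType R)
    (f : 'rV[R]_n -> W) x v : differentiable f x ->
  'D_v f x = \sum_i v 0 i *: 'D_(delta_mx 0 i) f x.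
Proof.
move=> df; rewrite deriveE// [in LHS](row_sum_delta v) linear_sum.
by apply: eq_bigr => i _; rewrite linearZ deriveE.
Qed.

(** The derivative of [g \o f] is a finite sum of products of a coordinate of ['D_v f] with a
    partial derivative of [g] composed with [f]. The order drops by one and [g] changes, hence the
    induction on [k] for all [g] at once. *)
Lemma Ck_comp {R : realType} {V : normedModType R} n U (U' : set 'rV[R]_n) k
    (f : V -> 'rV[R]_n) (g : 'rV[R]_n -> R) : open U -> open U' ->
  (forall x, U x -> U' (f x)) -> Ck U k f -> Ck U' k g -> Ck U k (g \o f).
Proof.
move=> oU oU' UU'; elim: k g => [|k IH] g cf cg.
  move=> x Ux; apply: continuous_comp; [exact: cf|exact/cg/UU'].
split=> [x Ux|v].
  apply: differentiable_comp; first exact: Ck_differentiable cf _.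
  by apply: Ck_differentiable cg _; exact: UU'.
(* The sum runs over a list, so that it can be handled by induction on the list. *)
pose h (s : seq 'I_n) y := \sum_(i <- s)
  'D_v f y 0 i * 'D_(delta_mx 0 i) g (f y).
have hC (s : seq 'I_n) : Ck U k (h s).
  elim: s => [|i s IHs].
    by apply: Ck_ext (Ck_cst U k 0) => // y _; rewrite /h big_nil.
  have c1 := (Ck_rVP _ _ oU).1 (cf.2 v) i.
  have c2 := IH _ (CkW cf) (cg.2 (delta_mx 0 i)).
  apply: Ck_ext (CkD oU (CkM oU c1 c2) IHs) => // y _.
  by rewrite /h big_cons.
apply: Ck_ext (hC (index_enum 'I_n)) => // y Uy.
have dg : differentiable g (f y) by apply: Ck_differentiable cg _; exact: UU'.
rewrite derive_compE//; last exact: Ck_differentiable cf _.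
by rewrite derive_sum_coord.
Qed.

(** * The mean value theorem and the symmetry of second derivatives *)

Section MeanValue.
Context {R : realType} {V : normedModType R}.
Implicit Types (x u v : V) (U : set V).

Lemma is_derive_line (W : normedModType R) (f : V -> W) x v (s : R) :
  differentiable f (x + s *: v) ->
  is_derive s 1 (fun t : R => f (x + t *: v)) ('D_v f (x + s *: v)).
Proof.
move=> df; pose l (t : R) := x + t *: v.
have dl : is_diff s l ( *:%R ^~ v).
  have -> : l = cst x + ( *:%R ^~ v) by apply/funext.
  rewrite -[X in is_diff_def _ _ X]add0r; exact: is_diffD.
have dfl : differentiable (f \o l) s by exact: differentiable_comp.
apply: DeriveDef; first exact: diff_derivable.
rewrite (@derive_compE _ _ _ _ l f s 1 _ df)//.
by rewrite [in 'D_1 l s]deriveE// diff_val scale1r.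
Qed.

Lemma MVT_line (f : V -> R) x v (h : R) : 0 <= h ->
  (forall s, 0 <= s <= h -> differentiable f (x + s *: v)) ->
  exists2 s, 0 <= s <= h & f (x + h *: v) - f x = h * 'D_v f (x + s *: v).
Proof.
move=> h0 df; pose g (t : R) := f (x + t *: v).
have dg s : 0 <= s <= h -> is_derive s 1 g ('D_v f (x + s *: v)).
  by move=> sh; apply: is_derive_line; exact: df.
have [||s sh E] := @MVT_segment _ g (fun s => 'D_v f (x + s *: v)) _ _ h0.
- by move=> s; rewrite in_itv/= => /andP[/ltW s0 /ltW sh]; apply: dg; rewrite s0.
- apply: derivable_within_continuous => s; rewrite in_itv/= => sh.
  by have [] := dg s sh.
exists s; first by rewrite in_itv/= in sh.
by move: E; rewrite /g scale0r addr0 subr0 mulrC.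
Qed.

(** Two mean value steps: first for the increment [g] of [f] in direction [v], moved along [u], then
    for ['D_u f], moved along [v]. *)
Lemma second_difference (f : V -> R) x u v (h : R) : 0 <= h ->
  (forall s t, 0 <= s <= h -> 0 <= t <= h ->
    differentiable f (x + s *: u + t *: v) /\
    differentiable ('D_u f) (x + s *: u + t *: v)) ->
  exists s t, [/\ 0 <= s <= h, 0 <= t <= h &
    f (x + h *: u + h *: v) - f (x + h *: u) - (f (x + h *: v) - f x) =
    h * (h * 'D_v ('D_u f) (x + s *: u + t *: v))].
Proof.
move=> h0 df.
pose g y := f (y + h *: v) - f y.
have hh : 0 <= h <= h by apply/andP.
have z0 : (0 : R) <= 0 <= h by apply/andP.
have dfv s : 0 <= s <= h -> differentiable (fun y => f (y + h *: v)) (x + s *: u).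
  move=> sh; apply: (@differentiable_comp _ _ _ _ (fun y => y + h *: v) f).
    exact: differentiableD.
  exact: (df s h sh hh).1.
have df0 s : 0 <= s <= h -> differentiable f (x + s *: u).
  by move=> sh; have [] := df s 0 sh z0; rewrite scale0r addr0.
have [s sh E] : exists2 s, 0 <= s <= h &
    g (x + h *: u) - g x = h * 'D_u g (x + s *: u).
  by apply: (MVT_line h0) => s sh; apply: differentiableB; [exact: dfv|exact: df0].
have [t th F] : exists2 t, 0 <= t <= h &
    'D_u f (x + s *: u + h *: v) - 'D_u f (x + s *: u) =
    h * 'D_v ('D_u f) (x + s *: u + t *: v).
  exact: (@MVT_line ('D_u f) (x + s *: u) v h h0 (fun t th => (df s t sh th).2)).
exists s, t; split=> //.
rewrite -F [LHS]E; congr (_ * _).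
rewrite /g deriveB; [|exact/diff_derivable/dfv|exact/diff_derivable/df0].
congr (_ - _).
have dt : differentiable (fun y : V => y + h *: v) (x + s *: u).
  exact: differentiableD.
rewrite (@derive_compE _ _ _ _ (fun y => y + h *: v) f)//; last exact: (df s h sh hh).1.
congr ('D_ _ _ _).
rewrite deriveD; [|exact: derivable_id|exact: derivable_cst].
by rewrite derive_id derive_cst addr0.
Qed.

(** Schwarz: the second difference of [f] does not change when [u] and [v] are exchanged, so some
    value of one mixed derivative near [x] is also a value of the other near [x]; continuity of both
    at [x] concludes. *)
Lemma derive_comm (f : V -> R) U x u v : open U -> U x -> Ck U 2 f ->
  'D_u ('D_v f) x = 'D_v ('D_u f) x.
Proof.
move=> oU Ux cf; apply/eqP; rewrite -subr_eq0 -normr_le0.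
apply/ler_addgt0Pr => e e0; rewrite add0r.
set A := 'D_v ('D_u f); set B := 'D_u ('D_v f).
have sd (a b c d : R) : a - b - (c - d) = a - c - (b - d) by ring.
have sb (a b c : R) : (a - b) - (c - b) = a - c by ring.
have e2 : 0 < e / 2 by rewrite divr_gt0.
have close (a b z : R) : `|a - z| < e / 2 -> `|b - z| < e / 2 -> `|b - a| <= e.
  move=> az bz; rewrite -(sb b z a) (le_trans (ler_normB _ _))//.
  by rewrite [leRHS]splitr lerD// ltW.
have cu : Ck U 1 ('D_u f) by exact: cf.2.
have cv : Ck U 1 ('D_v f) by exact: cf.2.
have nA : \forall y \near x, `|A x - A y| < e / 2.
  by move/cvgrPdist_lt: ((cf.2 u).2 v x Ux) => /(_ _ e2).
have nB : \forall y \near x, `|B x - B y| < e / 2.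
  by move/cvgrPdist_lt: ((cf.2 v).2 u x Ux) => /(_ _ e2).
have nU : \forall y \near x, U y by exact: open_nbhs_nbhs.
have : nbhs x ([set y | `|A x - A y| < e / 2] `&` [set y | `|B x - B y| < e / 2] `&` U).
  exact: filterI (filterI nA nB) nU.
move=> /nbhs_ballP[r /= r0 rP].
(* The parallelogram of side [h] stays in the ball because h (|u| + |v| + 1) = r / 2; the summand 1
   avoids a zero denominator. *)
pose h := r / (2 * (`|u| + `|v| + 1)).
have d0 : 0 < `|u| + `|v| + 1 by rewrite ltr_wpDl// addr_ge0.
have h0 : 0 < h by rewrite divr_gt0// mulr_gt0.
have inb s t : 0 <= s <= h -> 0 <= t <= h -> ball x r (x + s *: u + t *: v).
  move=> /andP[s0 sh] /andP[t0 th]; rewrite -ball_normE/= -addrA opprD addrA.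
  rewrite subrr add0r normrN (le_lt_trans (ler_normD _ _))//.
  rewrite !normrZ !ger0_norm//.
  have : s * `|u| + t * `|v| <= h * (`|u| + `|v| + 1).
    by rewrite !mulrDr mulr1 -[leLHS]addr0 lerD ?(ltW h0)// lerD// ler_wpM2r.
  move=> /le_lt_trans; apply.
  by rewrite /h invfM mulrA divfK ?gt_eqF// ltr_pdivrMr// ltr_pMr// ltr1n.
have inb' s t : 0 <= s <= h -> 0 <= t <= h -> ball x r (x + t *: v + s *: u).
  by move=> sh th; rewrite addrAC; exact: inb.
have [s [t [sh th E]]] : exists s t, [/\ 0 <= s <= h, 0 <= t <= h &
    f (x + h *: u + h *: v) - f (x + h *: u) - (f (x + h *: v) - f x) =
    h * (h * A (x + s *: u + t *: v))].
  apply: second_difference => // [|s t sh th]; first exact: ltW.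
  have [_ Us] := rP _ (inb s t sh th).
  by split; [exact: Ck_differentiable cf Us|exact: Ck_differentiable cu Us].
have [s' [t' [sh' th' E']]] : exists s t, [/\ 0 <= s <= h, 0 <= t <= h &
    f (x + h *: v + h *: u) - f (x + h *: v) - (f (x + h *: u) - f x) =
    h * (h * B (x + s *: v + t *: u))].
  apply: second_difference => // [|s' t' sh' th']; first exact: ltW.
  have [_ Us] := rP _ (inb' t' s' th' sh').
  by split; [exact: Ck_differentiable cf Us|exact: Ck_differentiable cv Us].
have AB : A (x + s *: u + t *: v) = B (x + s' *: v + t' *: u).
  apply: (mulfI (lt0r_neq0 h0)); apply: (mulfI (lt0r_neq0 h0)).
  move: E E'; rewrite [x + h *: v + _]addrAC.
  move: (A _) (B _) (f _) (f _) (f _) (f _) => a b f1 f2 f3 f4 <- <-.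
  exact: sd.
have [[/= HA _] _] := rP _ (inb s t sh th).
have [[_ /= HB] _] := rP _ (inb' t' s' th' sh').
move: HA HB; rewrite -AB -/(A x) -/(B x).
move: (A (x + s *: u + t *: v)) (A x) (B x) => z a b HA HB.
exact: close HA HB.
Qed.

Lemma derive_comm_rV n (f : V -> 'rV[R]_n) U x u v : open U -> U x -> Ck U 2 f ->
  'D_u ('D_v f) x = 'D_v ('D_u f) x.
Proof.
move=> oU Ux cf; apply/rowP => i.
have fi w y : U y -> 'D_w f y 0 i = 'D_w (fun z => f z 0 i) y.
  by move=> Uy; rewrite derive_rV//; exact/diff_derivable/cf.1.
have cu : Ck U 1 ('D_u f) by exact: cf.2.
have cv : Ck U 1 ('D_v f) by exact: cf.2.
have dv : derivable ('D_u f) x v by apply: diff_derivable; exact: cu.1.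
have du : derivable ('D_v f) x u by apply: diff_derivable; exact: cv.1.
have Eu := near_eq_deriveU u oU Ux (fi v).
have Ev := near_eq_deriveU v oU Ux (fi u).
have Euv := derive_comm u v oU Ux ((Ck_rVP 2 f oU).1 cf i).
have E1 := derive_rV i du.
have E2 := derive_rV i dv.
refine (etrans E1 _).
refine (etrans Eu _).
refine (etrans Euv _).
refine (etrans (esym Ev) _).
exact: (esym E2).
Qed.

Lemma ball_line (x y : V) r (s : R) : ball x r y -> 0 <= s <= 1 ->
  ball x r (x + s *: (y - x)).
Proof.
rewrite -!ball_normE/= => xy /andP[s0 s1].
rewrite opprD addrA subrr add0r normrN normrZ ger0_norm// distrC.
by apply: le_lt_trans xy; rewrite ler_piMl.
Qed.

Lemma derive0_ball_cst (f : V -> R) x r :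
  (forall y, ball x r y -> differentiable f y) ->
  (forall y v, ball x r y -> 'D_v f y = 0) ->
  forall y, ball x r y -> f y = f x.
Proof.
move=> df Df y xy.
have [|s sh] := @MVT_line f x (y - x) 1 ler01.
  by move=> s sh; apply/df/ball_line.
rewrite scale1r Df ?mulr0; last exact: ball_line.
by rewrite (addrC x) subrK => /eqP; rewrite subr_eq0 => /eqP.
Qed.

End MeanValue.

(** * The sup norm on row vectors and a fixed point theorem *)

Section RowNorm.
Context {R : realType} {n : nat}.
Implicit Types x : 'rV[R]_n.

Lemma rV_norm_le x (r : R) : 0 <= r -> (`|x| <= r) <-> (forall i, `|x 0 i| <= r).
Proof.
move=> r0; rewrite /Num.Def.normr/= mx_normrE; split=> [H i|H].
  by rewrite (le_trans _ H)//; exact: (le_bigmax _ (fun ij => `|x ij.1 ij.2|) (0, i)).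
by apply: bigmax_le => // -[i j] _ /=; rewrite ord1; exact: H.
Qed.

Lemma rV_norm_coord x i : `|x 0 i| <= `|x|.
Proof. by apply: (rV_norm_le x (normr_ge0 x)).1. Qed.

Lemma closed_ball_rV_compact x (r : R) : 0 < r -> compact (closed_ball x r).
Proof.
move=> r0; apply: bounded_closed_compact; last exact: closed_ball_closed.
exists (`|x| + r); split; first exact: num_real.
move=> M Mr y; rewrite closed_ballE//= /closed_ball_/= => xy.
rewrite (le_trans _ (ltW Mr))// -(subrK x y) addrC.
by rewrite (le_trans (ler_normD _ _))// lerD// distrC.
Qed.

(** Compactness replaces the iteration: at a minimum [c] of |x - G x| the value at [G c] is at most
    half as large, so the minimum is 0. *)
Lemma contraction_fixpoint (K : set 'rV[R]_n) (G : 'rV[R]_n -> 'rV[R]_n) :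
  compact K -> K !=set0 -> (forall x, K x -> K (G x)) ->
  (forall x, K x -> {for x, continuous G}) ->
  (forall x y, K x -> K y -> `|G x - G y| <= 2^-1 * `|x - y|) ->
  exists2 x, K x & G x = x.
Proof.
move=> cK K0 KG cG GK.
have cg : {within K, continuous (fun x => `|x - G x|)}.
  apply: continuous_in_subspaceT => x /set_mem Kx.
  have cxG : {for x, continuous (id - G)}.
    by apply: continuousB; [exact: cvg_id|exact: cG].
  exact: cvg_norm cxG.
have [c /set_mem Kc cmin] := EVT_min_rV K0 cK cg.
exists c => //; apply/eqP; rewrite eq_sym -subr_eq0 -normr_le0.
have := le_trans (cmin (G c) (mem_set (KG _ Kc))) (GK _ _ Kc (KG _ Kc)).
by lra.
Qed.

End RowNorm.

Lemma unitmx_inj (F : fieldType) m (A : 'M[F]_m) :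
  (forall v : 'rV_m, v *m A = 0 -> v = 0) -> A \in unitmx.
Proof.
move=> A0; rewrite -row_free_unit -kermx_eq0; apply/rowV0P => v /sub_kermxP.
exact: A0.
Qed.

Section EntrySum.
Context {R : realType}.

(** A crude upper bound for the operator norm of [v |-> v *m A] with respect to the sup norm. *)
Definition entry_sum m n (A : 'M[R]_(m, n)) : R := \sum_i \sum_j `|A i j|.

Lemma entry_sum_ge0 m n (A : 'M[R]_(m, n)) : 0 <= entry_sum A.
Proof. by apply: sumr_ge0 => i _; apply: sumr_ge0. Qed.

Lemma mulmx_norm_le m n (v : 'rV[R]_m) (A : 'M[R]_(m, n)) :
  `|v *m A| <= `|v| * entry_sum A.
Proof.
apply/rV_norm_le => [|j]; first by rewrite mulr_ge0// entry_sum_ge0.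
rewrite mxE (le_trans (ler_norm_sum _ _ _))// /entry_sum mulr_sumr.
apply: ler_sum => i _; rewrite normrM ler_pM//; first exact: rV_norm_coord.
by rewrite (bigD1 j)//= lerDl sumr_ge0.
Qed.

Lemma entry_sum_le m n (A : 'M[R]_(m, n)) (d : R) :
  (forall i j, `|A i j| <= d) -> entry_sum A <= (m * n)%:R * d.
Proof.
move=> Ad; apply: (@le_trans _ _ (\sum_(i < m) \sum_(j < n) d)).
  by apply: ler_sum => i _; apply: ler_sum => j _.
by rewrite !sumr_const !card_ord -mulrnA mulr_natl mulnC.
Qed.

End EntrySum.

(** * Regularity of determinants and inverse matrices *)

Section CkMatrix.
Context {R : realType} {V : normedModType R}.
Variables (U : set V) (k : nat).
Hypothesis oU : open U.

Lemma Ck_sum (I : Type) (s : seq I) (P : pred I) (F : I -> V -> R) :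
  (forall i, Ck U k (F i)) -> Ck U k (fun y => \sum_(i <- s | P i) F i y).
Proof.
move=> cF; elim: s => [|i s IH].
  by apply: Ck_ext (Ck_cst U k (0 : R)) => // y _; rewrite big_nil.
case: (boolP (P i)) => Pi.
  by apply: Ck_ext (CkD oU (cF i) IH) => // y _; rewrite big_cons Pi.
by apply: Ck_ext IH => // y _; rewrite big_cons (negbTE Pi).
Qed.

Lemma Ck_prod (I : Type) (s : seq I) (P : pred I) (F : I -> V -> R) :
  (forall i, Ck U k (F i)) -> Ck U k (fun y => \prod_(i <- s | P i) F i y).
Proof.
move=> cF; elim: s => [|i s IH].
  by apply: Ck_ext (Ck_cst U k (1 : R)) => // y _; rewrite big_nil.
case: (boolP (P i)) => Pi.
  by apply: Ck_ext (CkM oU (cF i) IH) => // y _; rewrite big_cons Pi.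
by apply: Ck_ext IH => // y _; rewrite big_cons (negbTE Pi).
Qed.

Lemma Ck_det n (A : V -> 'M[R]_n) :
  (forall i j, Ck U k (fun y => A y i j)) -> Ck U k (fun y => \det (A y)).
Proof.
move=> cA; rewrite /determinant; apply: Ck_sum => s.
by apply: CkM => //; [exact: (Ck_cst U k)|exact: Ck_prod].
Qed.

(** Cramer's rule: an entry of the inverse is a cofactor divided by the determinant. *)
Lemma Ck_invmx n (A : V -> 'M[R]_n) : (forall y, U y -> A y \in unitmx) ->
  (forall i j, Ck U k (fun y => A y i j)) ->
  forall i j, Ck U k (fun y => invmx (A y) i j).
Proof.
move=> uA cA i j.
pose c y : R := (-1) ^+ (j + i) * \det (row' j (col' i (A y))).
have cc : Ck U k c.
  apply: CkM => //; first exact: (Ck_cst U k).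
  apply: Ck_det => a b.
  by apply: Ck_ext (cA (lift j a) (lift i b)) => // y _; rewrite !mxE.
have cd : Ck U k (fun y => (\det (A y))^-1).
  apply: CkV => //; last exact: Ck_det.
  by move=> y Uy; have := uA y Uy; rewrite unitmxE unitfE.
apply: Ck_ext (CkM oU cd cc) => // y Uy.
by rewrite /invmx uA// !mxE.
Qed.

End CkMatrix.

(** * The inverse function theorem *)

Section DifferentialNorm.
Context {R : realType} {V W : normedModType R}.

Lemma differentiable_norm (f : V -> W) x : differentiable f x ->
  forall e, 0 < e -> exists2 d, 0 < d &
    forall h, `|h| < d -> `|f (h + x) - (f x + 'D_h f x)| <= e * `|h|.
Proof.
move=> df e e0; have [_ /eqaddoP fE] := (diff_locallyP _ _).1 df.
have /nbhs_ballP[d /= d0 dP] := fE e e0; exists d => // h hd.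
have : ball 0 d h by rewrite -ball_normE/= sub0r normrN.
by move=> /dP; rewrite /= !fctE/= deriveE.
Qed.

Lemma norm_differentiable (g : V -> W) y (L : {linear V -> W}) : continuous L ->
  (forall e, 0 < e -> exists2 d, 0 < d &
    forall h, `|h| < d -> `|g (h + y) - (g y + L h)| <= e * `|h|) ->
  differentiable g y /\ forall v, 'D_v g y = L v.
Proof.
move=> cL H.
have gE : g \o shift y = cst (g y) + L +o_ 0 id.
  apply/eqaddoP => e e0; have [d d0 dP] := H e e0.
  apply/nbhs_ballP; exists d => // h; rewrite -ball_normE/= sub0r normrN => hd.
  exact: dP.
have dE := diff_unique cL gE.
have dg : differentiable g y by apply/diff_locallyP; rewrite dE.
by split=> // v; rewrite deriveE// dE.
Qed.

End DifferentialNorm.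

Lemma continuous_normP {R : realType} (V W : normedModType R) (f : V -> W) x :
  {for x, continuous f} <->
  (forall e, 0 < e -> exists2 d, 0 < d & forall y, `|x - y| < d -> `|f x - f y| < e).
Proof.
split=> [/cvgrPdist_lt cf e e0|cf].
  have /nbhs_ballP[d /= d0 dP] := cf e e0; exists d => // y xy; apply: dP.
  by rewrite -ball_normE.
apply/cvgrPdist_lt => e e0; have [d d0 dP] := cf e e0.
apply/nbhs_ballP; exists d => // y; rewrite -ball_normE/=; exact: dP.
Qed.

Section InverseFunction.
Context {R : realType} {n : nat}.
Variables (U : set 'rV[R]_n) (f : 'rV[R]_n -> 'rV[R]_n).
Hypotheses (oU : open U) (sf : smooth_on U f).
Hypothesis f_inj : forall x v, U x -> 'D_v f x = 0 -> v = 0.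

Let J (x : 'rV[R]_n) : 'M[R]_n := \matrix_(i, j) 'D_(delta_mx 0 i) f x 0 j.

Let df x : U x -> differentiable f x.
Proof. exact: (sf 1).1. Qed.

Let derive_J x v : U x -> 'D_v f x = v *m J x.
Proof.
move=> Ux; rewrite (derive_sum_coord v (df Ux)); apply/rowP => j.
by rewrite !mxE summxE; apply: eq_bigr => i _; rewrite !mxE.
Qed.

Let J_unit x : U x -> J x \in unitmx.
Proof.
by move=> Ux; apply: unitmx_inj => v; rewrite -derive_J//; exact: f_inj.
Qed.

Let J_Ck k i j : Ck U k (fun x => J x i j).
Proof.
have := (Ck_rVP k _ oU).1 ((sf k.+1).2 (delta_mx 0 i)) j.
by apply: Ck_ext => // y _; rewrite mxE.
Qed.

Lemma nbhs_mx_entries (A : 'rV[R]_n -> 'M[R]_n) x (d : R) : 0 < d ->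
  (forall i j, {for x, continuous (fun y => A y i j)}) ->
  \forall y \near x, forall i j, `|A y i j - A x i j| < d.
Proof.
move=> d0 cA.
have H i j : \forall y \near x, `|A y i j - A x i j| < d.
  have /cvgrPdist_lt/(_ _ d0) := cA i j.
  by apply: filterS => y; rewrite distrC.
have H' i : \forall y \near x, forall j, `|A y i j - A x i j| < d.
  exact: (@filter_forall _ _ (fun j y => `|A y i j - A x i j| < d) (nbhs x) (nbhs_filter x) (H i)).
exact: (@filter_forall _ _ (fun i y => forall j, `|A y i j - A x i j| < d) (nbhs x) (nbhs_filter x) H').
Qed.

(** Near [q0] the map x - f(x) J(q0)^-1 is a contraction with factor 1/2, because its Jacobian
    vanishes at [q0] and is continuous. The second bound, injectivity with a Lipschitz inverse,
    follows from the first. *)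
Lemma inverse_function_bounds q0 : U q0 -> exists r C : R,
  [/\ 0 < r, 0 < C, ball q0 r `<=` U &
   forall x y, ball q0 r x -> ball q0 r y ->
     `|x - y - (f x - f y) *m invmx (J q0)| <= 2^-1 * `|x - y| /\
     `|x - y| <= C * `|f x - f y|].
Proof.
move=> Uq0; set B := invmx (J q0).
have uJ : J q0 \in unitmx by exact: J_unit.
set s := entry_sum B; have s0 : 0 <= s by exact: entry_sum_ge0.
(* A perturbation of the Jacobian with entries at most [d] has entry sum at most n^2 d, and n^2 d s
   <= 1/2. *)
pose d := (2 * ((n * n)%:R * s + 1))^-1 : R.
have m0 : 0 < (n * n)%:R * s + 1 by rewrite ltr_wpDl// mulr_ge0.
have d0 : 0 < d by rewrite invr_gt0 mulr_gt0.
have nJ : \forall y \near q0, forall i j, `|J y i j - J q0 i j| < d.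
  have cJ i j : {for q0, continuous (fun y => J y i j)} by exact: Ck_continuous (J_Ck 0 i j) Uq0.
  exact: (@nbhs_mx_entries J q0 d d0 cJ).
have nU : \forall y \near q0, U y by exact: open_nbhs_nbhs.
have : nbhs q0 ([set y | forall i j, `|J y i j - J q0 i j| < d] `&` U).
  exact: filterI.
move=> /nbhs_ballP[r /= r0 rP].
have bU : ball q0 r `<=` U by move=> y /rP[].
have key x y : ball q0 r x -> ball q0 r y ->
    `|x - y - (f x - f y) *m B| <= 2^-1 * `|x - y|.
  move=> bx byy.
  have seg t : 0 <= t <= 1 -> ball q0 r (y + t *: (x - y)).
    move=> /andP[t0 t1]; move: bx byy; rewrite -!ball_normE/= => bx byy.
    have -> : q0 - (y + t *: (x - y)) = (1 - t) *: (q0 - y) + t *: (q0 - x).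
      by apply/rowP => i; rewrite !mxE; ring.
    rewrite (le_lt_trans (ler_normD _ _))// !normrZ !ger0_norm ?subr_ge0//.
    have [->|t00] := eqVneq t 0; first by rewrite mul0r addr0 subr0 mul1r.
    have k1 : (1 - t) * `|q0 - y| <= (1 - t) * r.
      by rewrite ler_wpM2l ?subr_ge0// ltW.
    have k2 : t * `|q0 - x| < t * r by rewrite ltr_pM2l// lt_def t00.
    by move: k1 k2; move: `|_| `|_| => a b k1 k2; lra.
  (* The mean value point depends on the coordinate [j], so the columns of the Jacobian that
     represents f x - f y are taken at different points. *)
  have mvt j : {z | ball q0 r z /\ f x 0 j - f y 0 j = ((x - y) *m J z) 0 j}.
    apply: cid.
    have [|t /seg bt] := @MVT_line _ _ (fun z => f z 0 j) y (x - y) 1 ler01.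
      by move=> t /seg/bU/df/differentiable_rVP.
    rewrite scale1r (addrC y) subrK mul1r => E; exists (y + t *: (x - y)).
    split=> //; rewrite -(derive_J _ (bU _ bt)) derive_rV//.
    by apply: diff_derivable; exact/df/bU.
  pose z j := sval (mvt j).
  pose E : 'M[R]_n := \matrix_(i, j) (J (z j) i j - J q0 i j).
  have Ed i j : `|E i j| <= d.
    rewrite mxE ltW//; have [bz _] := svalP (mvt j).
    by have [+ _] := rP _ bz; exact.
  have fE : f x - f y = (x - y) *m J q0 + (x - y) *m E.
    apply/rowP => j; rewrite -mulmxDr !mxE; have [_ ->] := svalP (mvt j).
    rewrite mxE; apply: eq_bigr => i _; rewrite !mxE; congr (_ * _).
    by rewrite addrC subrK.
  rewrite fE mulmxDl mulmxK// opprD addrA subrr add0r normrN.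
  rewrite (le_trans (mulmx_norm_le _ _))// -/s.
  have : `|(x - y) *m E| * s <= `|x - y| * ((n * n)%:R * d) * s.
    rewrite ler_wpM2r// (le_trans (mulmx_norm_le _ _))// ler_wpM2l//.
    exact: entry_sum_le.
  move=> /le_trans; apply; rewrite [leRHS]mulrC -mulrA ler_wpM2l//.
  rewrite /d invfM mulrCA -mulrA ler_piMr// -mulrA mulrCA mulrC.
  by rewrite ler_pdivrMr// mul1r lerDl.
(* |x - y| <= |x - y| / 2 + s |f x - f y| gives the constant 2 s; the summand 1 makes it
   positive. *)
exists r, (2 * s + 1); split=> //; first by rewrite ltr_wpDl// mulr_ge0.
move=> x y bx byy; split; first exact: key.
have k1 := key _ _ bx byy.
have k2 : `|x - y| <= `|x - y - (f x - f y) *m B| + `|(f x - f y) *m B|.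
  by rewrite -{1}(subrK ((f x - f y) *m B) (x - y)) ler_normD.
have k3 := mulmx_norm_le (f x - f y) B; rewrite -/s in k3.
have k4 := normr_ge0 (f x - f y).
rewrite mulrDl mul1r.
move: k1 k2 k3 k4; rewrite [X in _ <= X -> _]mulrC.
move: `|x - y| `|x - y - _| `|_ *m B| => a b c.
move: `|f x - f y| => e k1 k2 k3 k4.
have : 2 * (s * e) = 2 * s * e by ring.
by lra.
Qed.

Lemma mulmxr_continuous (A : 'M[R]_n) : continuous (mulmxr A : 'rV[R]_n -> 'rV[R]_n).
Proof.
move=> x; apply/(continuous_normP (mulmxr A : 'rV[R]_n -> 'rV[R]_n)) => e e0.
have s0 : 0 < entry_sum A + 1 by rewrite ltr_wpDl// entry_sum_ge0.
exists (e / (entry_sum A + 1)) => [|y xy]; first by rewrite divr_gt0.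
rewrite /= -mulmxBl.
rewrite (le_lt_trans (mulmx_norm_le _ _))//.
apply: (@le_lt_trans _ _ (`|x - y| * (entry_sum A + 1))).
  by rewrite ler_wpM2l// lerDl.
by rewrite -ltr_pdivlMr.
Qed.

(** Let [k] be the increment of [g] for [h] and [A] the inverse Jacobian. Then k - h A = - (h - k J)
    A, and h - k J is the remainder of [f] for the increment [k], which is small relative to |k| <=
    C |h|. *)
Lemma local_inverse_differentiable (W : set 'rV[R]_n) g (C : R) y :
  open W -> 0 < C -> W y -> (forall z, W z -> U (g z) /\ f (g z) = z) ->
  (forall z, W z -> `|g z - g y| <= C * `|z - y|) ->
  differentiable g y /\ forall v, 'D_v g y = v *m invmx (J (g y)).
Proof.
move=> oW C0 Wy gP gC; have [Ux fx] := gP _ Wy.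
set x := g y in Ux fx gC *; set A := invmx (J x).
have uJ := J_unit Ux.
set s := entry_sum A; have s0 : 0 <= s := entry_sum_ge0 A.
apply: (norm_differentiable (L := mulmxr A)); first exact: mulmxr_continuous.
move=> e e0; pose e' := e / (s * C + 1).
have m0 : 0 < s * C + 1 by rewrite ltr_wpDl// mulr_ge0// ltW.
have e'0 : 0 < e' by rewrite divr_gt0.
have [d d0 dP] := differentiable_norm (df Ux) e'0.
have /nbhs_ballP[w /= w0 wP] : nbhs y W by exact: open_nbhs_nbhs.
exists (Num.min w (d / C)); first by rewrite lt_min w0 divr_gt0.
move=> h; rewrite lt_min => /andP[hw hd].
have Wh : W (h + y).
  by apply: wP; rewrite -ball_normE/= opprD addrA addrAC subrr add0r normrN.
pose k := g (h + y) - x.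
have kC : `|k| <= C * `|h| by have := gC _ Wh; rewrite addrK.
have kd : `|k| < d by rewrite (le_lt_trans kC)// mulrC -ltr_pdivlMr.
have := dP _ kd; rewrite /k subrK (gP _ Wh).2 fx derive_J// -/k.
rewrite opprD addrA addrK => kE.
rewrite -/x opprD addrA -/k /=.
have -> : k - h *m A = - ((h - k *m J x) *m A).
  by rewrite mulmxBl mulmxK// opprB.
rewrite normrN (le_trans (mulmx_norm_le _ _))// -/s.
apply: (@le_trans _ _ (e' * (C * `|h|) * s)).
  by rewrite ler_wpM2r// (le_trans kE)// ler_wpM2l// ltW.
have -> : e' * (C * `|h|) * s = (e' * (s * C)) * `|h| by ring.
by rewrite ler_wpM2r// /e' mulrAC ler_pdivrMr// ler_wpM2l ?ltW// ltrDl.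
Qed.

Lemma inverse_function q0 : U q0 -> exists V W g,
  [/\ open V /\ V q0, open W, V `<=` U, smooth_on W g &
      (forall q, V q -> W (f q) /\ g (f q) = q) /\
      (forall y, W y -> V (g y) /\ f (g y) = y)].
Proof.
move=> Uq0; have [r [C [r0 C0 rU H]]] := inverse_function_bounds Uq0.
set B := invmx (J q0) in H.
have uJ := J_unit Uq0.
have uB : B \in unitmx by rewrite unitmx_inv.
(* [W] is measured after applying [B]: this is the length of the first Newton step from [q0], which
   may use up half of the radius r / 2. *)
pose W := [set y | `|(y - f q0) *m B| < r / 4].
pose V := ball q0 r `&` f @^-1` W.
have r4 : 0 < r / 4 by rewrite divr_gt0.
have oW : open W.
  rewrite openE => y Wy; have := (continuous_normP _ _).1 (mulmxr_continuous (A := B) (x := y - f q0)).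
  move=> /(_ (r / 4 - `|(y - f q0) *m B|)); rewrite subr_gt0 => /(_ Wy)[e e0 eP].
  apply/nbhs_ballP; exists e => //= z; rewrite -ball_normE/= => yz.
  have := eP (z - f q0); rewrite opprB addrA subrK => /(_ yz) k.
  have := ler_normB ((y - f q0) *m B) ((y - f q0) *m B - (z - f q0) *m B).
  rewrite opprB addrC subrK /W/= => k2; move: k k2.
  by move: `|_| `|_| `|_| => a b c k k2; lra.
have inj x y : ball q0 r x -> ball q0 r y -> f x = f y -> x = y.
  move=> bx byy fxy; have [_] := H _ _ bx byy.
  by rewrite fxy subrr normr0 mulr0 normr_le0 subr_eq0 => /eqP.
have surj y : W y -> exists2 x, ball q0 r x & f x = y.
  (* Newton's map with frozen Jacobian: its fixed points solve f x = y. It maps the closed ball of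
     radius r / 2 to itself, as r / 4 comes from the contraction and r / 4 from the choice of
     [W]. *)
  move=> Wy; pose G x := x - (f x - y) *m B.
  have GE x x' : G x - G x' = x - x' - (f x - f x') *m B.
    rewrite /G !mulmxBl; move: (f x *m B) (f x' *m B) (y *m B) => a b c.
    by apply/rowP => i; rewrite !mxE; ring.
  have r2 : 0 < r / 2 by rewrite divr_gt0.
  have Dr : closed_ball q0 (r / 2) `<=` ball q0 r by exact: subset_closure_half.
  have [||x Dx|x Dx|x x' Dx Dx'|x Dx Gx] :=
    @contraction_fixpoint _ _ (closed_ball q0 (r / 2)) G.
  - exact: closed_ball_rV_compact.
  - by exists q0; exact: closed_ballxx.
  - have [k _] := H _ _ (Dr _ Dx) (ballxx q0 r0); rewrite -GE in k.
    move: Dx; rewrite closed_ballE// /closed_ball_/= => xq.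
    have k2 : `|G q0 - q0| < r / 4.
      by rewrite /G addrAC subrr add0r -mulNmx opprB.
    rewrite distrC -(subrK (G q0) (G x)) -addrA (le_trans (ler_normD _ _))//.
    rewrite distrC in xq.
    by move: k k2 xq; move: `|_| `|_| `|_| => a b c; lra.
  - apply/continuous_normP => e e0.
    have /nbhs_ballP[w /= w0 wP] : nbhs x (ball q0 r).
      by apply: open_nbhs_nbhs; split; [exact: ball_open|exact: Dr].
    exists (Num.min w e) => [|x']; first by rewrite lt_min w0.
    rewrite lt_min => /andP[xw xe]; have bx : ball q0 r x'.
      by apply: wP; rewrite -ball_normE.
    rewrite GE; have [k _] := H _ _ (Dr _ Dx) bx.
    by move: k xe; move: `|_| `|_| => a b k ae; lra.
  - by have [k _] := H _ _ (Dr _ Dx) (Dr _ Dx'); rewrite GE.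
  - exists x; first exact: Dr.
    have : (f x - y) *m B = 0.
      move: Gx; rewrite /G; move: (_ *m _) => w xw.
      by rewrite -[w]opprK -(addKr x (- w)) xw addNr oppr0.
    by move=> /(congr1 (mulmxr (J q0))) /=; rewrite mulmxKV// mul0mx
      => /eqP; rewrite subr_eq0 => /eqP.
have : forall y, exists x, W y -> ball q0 r x /\ f x = y.
  move=> y; have [Wy|nWy] := pselect (W y); last by exists 0.
  by have [x bx fx] := surj y Wy; exists x.
move=> /choice[g gP].
have gU z : W z -> U (g z) /\ f (g z) = z.
  by move=> /gP[bz fz]; split=> //; exact: rU.
have gC y z : W y -> W z -> `|g z - g y| <= C * `|z - y|.
  move=> Wy Wz; have [by1 fy] := gP y Wy; have [bz fz] := gP z Wz.
  by have [_] := H _ _ bz by1; rewrite fy fz.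
have gD y (Wy : W y) := local_inverse_differentiable oW C0 Wy gU (fun z Wz => gC y z Wy Wz).
exists V, W, g; split=> //.
- split; last first.
    by split; [exact: ballxx|rewrite /W/= subrr mul0mx normr0].
  rewrite openE => q [bq Wq]; apply: filterI.
    by apply: open_nbhs_nbhs; split=> //; exact: ball_open.
  have cf : {for q, continuous f} by apply/differentiable_continuous/df/rU.
  by apply: cf; exact: open_nbhs_nbhs.
- by move=> q [/rU].
(* ['D_v g] is [v] times the inverse Jacobian at [g y]: if [g] is of class C^k, so is its
   derivative, and [g] is of class C^(k+1). *)
- elim=> [|k IH].
    by move=> y Wy; apply/differentiable_continuous; exact: (gD y Wy).1.
  split=> [y Wy|v]; first exact: (gD y Wy).1.
  apply/(Ck_rVP k _ oW) => j.
  have cJ a b : Ck W k (fun y => J (g y) a b).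
    apply: (Ck_comp oW oU _ IH (J_Ck k a b)) => y Wy.
    exact: (gU y Wy).1.
  have uJg y : W y -> J (g y) \in unitmx by move=> /gU[/J_unit].
  have cI := Ck_invmx oW uJg cJ.
  apply: Ck_ext (Ck_sum oW (index_enum 'I_n) xpredT
    (fun a => CkM oW (Ck_cst W k (v 0 a)) (cI a j))) => // y Wy.
  by rewrite (gD y Wy).2 mxE.
- split=> [q [bq Wq]|y Wy].
    split=> //; have [bg fg] := gP _ Wq.
    exact: inj.
  have [bg fg] := gP _ Wy; split=> //; split=> //.
  by rewrite /= fg.
Qed.

End InverseFunction.

(** * The Minkowski form *)

Section Minkowski.
Context {R : realType}.
Implicit Types (x y z p : E6 R) (a : R).

Let sg (i : 'I_6) : R := if i == 0 then -1 else 1.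

Lemma minkE x y : mink x y = \sum_i sg i * x 0 i * y 0 i.
Proof.
rewrite /mink [RHS]big_ord_recl /sg/= mulN1r mulNr; congr (_ + _).
by apply: eq_bigr => i _; rewrite mul1r.
Qed.

Lemma minkC x y : mink x y = mink y x.
Proof. by rewrite !minkE; apply: eq_bigr => i _; rewrite mulrAC. Qed.

Lemma minkDl x y z : mink (x + y) z = mink x z + mink y z.
Proof.
by rewrite !minkE -big_split; apply: eq_bigr => i _; rewrite /= mxE mulrDr mulrDl.
Qed.

Lemma minkZl a x y : mink (a *: x) y = a * mink x y.
Proof. by rewrite !minkE mulr_sumr; apply: eq_bigr => i _; rewrite mxE; ring. Qed.

Lemma minkDr x y z : mink z (x + y) = mink z x + mink z y.
Proof. by rewrite minkC minkDl !(minkC z). Qed.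

Lemma minkZr a x y : mink y (a *: x) = a * mink y x.
Proof. by rewrite minkC minkZl minkC. Qed.

Lemma minkNl x y : mink (- x) y = - mink x y.
Proof. by rewrite -scaleN1r minkZl mulN1r. Qed.

Lemma minkNr x y : mink y (- x) = - mink y x.
Proof. by rewrite -scaleN1r minkZr mulN1r. Qed.

Lemma mink0l x : mink 0 x = 0.
Proof. by rewrite -(scale0r 0) minkZl mul0r. Qed.

Lemma mink0r x : mink x 0 = 0.
Proof. by rewrite minkC mink0l. Qed.

Lemma mink_suml I (s : seq I) P (F : I -> E6 R) x :
  mink (\sum_(i <- s | P i) F i) x = \sum_(i <- s | P i) mink (F i) x.
Proof.
by elim/big_rec2: _ => [|i a y _ <-]; rewrite ?mink0l// minkDl.
Qed.

Lemma mink_dt x : mink x dt = - x 0 0.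
Proof.
rewrite minkE big_ord_recl big1 => [|i _]; last by rewrite /dt mxE/= mulr0.
by rewrite /sg /dt mxE/=; ring.
Qed.

Lemma mink_dtdt : mink dt dt = -1 :> R.
Proof. by rewrite mink_dt /dt mxE. Qed.

Lemma unormalE p : unormal p = p + mink p dt *: dt.
Proof.
apply/rowP => i; rewrite mink_dt !mxE eqxx/=.
by case: eqP => [->|]; rewrite ?mulr1 ?subrr// mulr0 addr0.
Qed.

Definition minkL := (minkDl, minkDr, minkZl, minkZr, minkNl, minkNr).

Lemma mink_unormal x y : mink x (unormal y) = mink x y + mink x dt * mink y dt.
Proof. by rewrite unormalE !minkL mulrC. Qed.

Lemma mink_unormal_dt x : mink (unormal x) dt = 0.
Proof. by rewrite unormalE !minkL mink_dtdt; ring. Qed.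

Lemma RxS4P p : RxS4 p <-> mink p (unormal p) = 1.
Proof.
rewrite /RxS4/= /mink /unormal mxE/= mulr0 oppr0 add0r.
by under [X in _ <-> X = _]eq_bigr do rewrite mxE/= -expr2.
Qed.

Lemma mink_spacelike x : x 0 0 = 0 -> x != 0 -> 0 < mink x x.
Proof.
move=> x0 xn; have H : mink x x = \sum_(i < 5) x 0 (lift 0 i) ^+ 2.
  by rewrite /mink x0 mulr0 oppr0 add0r; apply: eq_bigr => i _; rewrite expr2.
rewrite H lt_def sumr_ge0 ?andbT => [|i _]; last exact: sqr_ge0.
apply: contra xn => /eqP /psumr_eq0P H0; apply/eqP/rowP => j; rewrite mxE.
have [->//|/eqP j0] := eqVneq j 0.
case: (unliftP 0 j) => [i ->|//].
by apply/eqP; rewrite -sqrf_eq0 H0// => k _; exact: sqr_ge0.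
Qed.

(** The combination [z] of [x] and [y] without time coordinate is spacelike or zero, and by
    orthogonality its square is x_0^2 <y, y> + y_0^2 <x, x>; as the first term is negative, <x, x>
    must be positive. *)
Lemma mink_orth_timelike x y : mink y y < 0 -> mink x y = 0 -> x != 0 ->
  0 < mink x x.
Proof.
move=> yy xy xn.
have [x0|x0] := eqVneq (x 0 0) 0; first exact: mink_spacelike.
pose z := x 0 0 *: y - y 0 0 *: x.
have z0 : z 0 0 = 0 by rewrite !mxE; ring.
have zz : mink z z = x 0 0 ^+ 2 * mink y y + y 0 0 ^+ 2 * mink x x.
  by rewrite /z !minkL (minkC y x) xy; ring.
have zge : 0 <= mink z z.
  have [->|zn] := eqVneq z 0; first by rewrite mink0l.
  exact/ltW/mink_spacelike.
rewrite zz in zge; have x2 : 0 < x 0 0 ^+ 2 by rewrite exprn_even_gt0.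
have y2 : 0 <= y 0 0 ^+ 2 by exact: sqr_ge0.
rewrite ltNge; apply/negP => xx.
have : x 0 0 ^+ 2 * mink y y < 0 by rewrite pmulr_rlt0.
have : y 0 0 ^+ 2 * mink x x <= 0 by rewrite mulr_ge0_le0.
by move: zge; move: (_ * _) (_ * _) => a b; lra.
Qed.

Section Frame.
Variable w : 'I_6 -> E6 R.
Hypothesis w_orth : forall i j, i != j -> mink (w i) (w j) = 0.
Hypothesis w_nonnull : forall i, mink (w i) (w i) != 0.

(** [A *m B] is the Gram matrix of the [w i], diagonal without zero entry; hence [B], which computes
    the products with the [w i], is invertible. The signs of the squares are left free, since the
    frames contain a timelike vector. *)
Lemma frame_eq0 x : (forall i, mink x (w i) = 0) -> x = 0.
Proof.
move=> xw; pose A : 'M[R]_6 := \matrix_(i, j) w i 0 j.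
pose B : 'M[R]_6 := \matrix_(i, j) (sg i * w j 0 i).
have mB y j : (y *m B) 0 j = mink y (w j).
  by rewrite mxE minkE; apply: eq_bigr => i _; rewrite mxE; ring.
have AB : A *m B = diag_mx (\row_i mink (w i) (w i)).
  apply/matrixP => i j; have -> : (A *m B) i j = (w i *m B) 0 j.
    by rewrite !mxE; apply: eq_bigr => k _; rewrite !mxE.
  by rewrite mB !mxE; case: eqVneq => [->|/w_orth].
have uAB : A *m B \in unitmx.
  by rewrite AB unitmxE det_diag unitfE prodf_seq_neq0; apply/allP => i _ /=;
     rewrite mxE.
have uB : B \in unitmx by move: uAB; rewrite unitmx_mul => /andP[].
have : x *m B = 0 by apply/rowP => j; rewrite mB xw mxE.
by move=> /(congr1 (mulmxr (invmx B))) /=; rewrite mulmxK// mul0mx.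
Qed.

Lemma frame_expand x : x = \sum_i (mink x (w i) / mink (w i) (w i)) *: w i.
Proof.
apply/eqP; rewrite -subr_eq0; apply/eqP/frame_eq0 => j.
rewrite minkDl minkNl mink_suml (bigD1 j)//= big1 => [|i ij].
  by rewrite minkZl divfK// addr0 subrr.
by rewrite minkZl (w_orth ij) mulr0.
Qed.

End Frame.

Lemma frame6_eq0 (w0 w1 w2 w3 w4 w5 x : E6 R) :
  [/\ mink w0 w0 != 0, mink w1 w1 != 0 & mink w2 w2 != 0] ->
  [/\ mink w3 w3 != 0, mink w4 w4 != 0 & mink w5 w5 != 0] ->
  [/\ mink w0 w1 = 0, mink w0 w2 = 0, mink w0 w3 = 0, mink w0 w4 = 0 & mink w0 w5 = 0] ->
  [/\ mink w1 w2 = 0, mink w1 w3 = 0, mink w1 w4 = 0 & mink w1 w5 = 0] ->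
  [/\ mink w2 w3 = 0, mink w2 w4 = 0 & mink w2 w5 = 0] ->
  [/\ mink w3 w4 = 0, mink w3 w5 = 0 & mink w4 w5 = 0] ->
  [/\ mink x w0 = 0, mink x w1 = 0 & mink x w2 = 0] ->
  [/\ mink x w3 = 0, mink x w4 = 0 & mink x w5 = 0] -> x = 0.
Proof.
move=> [n0 n1 n2] [n3 n4 n5] [h1 h2 h3 h4 h5] [h6 h7 h8 h9] [p0 p1 p2] [p3 p4 p5].
move=> [x0 x1 x2] [x3 x4 x5].
pose w (i : 'I_6) := nth 0 [:: w0; w1; w2; w3; w4; w5] i.
apply: (@frame_eq0 w).
- move=> [i Hi] [j Hj]; do 6?[case: i Hi => [|i] Hi]; do 6?[case: j Hj => [|j] Hj];
    rewrite //= => _; rewrite /w /=; solve [assumption | by rewrite minkC].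
- by move=> [i Hi]; do 6?[case: i Hi => [|i] Hi].
- by move=> [i Hi]; do 6?[case: i Hi => [|i] Hi].
Qed.
End Minkowski.

Section MinkowskiCalculus.
Context {R : realType} {V : normedModType R}.

Lemma is_derive_mink (f g : V -> E6 R) q v df dg :
  is_derive q v f df -> is_derive q v g dg ->
  is_derive q v (fun x => mink (f x) (g x)) (mink df (g q) + mink (f q) dg).
Proof.
move=> /is_derive_rVP Hf /is_derive_rVP Hg.
pose F (i : 'I_6) (x : V) : R := (if i == 0 then -1 else 1) * f x 0 i * g x 0 i.
have -> : (fun x => mink (f x) (g x)) = \sum_i F i.
  by apply/funext => x; rewrite minkE fct_sumE.
rewrite !minkE -big_split/=; apply: is_derive_sum => i.
pose c : R := if i == 0 then -1 else 1.
have -> : F i = c *: ((fun x => f x 0 i) * (fun x => g x 0 i)).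
  by apply/funext => x; rewrite /F -mulrA.
have H := is_deriveZ c (is_deriveM (Hf i) (Hg i)).
apply: (is_derive_eq H); rewrite -/c -![_ *: _]/(_ * _); ring.
Qed.

Lemma Ck_mink U k (f g : V -> E6 R) : open U -> Ck U k f -> Ck U k g ->
  Ck U k (fun x => mink (f x) (g x)).
Proof.
move=> oU /(Ck_rVP k _ oU) cf /(Ck_rVP k _ oU) cg.
apply: Ck_ext (Ck_sum oU (index_enum 'I_6) xpredT (fun i =>
  CkM oU (CkM oU (Ck_cst U k (if i == 0 then -1 else 1 : R)) (cf i)) (cg i))) => //.
by move=> y _; rewrite minkE.
Qed.

End MinkowskiCalculus.

Section SmoothClosure.
Context {R : realType} {V : normedModType R}.
Variable U : set V.
Hypothesis oU : open U.
Implicit Types (q v : V) (n : nat).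

Lemma smooth_ext (W : normedModType R) (f g : V -> W) :
  (forall y, U y -> f y = g y) -> smooth_on U f -> smooth_on U g.
Proof. by move=> fg sf k; exact: Ck_ext fg (sf k). Qed.

Lemma smooth_cst (W : normedModType R) (w : W) : smooth_on U (fun _ : V => w).
Proof. by move=> k; exact: Ck_cst. Qed.

Lemma smooth_rVP n (f : V -> 'rV[R]_n) :
  smooth_on U f <-> forall i, smooth_on U (fun y => f y 0 i).
Proof.
split=> [sf i k|sf k]; first exact: (Ck_rVP k f oU).1.
by apply/Ck_rVP => // i; exact: sf.
Qed.

Lemma smoothD (f g : V -> R) : smooth_on U f -> smooth_on U g ->
  smooth_on U (fun y => f y + g y).
Proof. by move=> sf sg k; exact: CkD. Qed.

Lemma smoothM (f g : V -> R) : smooth_on U f -> smooth_on U g ->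
  smooth_on U (fun y => f y * g y).
Proof. by move=> sf sg k; exact: CkM. Qed.

Lemma smoothN (f : V -> R) : smooth_on U f -> smooth_on U (fun y => - f y).
Proof.
move=> sf; have := smoothM (smooth_cst (-1 : R)) sf.
by apply: smooth_ext => y _; rewrite mulN1r.
Qed.

Lemma smoothV (f : V -> R) : (forall x, U x -> f x != 0) -> smooth_on U f ->
  smooth_on U (fun y => (f y)^-1).
Proof. by move=> f0 sf k; exact: CkV. Qed.

Lemma smoothD_rV n (f g : V -> 'rV[R]_n) : smooth_on U f -> smooth_on U g ->
  smooth_on U (fun y => f y + g y).
Proof.
move=> /smooth_rVP sf /smooth_rVP sg; apply/smooth_rVP => i.
by apply: smooth_ext (smoothD (sf i) (sg i)) => y _; rewrite mxE.
Qed.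

Lemma smoothZ n (a : V -> R) (f : V -> 'rV[R]_n) : smooth_on U a ->
  smooth_on U f -> smooth_on U (fun y => a y *: f y).
Proof.
move=> sa /smooth_rVP sf; apply/smooth_rVP => i.
by apply: smooth_ext (smoothM sa (sf i)) => y _; rewrite mxE.
Qed.

Lemma smoothN_rV n (f : V -> 'rV[R]_n) : smooth_on U f ->
  smooth_on U (fun y => - f y).
Proof.
move=> sf; have := smoothZ (smooth_cst (-1 : R)) sf.
by apply: smooth_ext => y _; rewrite scaleN1r.
Qed.

Lemma smooth_mink (f g : V -> E6 R) : smooth_on U f -> smooth_on U g ->
  smooth_on U (fun y => mink (f y) (g y)).
Proof. by move=> sf sg k; exact: Ck_mink. Qed.

Lemma smooth_derive (W : normedModType R) v (f : V -> W) : smooth_on U f ->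
  smooth_on U ('D_v f).
Proof. by move=> sf k; exact: (sf k.+1).2. Qed.

Lemma smooth_differentiable (W : normedModType R) (f : V -> W) q :
  smooth_on U f -> U q -> differentiable f q.
Proof. by move=> sf Uq; exact: (sf 1).1. Qed.

Lemma smooth_is_derive (W : normedModType R) (f : V -> W) q v :
  smooth_on U f -> U q -> is_derive q v f ('D_v f q).
Proof.
by move=> sf Uq; apply: derivableP; apply: diff_derivable; exact: smooth_differentiable Uq.
Qed.

Lemma smooth_comp n (U' : set 'rV[R]_n) (f : V -> 'rV[R]_n) (g : 'rV[R]_n -> R) :
  open U' -> (forall x, U x -> U' (f x)) -> smooth_on U f -> smooth_on U' g ->
  smooth_on U (g \o f).
Proof. by move=> oU' H sf sg k; exact: Ck_comp oU oU' H (sf k) (sg k). Qed.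

Lemma smooth_comp_rV n m (U' : set 'rV[R]_n) (f : V -> 'rV[R]_n)
    (g : 'rV[R]_n -> 'rV[R]_m) :
  open U' -> (forall x, U x -> U' (f x)) -> smooth_on U f -> smooth_on U' g ->
  smooth_on U (g \o f).
Proof.
move=> oU' H sf sg; apply/smooth_rVP => i.
apply: (@smooth_comp _ U' f (fun y => g y 0 i)) => // k.
exact: (Ck_rVP k g oU').1 (sg k) i.
Qed.

Lemma derive_unique (W : normedModType R) (f : V -> W) q v df :
  is_derive q v f df -> 'D_v f q = df.
Proof. by move=> H; exact: derive_val. Qed.

Lemma derive_mink (f g : V -> E6 R) q v : smooth_on U f -> smooth_on U g -> U q ->
  'D_v (fun y => mink (f y) (g y)) q = mink ('D_v f q) (g q) + mink (f q) ('D_v g q).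
Proof.
by move=> sf sg Uq; apply: derive_unique; apply: is_derive_mink;
  exact: smooth_is_derive.
Qed.

Lemma is_deriveZ_rV n (a : V -> R) (f : V -> 'rV[R]_n) q v da df :
  is_derive q v a da -> is_derive q v f df ->
  is_derive q v (fun y => a y *: f y) (da *: f q + a q *: df).
Proof.
move=> Ha /is_derive_rVP Hf; apply/is_derive_rVP => i.
have H := is_deriveM Ha (Hf i).
have -> : (fun y => (a y *: f y) 0 i) = a * (fun y => f y 0 i).
  by apply/funext => y; rewrite mxE.
by apply: (is_derive_eq H); rewrite -![_ *: _]/(_ * _) !mxE; ring.
Qed.

Lemma deriveZ_rV n (a : V -> R) (f : V -> 'rV[R]_n) q v :
  smooth_on U a -> smooth_on U f -> U q ->
  'D_v (fun y => a y *: f y) q = 'D_v a q *: f q + a q *: 'D_v f q.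
Proof.
by move=> sa sf Uq; apply: derive_unique; apply: is_deriveZ_rV;
  exact: smooth_is_derive.
Qed.

Lemma deriveD_fun (W : normedModType R) (f g : V -> W) q v :
  smooth_on U f -> smooth_on U g -> U q ->
  'D_v (fun y => f y + g y) q = 'D_v f q + 'D_v g q.
Proof.
by move=> sf sg Uq; apply: derive_unique; apply: is_deriveD;
  exact: smooth_is_derive.
Qed.

Lemma deriveM_fun (f g : V -> R) q v : smooth_on U f -> smooth_on U g -> U q ->
  'D_v (fun y => f y * g y) q = 'D_v f q * g q + f q * 'D_v g q.
Proof.
move=> sf sg Uq; apply: derive_unique.
have H := is_deriveM (smooth_is_derive v sf Uq) (smooth_is_derive v sg Uq).
by apply: (is_derive_eq H); rewrite -![_ *: _]/(_ * _); ring.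
Qed.

Lemma derive_cst_on (W : normedModType R) (f : V -> W) (w : W) q v :
  (forall y, U y -> f y = w) -> U q -> 'D_v f q = 0.
Proof.
by move=> fw Uq; rewrite (@near_eq_deriveU _ _ _ U f (cst w) q v oU Uq fw) derive_cst.
Qed.

Lemma derive_comm_smooth n (f : V -> 'rV[R]_n) q u v : smooth_on U f -> U q ->
  'D_u ('D_v f) q = 'D_v ('D_u f) q.
Proof. by move=> sf Uq; exact: (derive_comm_rV u v oU Uq (sf 2)). Qed.

End SmoothClosure.

Lemma ord2P (P : 'I_2 -> Prop) : P 0 -> P 1 -> forall i, P i.
Proof.
move=> P0 P1 i; case: (unliftP 0 i) => [j ->|->//].
by rewrite (_ : lift 0 j = 1)//; apply/val_inj; rewrite /= (ord1 j).
Qed.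

Lemma sum_ord2 (W : nmodType) (F : 'I_2 -> W) : \sum_i F i = F 0 + F 1.
Proof.
rewrite big_ord_recl big_ord1; congr (_ + F _).
by apply/val_inj.
Qed.

Lemma invmx2 (F : fieldType) (A : 'M[F]_2) (a b c : F) :
  A 0 0 = a -> A 0 1 = b -> A 1 0 = b -> A 1 1 = c -> a * c - b * b != 0 ->
  [/\ invmx A 0 0 = c / (a * c - b * b), invmx A 0 1 = - b / (a * c - b * b),
      invmx A 1 0 = - b / (a * c - b * b) & invmx A 1 1 = a / (a * c - b * b)].
Proof.
move=> Aa Ab Ab' Ac d0; set d := a * c - b * b in d0 *.
pose B : 'M[F]_2 := \matrix_(i, j)
  if i == 0 then (if j == 0 then c / d else - b / d)
  else (if j == 0 then - b / d else a / d).
have AB : A *m B = 1%:M.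
  apply/matrixP; apply: ord2P; apply: ord2P;
  rewrite !mxE sum_ord2 !mxE/= ?Aa ?Ab ?Ab' ?Ac; rewrite /d in d0 *; by field.
have uA : A \in unitmx by case/mulmx1_unit: AB.
have -> : invmx A = B by rewrite -[RHS]mul1mx -(mulVmx uA) -mulmxA AB mulmx1.
by rewrite !mxE.
Qed.

(** * Local geometry of a surface in R x S^4 *)

Section Gram.
Context {R : realType}.
Implicit Types (a b w x : E6 R).

Definition gdet a b : R := mink a a * mink b b - mink a b * mink a b.

(** The orthogonal projection of [w] to the span of [a] and [b], by Cramer's rule. *)
Definition tan2 a b w : E6 R :=
  ((mink b b * mink w a - mink a b * mink w b) / gdet a b) *: a +
  ((mink a a * mink w b - mink a b * mink w a) / gdet a b) *: b.

(** The metric trace of a bilinear form on the span of [a] and [b], given by its values on the pairs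
    of basis vectors. *)
Definition tr2 a b (B00 B01 B10 B11 : R) : R :=
  (mink b b * B00 - mink a b * (B01 + B10) + mink a a * B11) / gdet a b.

Lemma tr2_eq0 a b (B00 B01 B10 B11 : R) :
  B00 = 0 -> B01 = 0 -> B10 = 0 -> B11 = 0 -> tr2 a b B00 B01 B10 B11 = 0.
Proof. by move=> -> -> -> ->; rewrite /tr2 addr0 !mulr0 subrr addr0 mul0r. Qed.

Lemma mink_tan2l a b w : gdet a b != 0 -> mink (tan2 a b w) a = mink w a.
Proof.
by rewrite /tan2 !minkL (minkC b a) /gdet => d0; field; exact: d0.
Qed.

Lemma mink_tan2r a b w : gdet a b != 0 -> mink (tan2 a b w) b = mink w b.
Proof. by rewrite /tan2 !minkL /gdet => d0; field; exact: d0. Qed.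

Lemma tan2_lincomb a b (r s : R) : gdet a b != 0 ->
  tan2 a b (r *: a + s *: b) = r *: a + s *: b.
Proof.
rewrite /tan2 !minkL (minkC b a) /gdet => d0.
by congr (_ *: _ + _ *: _); field; exact: d0.
Qed.

Lemma tan2_sqr a b w : gdet a b != 0 -> mink (tan2 a b w) (tan2 a b w) =
  tr2 a b (mink w a * mink w a) (mink w a * mink w b)
          (mink w b * mink w a) (mink w b * mink w b).
Proof.
move=> d0; have [ta tb] := (mink_tan2l w d0, mink_tan2r w d0).
by rewrite [X in mink X _ = _]/tan2 minkDl !minkZl
  (minkC a (tan2 a b w)) ta (minkC b (tan2 a b w)) tb /tr2; ring.
Qed.

(** The vector - <a, b> a + <a, a> b, which is orthogonal to [a], has square <a, a> times the Gram
    determinant. *)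
Lemma gdet_gt0 a b :
  (forall r s : R, (r != 0) || (s != 0) -> 0 < mink (r *: a + s *: b) (r *: a + s *: b)) ->
  0 < gdet a b.
Proof.
move=> H; have := H 1 0; rewrite oner_neq0 scale1r scale0r addr0 => /(_ isT) E0.
have := H (- mink a b) (mink a a).
rewrite (gt_eqF E0) orbT => /(_ isT).
rewrite !minkL (minkC b a) /gdet.
move: E0; move: (mink _ _) (mink _ _) (mink _ _) => E B G E0 H'.
by rewrite -(pmulr_rgt0 _ E0); apply: (lt_le_trans H'); rewrite le_eqVlt;
   apply/orP; left; apply/eqP; ring.
Qed.

Lemma gram_invmx (x : 'I_2 -> E6 R) : gdet (x 0) (x 1) != 0 ->
  let A : 'M[R]_2 := invmx (\matrix_(i, j) mink (x i) (x j)) in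
  [/\ A 0 0 = mink (x 1) (x 1) / gdet (x 0) (x 1),
      A 0 1 = - mink (x 0) (x 1) / gdet (x 0) (x 1),
      A 1 0 = - mink (x 0) (x 1) / gdet (x 0) (x 1) &
      A 1 1 = mink (x 0) (x 0) / gdet (x 0) (x 1)].
Proof.
move=> d0 A; apply: invmx2; [by rewrite mxE|by rewrite mxE| |by rewrite mxE|exact: d0].
by rewrite mxE minkC.
Qed.

Definition gtrace (x : 'I_2 -> E6 R) (B : 'I_2 -> 'I_2 -> E6 R) : E6 R :=
  \sum_i \sum_j invmx (\matrix_(i, j) mink (x i) (x j)) i j *: B i j.

Lemma gtraceE (x : 'I_2 -> E6 R) B : gdet (x 0) (x 1) != 0 ->
  gtrace x B = (gdet (x 0) (x 1))^-1 *: (mink (x 1) (x 1) *: B 0 0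
    - mink (x 0) (x 1) *: (B 0 1 + B 1 0) + mink (x 0) (x 0) *: B 1 1).
Proof.
move=> /gram_invmx[i00 i01 i10 i11]; rewrite /gtrace !sum_ord2 i00 i01 i10 i11.
move: (mink (x 1) (x 1)) (mink (x 0) (x 1)) (mink (x 0) (x 0)) (gdet _ _).
by move=> g11 g01 g00 d; apply/rowP => k; rewrite !mxE; ring.
Qed.

Lemma gtrace_tan2 (x : 'I_2 -> E6 R) w : gdet (x 0) (x 1) != 0 ->
  gtrace x (fun i j => mink w (x i) *: x j) = tan2 (x 0) (x 1) w.
Proof.
move=> d0; rewrite gtraceE// /tan2; move: (gdet _ _) => d.
by apply/rowP => k; rewrite !mxE; ring.
Qed.

Lemma mink_gtrace (x : 'I_2 -> E6 R) B w : gdet (x 0) (x 1) != 0 ->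
  mink (gtrace x B) w = tr2 (x 0) (x 1) (mink (B 0 0) w) (mink (B 0 1) w)
    (mink (B 1 0) w) (mink (B 1 1) w).
Proof. by move=> d0; rewrite gtraceE// /tr2 !minkL; ring. Qed.

(** For [w] = [dt] the form <x, y> + <x, w> <y, w> is, up to sign, the second fundamental form of R
    x S^4 in E^6_1; its trace over the tangent plane is 2 + |T|^2. *)
Lemma tr2_ambient (a b w : E6 R) (B00 B01 B10 B11 t : R) : gdet a b != 0 ->
  tr2 a b (B00 + (mink a a + mink a w * mink a w) * t)
    (B01 + (mink a b + mink a w * mink b w) * t)
    (B10 + (mink b a + mink b w * mink a w) * t)
    (B11 + (mink b b + mink b w * mink b w) * t) =
  tr2 a b B00 B01 B10 B11 + (2 + mink (tan2 a b w) (tan2 a b w)) * t.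
Proof.
move=> d0; rewrite tan2_sqr// /tr2 (minkC b a) !(minkC w).
by rewrite /gdet in d0 *; field.
Qed.

End Gram.

(* Unfolding [derive] during conversion is prohibitively expensive, hence this
   sealed copy of [pd]. *)
Lemma pD_subproof (R : realType) (W : normedModType R) :
  {D : 'I_2 -> (E2 R -> W) -> E2 R -> W | D = pd}.
Proof. by exists pd. Qed.

Definition pD (R : realType) (W : normedModType R) : 'I_2 -> (E2 R -> W) -> E2 R -> W :=
  sval (pD_subproof W).

Lemma pdE (R : realType) (W : normedModType R) : @pd R W = @pD R W.
Proof. exact: (esym (svalP (pD_subproof W))). Qed.

Lemma pD_derive (R : realType) (W : normedModType R) i (V : E2 R -> W) :
  pD i V = 'D_(delta_mx 0 i) V.
Proof. by rewrite -(pdE W). Qed.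

Lemma pD_deriveE (R : realType) (W : normedModType R) i (V : E2 R -> W) q :
  pD i V q = 'D_(delta_mx 0 i) V q.
Proof. by rewrite pD_derive. Qed.

Lemma derive_pD (R : realType) (W : normedModType R) (V : E2 R -> W) q v :
  differentiable V q -> 'D_v V q = v 0 0 *: pD 0 V q + v 0 1 *: pD 1 V q.
Proof. by move=> dV; rewrite (derive_sum_coord v dV) sum_ord2 !pD_derive. Qed.

Lemma pD_cst (R : realType) (W : normedModType R) i (w : W) q :
  pD i (fun _ => w) q = 0.
Proof. by rewrite pD_derive; exact: derive_cst. Qed.

Section LocalSurface.
Context {R : realType}.
Variables (U : set (E2 R)) (f : E2 R -> E6 R).
Hypotheses (oU : open U) (sf : smooth_on U f).
Hypothesis fS : forall q, U q -> RxS4 (f q).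
Hypothesis f_pos : forall q, U q -> forall v : E2 R, v != 0 ->
  0 < mink ('D_v f q) ('D_v f q).
Implicit Types (q : E2 R) (w x : E6 R) (i j : 'I_2).

Definition gram_det q := gdet (pD 0 f q) (pD 1 f q).

Lemma derive_pd_on q v : U q -> 'D_v f q = v 0 0 *: pD 0 f q + v 0 1 *: pD 1 f q.
Proof.
by move=> Uq; apply: derive_pD; exact: smooth_differentiable Uq.
Qed.

Lemma pD_lincomb_gt0 q a b : U q -> (a != 0) || (b != 0) ->
  0 < mink (a *: pD 0 f q + b *: pD 1 f q) (a *: pD 0 f q + b *: pD 1 f q).
Proof.
move=> Uq ab; pose v : E2 R := \row_i if i == 0 then a else b.
have v0 : v 0 0 = a by rewrite mxE.
have v1 : v 0 1 = b by rewrite mxE.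
have vn : v != 0.
  apply: contraTN ab => /eqP v00.
  by rewrite -v0 -v1 v00 !mxE eqxx.
by have := f_pos Uq vn; rewrite derive_pd_on// v0 v1.
Qed.

Lemma gram_det_gt0 q : U q -> 0 < gram_det q.
Proof. by move=> Uq; apply: gdet_gt0 => r s; exact: pD_lincomb_gt0. Qed.

Lemma gram_det_neq0 q : U q -> gram_det q != 0.
Proof. by move=> /gram_det_gt0/lt0r_neq0. Qed.

Lemma trace_g_gtrace q B : trace_g f q B = gtrace (fun i => pD i f q) B.
Proof. by rewrite /trace_g /fform_inv /fform pdE. Qed.

Lemma trace_gE q (B : 'I_2 -> 'I_2 -> E6 R) : U q ->
  trace_g f q B = (gram_det q)^-1 *: (mink (pD 1 f q) (pD 1 f q) *: B 0 0
    - mink (pD 0 f q) (pD 1 f q) *: (B 0 1 + B 1 0)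
    + mink (pD 0 f q) (pD 0 f q) *: B 1 1).
Proof.
move=> Uq; rewrite trace_g_gtrace.
exact: (@gtraceE _ (fun i => pD i f q) B (gram_det_neq0 Uq)).
Qed.

Lemma tangE q w : U q -> tang f q w = tan2 (pD 0 f q) (pD 1 f q) w.
Proof.
move=> Uq; rewrite /tang pdE trace_g_gtrace.
exact: (@gtrace_tan2 _ (fun i => pD i f q) w (gram_det_neq0 Uq)).
Qed.

Lemma mink_tang q w i : U q -> mink (tang f q w) (pD i f q) = mink w (pD i f q).
Proof.
move=> Uq; rewrite tangE//; have d0 := gram_det_neq0 Uq; move: i; apply: ord2P.
  exact: mink_tan2l.
exact: mink_tan2r.
Qed.

Lemma tang_orth q w x : U q -> (forall i, mink x (pD i f q) = 0) ->
  mink x (tang f q w) = 0.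
Proof.
by move=> Uq xF; rewrite tangE// /tan2 minkDr !minkZr xF xF !mulr0 addr0.
Qed.

Lemma tang_eq0 q w : U q ->
  tang f q w = 0 <-> (forall i, mink w (pD i f q) = 0).
Proof.
move=> Uq; split=> [w0 i|w0]; first by rewrite -mink_tang// w0 mink0l.
by rewrite tangE// /tan2 w0 w0 !mulr0 !subrr !mul0r !scale0r addr0.
Qed.

Lemma norm_part_orth q w i : U q -> mink (norm_part f q w) (pD i f q) = 0.
Proof. by move=> Uq; rewrite /norm_part !minkL mink_tang// subrr. Qed.

Lemma smooth_pD i : smooth_on U (pD i f).
Proof. by rewrite pD_derive; exact: smooth_derive. Qed.

Lemma smooth_gram i j : smooth_on U (fun q => mink (pD i f q) (pD j f q)).
Proof. by apply: smooth_mink => //; exact: smooth_pD. Qed.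

Lemma smooth_gram_det_inv : smooth_on U (fun q => (gram_det q)^-1).
Proof.
apply: smoothV => //; first exact: gram_det_neq0.
apply: smoothD => //; first by apply: smoothM => //; exact: smooth_gram.
by apply: smoothN => //; apply: smoothM => //; exact: smooth_gram.
Qed.

Lemma smooth_trace_g (B : 'I_2 -> 'I_2 -> E2 R -> E6 R) :
  (forall i j, smooth_on U (B i j)) ->
  smooth_on U (fun q => trace_g f q (fun i j => B i j q)).
Proof.
move=> sB; have sg := smooth_gram.
have s1 := smoothD_rV oU (smoothD_rV oU (smoothZ oU (sg 1 1) (sB 0 0))
  (smoothN_rV oU (smoothZ oU (sg 0 1) (smoothD_rV oU (sB 0 1) (sB 1 0)))))
  (smoothZ oU (sg 0 0) (sB 1 1)).
apply: (smooth_ext oU _ (smoothZ oU smooth_gram_det_inv s1)) => q Uq.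
by rewrite trace_gE.
Qed.

Lemma smooth_tang (W : E2 R -> E6 R) : smooth_on U W ->
  smooth_on U (fun q => tang f q (W q)).
Proof.
move=> sW; rewrite /tang pdE; apply: (smooth_trace_g (B := fun i j q => mink (W q) (pD i f q) *: pD j f q)).
move=> i j; apply: (smoothZ oU _ (smooth_pD j)).
exact: (smooth_mink oU sW (smooth_pD i)).
Qed.

Lemma smooth_norm_part (W : E2 R -> E6 R) : smooth_on U W ->
  smooth_on U (fun q => norm_part f q (W q)).
Proof.
by move=> sW; apply: (smoothD_rV oU sW); apply: smoothN_rV => //; exact: smooth_tang.
Qed.

Lemma smooth_mink_dt (W : E2 R -> E6 R) : smooth_on U W ->
  smooth_on U (fun q => mink (W q) dt).
Proof. by move=> sW; apply: (smooth_mink oU sW); exact: smooth_cst. Qed.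

Lemma smooth_unormal : smooth_on U (fun y => unormal (f y)).
Proof.
have := smoothD_rV oU sf (smoothZ oU (smooth_mink_dt sf) (smooth_cst U (dt : E6 R))).
by apply: (smooth_ext oU) => q _; rewrite unormalE.
Qed.

Lemma smooth_nabla (W : E2 R -> E6 R) i : smooth_on U W -> smooth_on U (nabla f i W).
Proof.
move=> sW; rewrite /nabla pdE pD_derive.
have sD := smooth_derive (delta_mx 0 i : E2 R) sW.
apply: (smoothD_rV oU sD); apply: smoothN_rV => //.
apply: (smoothZ oU _ smooth_unormal).
exact: (smooth_mink oU sD smooth_unormal).
Qed.

Lemma smooth_mean_curvature : smooth_on U (mean_curvature f).
Proof.
have s i j : smooth_on U (sff f i j).
  have -> : sff f i j = fun q => norm_part f q (nabla f i (pD j f) q).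
    by rewrite /sff pdE.
  by apply: smooth_norm_part; apply: smooth_nabla; exact: smooth_pD.
exact: (smoothZ oU (smooth_cst U (2^-1 : R)) (smooth_trace_g s)).
Qed.

Lemma mink_unormal_unormal q : U q -> mink (unormal (f q)) (unormal (f q)) = 1.
Proof.
move=> Uq; rewrite mink_unormal mink_unormal_dt mul0r addr0 minkC.
exact/RxS4P/fS.
Qed.

Lemma pD_mink i (V W : E2 R -> E6 R) q : smooth_on U V -> smooth_on U W -> U q ->
  pD i (fun y => mink (V y) (W y)) q = mink (pD i V q) (W q) + mink (V q) (pD i W q).
Proof. by move=> sV sW Uq; rewrite !pD_derive; exact: (derive_mink _ sV sW Uq). Qed.

Lemma pD_mink_dt i (V : E2 R -> E6 R) q : smooth_on U V -> U q ->
  pD i (fun y => mink (V y) dt) q = mink (pD i V q) dt.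
Proof.
move=> sV Uq; rewrite (pD_mink _ sV (smooth_cst U (dt : E6 R)) Uq).
by rewrite pD_cst mink0r addr0.
Qed.

Lemma pD_mink_cst i (V W : E2 R -> E6 R) (a : R) q :
  smooth_on U V -> smooth_on U W -> (forall y, U y -> mink (V y) (W y) = a) ->
  U q -> mink (pD i V q) (W q) = - mink (V q) (pD i W q).
Proof.
move=> sV sW VW Uq; apply/eqP; rewrite -addr_eq0 -(pD_mink i sV sW Uq); apply/eqP.
by rewrite pD_derive; exact: (@derive_cst_on _ _ U oU _ _ a).
Qed.

Lemma pD_unormal i q : U q -> pD i (fun y => unormal (f y)) q = pD i f q + mink (pD i f q) dt *: dt.
Proof.
move=> Uq; have sdt := smooth_cst U (dt : E6 R).
have st := smooth_mink_dt sf.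
have NE y : U y -> unormal (f y) = f y + mink (f y) dt *: dt by rewrite unormalE.
rewrite !pD_derive; refine (etrans (near_eq_deriveU (delta_mx 0 i) oU Uq NE) _).
rewrite (deriveD_fun _ sf (smoothZ oU st sdt) Uq).
rewrite (deriveZ_rV _ st sdt Uq) -!pD_deriveE pD_cst scaler0 addr0.
by congr (_ + _ *: _); exact: (pD_mink_dt i sf Uq).
Qed.

Lemma pD_orth_unormal i q : U q -> mink (pD i f q) (unormal (f q)) = 0.
Proof.
move=> Uq; have sN := smooth_unormal.
have := pD_mink_cst i sN sN mink_unormal_unormal Uq.
rewrite minkC => /eqP; rewrite -addr_eq0 -mulr2n -mulr_natl mulf_eq0 pnatr_eq0/=.
by rewrite pD_unormal// minkDr minkZr mink_unormal_dt mulr0 addr0 minkC => /eqP.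
Qed.

Lemma proj_orth q w : U q -> mink (Defs.proj (f q) w) (unormal (f q)) = 0.
Proof.
by move=> Uq; rewrite /Defs.proj !minkL mink_unormal_unormal// mulr1 subrr.
Qed.

Lemma tang_orth_unormal q w : U q -> mink (tang f q w) (unormal (f q)) = 0.
Proof.
by move=> Uq; rewrite minkC; apply: tang_orth => // i; rewrite minkC pD_orth_unormal.
Qed.

Lemma norm_part_orth_unormal q w : U q ->
  mink (norm_part f q w) (unormal (f q)) = mink w (unormal (f q)).
Proof. by move=> Uq; rewrite /norm_part !minkL tang_orth_unormal// subr0. Qed.

Lemma mink_pD2_unormal i j q : U q -> mink (pD i (pD j f) q) (unormal (f q)) =
  - (mink (pD i f q) (pD j f q) + mink (pD i f q) dt * mink (pD j f q) dt).
Proof.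
move=> Uq.
rewrite (pD_mink_cst i (smooth_pD j) smooth_unormal (pD_orth_unormal j) Uq).
by rewrite pD_unormal// minkDr minkZr (minkC (pD j f q)).
Qed.

Lemma pD2_comm i j q : U q -> pD i (pD j f) q = pD j (pD i f) q.
Proof. by move=> Uq; rewrite !pD_derive; exact: (derive_comm_smooth oU _ _ sf Uq). Qed.

Lemma mink_sff i j q x : U q -> (forall k, mink x (pD k f q) = 0) ->
  mink (sff f i j q) x = mink (pD i (pD j f) q) x
    + (mink (pD i f q) (pD j f q) + mink (pD i f q) dt * mink (pD j f q) dt)
      * mink (unormal (f q)) x.
Proof.
move=> Uq xF; rewrite /sff /norm_part !minkL (minkC (tang _ _ _)) tang_orth//.
by rewrite subr0 /nabla pdE /Defs.proj mink_pD2_unormal// mulNr opprK.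
Qed.

Definition tr_g q (B : 'I_2 -> 'I_2 -> R) : R :=
  tr2 (pD 0 f q) (pD 1 f q) (B 0 0) (B 0 1) (B 1 0) (B 1 1).

Lemma mink_trace_g q (B : 'I_2 -> 'I_2 -> E6 R) x : U q ->
  mink (trace_g f q B) x = tr_g q (fun i j => mink (B i j) x).
Proof.
move=> Uq; rewrite trace_g_gtrace; exact: (@mink_gtrace _ (fun i => pD i f q) B x (gram_det_neq0 Uq)).
Qed.

Lemma mean_curvature_orth i q : U q -> mink (mean_curvature f q) (pD i f q) = 0.
Proof.
move=> Uq; have h a b : mink (sff f a b q) (pD i f q) = 0 by exact: norm_part_orth.
by rewrite /mean_curvature minkZl mink_trace_g// [tr_g _ _]tr2_eq0 ?mulr0//; exact: h.
Qed.

Lemma mean_curvature_orth_unormal q : U q ->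
  mink (mean_curvature f q) (unormal (f q)) = 0.
Proof.
move=> Uq; have h a b : mink (sff f a b q) (unormal (f q)) = 0.
  by rewrite /sff norm_part_orth_unormal// proj_orth.
by rewrite /mean_curvature minkZl mink_trace_g// [tr_g _ _]tr2_eq0 ?mulr0//; exact: h.
Qed.

(** The trace formula. A component of [x] along the normal of R x S^4 is allowed and produces the
    last term, so the formula can be tested on any vector orthogonal to the coordinate fields; it
    will serve for H, dt - T and C. *)
Lemma mink_mean_curvature q x : U q -> (forall k, mink x (pD k f q) = 0) ->
  2 * mink (mean_curvature f q) x = tr_g q (fun i j => mink (pD i (pD j f) q) x)
    + (2 + mink (tang f q dt) (tang f q dt)) * mink (unormal (f q)) x.
Proof.
move=> Uq xF; rewrite /mean_curvature minkZl mink_trace_g// mulrA divff ?mul1r ?pnatr_eq0//.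
have h a b := mink_sff a b Uq xF; rewrite tangE//.
refine (etrans _ (tr2_ambient _ _ _ _ _ _ (gram_det_neq0 Uq))).
by congr tr2; exact: h.
Qed.

End LocalSurface.

(** * Structure equations of a biconservative PMCV surface *)

Section TangentPlane.
Context {R : realType}.
Implicit Types (a b w x y z : E6 R).

Lemma tan2_ext a b z (r s : R) : gdet a b != 0 -> z = tan2 a b z ->
  mink z a = mink (r *: a + s *: b) a -> mink z b = mink (r *: a + s *: b) b ->
  z = r *: a + s *: b.
Proof.
move=> d0 zz za zb; rewrite -(tan2_lincomb r s d0) zz /tan2.
by rewrite za zb.
Qed.

(** In a plane, a symmetric operator that kills the nonnull vector [x] is its trace [c] times the
    projection to the line orthogonal to [x]; [z0] and [z1] are its values at [a] and [b]. *)
Lemma rank_one_tangent a b z0 z1 x (r s c : R) :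
  gdet a b != 0 -> x = r *: a + s *: b -> mink x x != 0 ->
  z0 = tan2 a b z0 -> z1 = tan2 a b z1 -> mink z0 b = mink z1 a ->
  mink z0 x = 0 -> mink z1 x = 0 ->
  tr2 a b (mink z0 a) (mink z0 b) (mink z1 a) (mink z1 b) = c ->
  z0 = c *: (a - (mink a x / mink x x) *: x) /\
  z1 = c *: (b - (mink b x / mink x x) *: x).
Proof.
move=> d0 xE th0 z0t z1t sym o0 o1 trc.
have o0' : r * mink z0 a + s * mink z0 b = 0 by rewrite -o0 xE !minkL.
have o1' : r * mink z1 a + s * mink z1 b = 0 by rewrite -o1 xE !minkL.
have ax : mink a x = r * mink a a + s * mink a b by rewrite xE !minkL.
have bx : mink b x = r * mink a b + s * mink b b by rewrite xE !minkL (minkC b a).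
have xx : mink x x = r * (r * mink a a + s * mink a b) + s * (r * mink a b + s * mink b b).
  by rewrite {1}xE !minkL ax bx.
have tc : mink b b * mink z0 a - mink a b * (mink z0 b + mink z1 a) + mink a a * mink z1 b
    = c * gdet a b by rewrite -trc /tr2 divfK.
have comb (k : R) y : y - (k / mink x x) *: x = y - (k / mink x x * r) *: a
    - (k / mink x x * s) *: b.
  by rewrite [X in y - _ *: X]xE scalerDr !scalerA opprD addrA.
have c0 : c *: (a - (mink a x / mink x x) *: x) =
    (c * (1 - mink a x / mink x x * r)) *: a + (- c * (mink a x / mink x x * s)) *: b.
  by rewrite comb; apply/rowP => k; rewrite !mxE; ring.
have c1 : c *: (b - (mink b x / mink x x) *: x) =
    (- c * (mink b x / mink x x * r)) *: a + (c * (1 - mink b x / mink x x * s)) *: b.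
  by rewrite comb; apply/rowP => k; rewrite !mxE; ring.
(* The three values of the form, multiplied by <x, x>: once the trace is substituted for [c], each
   identity is a combination of [o0'] and [o1']. *)
have k00 : mink z0 a * mink x x = c * gdet a b * s ^+ 2.
  rewrite -tc xx; apply/eqP; rewrite -subr_eq0.
  set E := mink a a; set B := mink a b; set G := mink b b.
  move: o0' o1'; rewrite -sym; move: (mink z0 a) (mink z0 b) (mink z1 b) => p u v h0 h1.
  rewrite (_ : _ - _ = (r * p + s * u) * (r * E + 2 * s * B)
     - s * E * (r * u + s * v)); last by ring.
  by rewrite h0 h1; apply/eqP; ring.
have k01 : mink z0 b * mink x x = - c * gdet a b * (r * s).
  rewrite mulNr -tc xx; apply/eqP; rewrite -subr_eq0.
  set E := mink a a; set B := mink a b; set G := mink b b.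
  move: o0' o1'; rewrite -sym; move: (mink z0 a) (mink z0 b) (mink z1 b) => p u v h0 h1.
  rewrite (_ : _ - _ = (r * p + s * u) * (s * G) + (r * u + s * v) * (r * E));
    last by ring.
  by rewrite h0 h1; apply/eqP; ring.
have k11 : mink z1 b * mink x x = c * gdet a b * r ^+ 2.
  rewrite -tc xx; apply/eqP; rewrite -subr_eq0.
  set E := mink a a; set B := mink a b; set G := mink b b.
  move: o0' o1'; rewrite -sym; move: (mink z0 a) (mink z0 b) (mink z1 b) => p u v h0 h1.
  rewrite (_ : _ - _ = (r * u + s * v) * (s * G + 2 * r * B)
     - r * G * (r * p + s * u)); last by ring.
  by rewrite h0 h1; apply/eqP; ring.
have div (p v : R) : p * mink x x = v -> p = v / mink x x by move=> <-; rewrite mulfK.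
rewrite c0 c1; split; apply: tan2_ext => //; rewrite -?sym ?(div _ _ k00)
  ?(div _ _ k01) ?(div _ _ k11) !minkL ?(minkC b a) ?ax ?bx /gdet;
  rewrite xx in th0 *; by field.
Qed.

End TangentPlane.

Lemma pD_ext {R : realType} (U : set (E2 R)) (W : normedModType R) i
    (V V' : E2 R -> W) q : open U -> (forall y, U y -> V y = V' y) -> U q ->
  pD i V q = pD i V' q.
Proof.
by move=> oU VV' Uq; rewrite !pD_deriveE; exact: near_eq_deriveU oU Uq VV'.
Qed.

Lemma pDZ {R : realType} (U : set (E2 R)) n i (a : E2 R -> R) (V : E2 R -> 'rV[R]_n) q :
  smooth_on U a -> smooth_on U V -> U q ->
  pD i (fun y => a y *: V y) q = pD i a q *: V q + a q *: pD i V q.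
Proof. by move=> sa sV Uq; rewrite !pD_deriveE; exact: deriveZ_rV. Qed.

Lemma pD_add {R : realType} (U : set (E2 R)) (W : normedModType R) i
    (V V' : E2 R -> W) q : smooth_on U V -> smooth_on U V' -> U q ->
  pD i (fun y => V y + V' y) q = pD i V q + pD i V' q.
Proof. by move=> sV sV' Uq; rewrite !pD_deriveE; exact: deriveD_fun Uq. Qed.

Lemma pDM {R : realType} (U : set (E2 R)) i (a b : E2 R -> R) q :
  smooth_on U a -> smooth_on U b -> U q ->
  pD i (fun y => a y * b y) q = pD i a q * b q + a q * pD i b q.
Proof. by move=> sa sb Uq; rewrite !pD_deriveE; exact: deriveM_fun. Qed.

(** Dividing by whichever t_i is nonzero would give the common factor only locally; the weights r /
    th and s / th, with r t_0 + s t_1 = th, give it by a single formula, hence smoothly. *)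
Lemma divide_share {R : realType} (W : lmodType R) (r s t0 t1 th : R) (X0 X1 : W) :
  th = r * t0 + s * t1 -> th != 0 -> t0 *: X1 = t1 *: X0 ->
  X0 = t0 *: ((r / th) *: X0 + (s / th) *: X1) /\
  X1 = t1 *: ((r / th) *: X0 + (s / th) *: X1).
Proof.
move=> thE th0 E; have one : t0 * (r / th) + s / th * t1 = 1.
  by rewrite thE; field; rewrite -thE.
have one' : r / th * t0 + t1 * (s / th) = 1 by rewrite mulrC (mulrC t1).
rewrite !scalerDr !scalerA; split.
  by rewrite (mulrC t0 (s / th)) -[(_ * t0) *: X1]scalerA E scalerA -scalerDl one scale1r.
by rewrite (mulrC t1 (r / th)) -[(_ * t1) *: X0]scalerA -E scalerA -scalerDl one' scale1r.
Qed.

(** * Integration of the structure equations *)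

Section Core.
Context {R : realType}.
Variables (U : set (E2 R)) (F : 'I_2 -> E2 R -> E6 R) (N H : E2 R -> E6 R).
Hypotheses (oU : open U) (sF : forall i, smooth_on U (F i)) (sN : smooth_on U N)
  (sH : smooth_on U H).
Implicit Types (q : E2 R) (x : E6 R) (i j k : 'I_2).

Definition tangent_dt q : E6 R := tan2 (F 0 q) (F 1 q) dt.
Local Notation T := tangent_dt.
Local Notation t := (fun i q => mink (F i q) dt).
Local Notation th := (fun q => mink (tangent_dt q) (tangent_dt q)).
Local Notation c := (fun q => mink (H q) (H q)).

Hypotheses
  (DF : forall i j q, U q -> pD i (F j) q = pD j (F i) q)
  (DN : forall i q, U q -> pD i N q = F i q + (mink (F i q) dt) *: dt)
  (FN : forall i q, U q -> mink (F i q) (N q) = 0)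
  (NN : forall q, U q -> mink (N q) (N q) = 1)
  (Ndt : forall q, U q -> mink (N q) dt = 0)
  (d0 : forall q, U q -> gdet (F 0 q) (F 1 q) != 0)
  (HF : forall i q, U q -> mink (H q) (F i q) = 0)
  (HN : forall q, U q -> mink (H q) (N q) = 0)
  (Hdt : forall q, U q -> mink (H q) dt = 0)
  (Htr : forall q x, U q -> (forall k, mink x (F k q) = 0) ->
    2 * mink (H q) x = tr2 (F 0 q) (F 1 q)
      (mink (pD 0 (F 0) q) x) (mink (pD 0 (F 1) q) x)
      (mink (pD 1 (F 0) q) x) (mink (pD 1 (F 1) q) x)
      + (2 + (mink (T q) (T q))) * mink (N q) x)
  (DH : forall i q, U q -> pD i H q = tan2 (F 0 q) (F 1 q) (pD i H q))
  (th_gt0 : forall q, U q -> 0 < (mink (T q) (T q)))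
  (c_gt0 : forall q, U q -> 0 < (mink (H q) (H q))).

Let th0 q : U q -> (mink (T q) (T q)) != 0. Proof. by move=> /th_gt0/lt0r_neq0. Qed.

Lemma coreTF i q : U q -> mink (T q) (F i q) = (mink (F i q) dt).
Proof.
move=> Uq; rewrite [RHS]minkC; move: i; apply: ord2P.
  exact/mink_tan2l/d0.
exact/mink_tan2r/d0.
Qed.

Lemma core_orth q x : U q -> (forall k, mink x (F k q) = 0) -> mink x (T q) = 0.
Proof. by move=> Uq xF; rewrite /T /tan2 minkDr !minkZr !xF !mulr0 addr0. Qed.

Lemma core_coef q : U q -> exists r s, T q = r *: F 0 q + s *: F 1 q.
Proof. by move=> Uq; do 2!eexists. Qed.

Lemma coreTdt q : U q -> mink (T q) dt = (mink (T q) (T q)).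
Proof.
move=> Uq; apply/eqP; rewrite -subr_eq0 -minkNr -minkDr minkC; apply/eqP.
by apply: core_orth => // k; rewrite minkDl minkNl coreTF// (minkC dt) subrr.
Qed.

Lemma coreTN q : U q -> mink (N q) (T q) = 0.
Proof. by move=> Uq; apply: core_orth => // k; rewrite minkC FN. Qed.

Lemma coreHT q : U q -> mink (H q) (T q) = 0.
Proof. by move=> Uq; apply: core_orth => // k; rewrite HF. Qed.

Definition coef0 q := (mink (F 1 q) (F 1 q) * mink dt (F 0 q)
  - mink (F 0 q) (F 1 q) * mink dt (F 1 q)) / gdet (F 0 q) (F 1 q).
Definition coef1 q := (mink (F 0 q) (F 0 q) * mink dt (F 1 q)
  - mink (F 0 q) (F 1 q) * mink dt (F 0 q)) / gdet (F 0 q) (F 1 q).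

Lemma tangent_dtE q : T q = coef0 q *: F 0 q + coef1 q *: F 1 q.
Proof. by []. Qed.

Lemma smooth_coef0 : smooth_on U coef0.
Proof.
have m (V W : E2 R -> E6 R) := @smooth_mink R _ U oU V W.
have sdt : smooth_on U (fun _ : E2 R => dt : E6 R) by exact: smooth_cst.
apply: smoothM => //; last first.
  apply: smoothV => //; apply: smoothD => //; first by apply: smoothM => //; exact: m.
  by apply: smoothN => //; apply: smoothM => //; exact: m.
apply: smoothD => //; first by apply: smoothM => //; exact: m.
by apply: smoothN => //; apply: smoothM => //; exact: m.
Qed.

Lemma smooth_coef1 : smooth_on U coef1.
Proof.
have m (V W : E2 R -> E6 R) := @smooth_mink R _ U oU V W.
have sdt : smooth_on U (fun _ : E2 R => dt : E6 R) by exact: smooth_cst.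
apply: smoothM => //; last first.
  apply: smoothV => //; apply: smoothD => //; first by apply: smoothM => //; exact: m.
  by apply: smoothN => //; apply: smoothM => //; exact: m.
apply: smoothD => //; first by apply: smoothM => //; exact: m.
by apply: smoothN => //; apply: smoothM => //; exact: m.
Qed.

Lemma smooth_T : smooth_on U T.
Proof.
exact: (smoothD_rV oU (smoothZ oU smooth_coef0 (sF 0)) (smoothZ oU smooth_coef1 (sF 1))).
Qed.

Lemma smooth_th : smooth_on U th.
Proof. exact: (smooth_mink oU smooth_T smooth_T). Qed.

Lemma smooth_thV : smooth_on U (fun q => (mink (T q) (T q))^-1).
Proof. exact: (smoothV oU th0 smooth_th). Qed.

Lemma smooth_t i : smooth_on U (t i).
Proof. by apply: (smooth_mink oU (sF i)); exact: smooth_cst. Qed.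

Lemma core_Dt i j q : U q -> pD i (t j) q = mink (pD i (F j) q) dt.
Proof. by move=> Uq; exact: (pD_mink_dt i (sF j) Uq). Qed.

Lemma core_DH_dt i q : U q -> mink (pD i H q) dt = 0.
Proof.
move=> Uq; rewrite -(pD_mink_dt i sH Uq) pD_deriveE.
exact: (@derive_cst_on _ _ U oU _ _ 0).
Qed.

Lemma core_DH_orth i q x : U q -> (forall k, mink x (F k q) = 0) ->
  mink (pD i H q) x = 0.
Proof. by move=> Uq xF; rewrite minkC DH// /tan2 minkDr !minkZr !xF !mulr0 addr0. Qed.

(** Split T = (T - dt) + dt: [pD i H] is tangent while T - dt is normal, and its product with dt is
    the derivative of <H, dt> = 0. *)
Lemma core_DH_T i q : U q -> mink (pD i H q) (T q) = 0.
Proof.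
move=> Uq; rewrite -[T q](subrK dt) minkDr core_DH_dt// addr0.
by apply: core_DH_orth => // k; rewrite minkDl minkNl coreTF// (minkC dt) subrr.
Qed.

Lemma core_DH_F i j q : U q -> mink (pD i H q) (F j q) = - mink (pD i (F j) q) (H q).
Proof.
by move=> Uq; rewrite (pD_mink_cst oU i sH (sF j) (HF j) Uq) minkC.
Qed.

Lemma core_Dc i q : U q -> pD i c q = 0.
Proof.
move=> Uq; rewrite (pD_mink i sH sH Uq) (minkC (H q)) -mulr2n core_DH_orth ?mul0rn//.
by move=> k; exact: HF.
Qed.

(** This is [rank_one_tangent] for the shape operator of H: symmetry comes from D_i F_j = D_j F_i,
    the kernel from [core_DH_T], the trace from the trace formula at H. *)
Lemma core_DH i q : U q ->
  pD i H q = (- (2 * (mink (H q) (H q)))) *: (F i q - ((mink (F i q) dt) / (mink (T q) (T q))) *: T q).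
Proof.
move=> Uq; have [r [s rs]] := core_coef Uq.
have HFq k : mink (H q) (F k q) = 0 by exact: HF.
have trc := Htr Uq HFq; rewrite (minkC (N q)) HN// mulr0 addr0 in trc.
have [] := @rank_one_tangent _ (F 0 q) (F 1 q) (pD 0 H q) (pD 1 H q) (T q) r s
  (- (2 * (mink (H q) (H q)))) (d0 Uq) rs (th0 Uq) (DH 0 Uq) (DH 1 Uq).
- by rewrite !core_DH_F// DF.
- exact: core_DH_T.
- exact: core_DH_T.
- rewrite trc !core_DH_F// /tr2; move: (gdet _ _) => g.
  by move: (mink (pD 0 (F 0) q) _) (mink (pD 0 (F 1) q) _) (mink (pD 1 (F 0) q) _)
    (mink (pD 1 (F 1) q) _) => *; ring.
have Ft k : mink (F k q) (T q) = (mink (F k q) dt) by rewrite minkC coreTF.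
by rewrite !Ft => h0 h1; move: i; apply: ord2P.
Qed.

(** Preferred to T because <S, dt> = 1 is constant and because D_i H = - 2c (F_i - t_i S) with
    constant c, so that symmetry of D_j D_i H concerns S alone. *)
Let S q := (mink (T q) (T q))^-1 *: T q.

Lemma smooth_S : smooth_on U S.
Proof. exact: (smoothZ oU smooth_thV smooth_T). Qed.

Lemma core_DW i j q : U q ->
  pD j (fun y => F i y - (mink (F i y) dt) *: S y) q =
  pD j (F i) q - (mink (pD j (F i) q) dt *: S q + (mink (F i q) dt) *: pD j S q).
Proof.
move=> Uq; have sW := smoothZ oU (smooth_t i) smooth_S.
rewrite (pD_add _ (sF i) (smoothN_rV oU sW) Uq); congr (_ + _).
have E y : U y -> - ((mink (F i y) dt) *: S y) = (- (mink (F i y) dt)) *: S y by rewrite scaleNr.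
have Dt : pD j (fun y => - (mink (F i y) dt)) q = - mink (pD j (F i) q) dt.
  rewrite -core_Dt// !pD_deriveE; apply: deriveN.
  by apply: diff_derivable; exact: smooth_differentiable (smooth_t i) Uq.
rewrite (pD_ext _ oU E Uq) (pDZ _ (smoothN oU (smooth_t i)) smooth_S Uq) Dt.
by rewrite !scaleNr -opprD.
Qed.

(* Symmetry of the second derivatives of [H]. *)
Lemma core_DS q : U q -> (mink (F 0 q) dt) *: pD 1 S q = (mink (F 1 q) dt) *: pD 0 S q.
Proof.
move=> Uq; pose W i y := F i y - (mink (F i y) dt) *: S y.
have sW i : smooth_on U (W i).
  exact: (smoothD_rV oU (sF i) (smoothN_rV oU (smoothZ oU (smooth_t i) smooth_S))).
have sc : smooth_on U (fun y => - (2 * (mink (H y) (H y)))).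
  apply: smoothN => //; apply: smoothM => //; first exact: smooth_cst.
  exact: (smooth_mink oU sH sH).
have HW i y : U y -> pD i H y = (- (2 * (mink (H y) (H y)))) *: W i y.
  by move=> Uy; rewrite core_DH// /W /S scalerA.
have Dc i : pD i (fun y => - (2 * (mink (H y) (H y)))) q = 0.
  have E y : U y -> - (2 * (mink (H y) (H y))) = (-2) * (mink (H y) (H y)) by rewrite mulNr.
  rewrite (pD_ext _ oU E Uq) pD_deriveE.
  rewrite (deriveM_fun _ (smooth_cst U (-2 : R)) (smooth_mink oU sH sH) Uq).
  rewrite -!pD_deriveE core_Dc// mulr0 addr0 pD_cst mul0r//.
have DHW i j : pD j (pD i H) q = (- (2 * (mink (H q) (H q)))) *: pD j (W i) q.
  by rewrite (pD_ext _ oU (HW i) Uq) (pDZ _ sc (sW i) Uq) Dc scale0r add0r.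
have : pD 0 (W 1) q = pD 1 (W 0) q.
  have c2 : - (2 * (mink (H q) (H q))) != 0 by rewrite oppr_eq0 mulf_neq0 ?pnatr_eq0// gt_eqF ?c_gt0.
  by apply: (scalerI c2); rewrite -!DHW; exact: (pD2_comm oU sH _ _ Uq).
rewrite !core_DW// (DF 0 1 Uq) => /addrI/oppr_inj/addrI.
by [].
Qed.

Lemma core_th q : U q -> (mink (T q) (T q)) = coef0 q * (mink (F 0 q) dt) + coef1 q * (mink (F 1 q) dt).
Proof. by move=> Uq; rewrite -coreTdt// tangent_dtE minkDl !minkZl. Qed.

Lemma core_t_neq0 q : U q -> exists i, (mink (F i q) dt) != 0.
Proof.
move=> Uq; have := th0 Uq; rewrite core_th//.
have [t0|t0 _] := eqVneq (mink (F 0 q) dt) 0; last by exists 0.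
by rewrite t0 mulr0 add0r mulf_eq0 negb_or => /andP[_ t1]; exists 1.
Qed.

(** Scalar products with a vector known through its multiples by the t_i are computed in this way:
    multiply by t_i, recognize a derivative, and cancel, as T does not vanish. *)
Lemma core_t_scale_eq0 q (a : R) : U q -> (forall i, (mink (F i q) dt) * a = 0) -> a = 0.
Proof.
move=> /core_t_neq0[i ti] /(_ i)/eqP; rewrite mulf_eq0 (negbTE ti).
by move/eqP.
Qed.

(** The common factor in D_i S = t_i Q, as provided by [divide_share]. *)
Let Q q := (coef0 q / (mink (T q) (T q))) *: pD 0 S q + (coef1 q / (mink (T q) (T q))) *: pD 1 S q.

Lemma smooth_pDi i (V : E2 R -> E6 R) : smooth_on U V -> smooth_on U (pD i V).
Proof. by rewrite pD_derive; exact: smooth_derive. Qed.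

Lemma smooth_Q : smooth_on U Q.
Proof.
exact: (smoothD_rV oU
  (smoothZ oU (smoothM oU smooth_coef0 smooth_thV) (smooth_pDi 0 smooth_S))
  (smoothZ oU (smoothM oU smooth_coef1 smooth_thV) (smooth_pDi 1 smooth_S))).
Qed.

Lemma core_DSE i q : U q -> pD i S q = (mink (F i q) dt) *: Q q.
Proof.
move=> Uq; have [h0 h1] := divide_share (core_th Uq) (th0 Uq) (core_DS Uq).
by move: i; apply: ord2P.
Qed.

Lemma coreST q : U q -> mink (T q) (S q) = 1.
Proof. by move=> Uq; rewrite /S minkZr mulVf// th0. Qed.

Lemma core_Qdt q : U q -> mink (Q q) dt = 0.
Proof.
move=> Uq; apply: (core_t_scale_eq0 Uq) => i; rewrite -minkZl -core_DSE//.
rewrite -(pD_mink_dt i smooth_S Uq) pD_deriveE.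
have E y : U y -> mink (S y) dt = 1.
  by move=> Uy; rewrite /S minkZl coreTdt// mulVf// th0.
exact: (derive_cst_on oU _ E Uq).
Qed.
Let u i q := pD i (fun y => (mink (T y) (T y))^-1) q.

Lemma core_u i q : U q -> u i q = 2 * ((mink (F i q) dt) * mink (Q q) (S q)).
Proof.
move=> Uq; have E y : U y -> (mink (T y) (T y))^-1 = mink (S y) (S y).
  by move=> Uy; rewrite /S minkZl minkZr mulrA -mulrA mulVf ?mulr1// th0.
rewrite /u (pD_ext _ oU E Uq) (pD_mink i smooth_S smooth_S Uq) (minkC (S q)).
by rewrite core_DSE// minkZl; ring.
Qed.

Lemma core_SF i j q : U q -> (mink (F i q) dt) * mink (Q q) (F j q) + mink (S q) (pD i (F j) q)
  = u i q * (mink (F j q) dt) + (mink (T q) (T q))^-1 * mink (pD i (F j) q) dt.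
Proof.
move=> Uq; have E y : U y -> mink (S y) (F j y) = (mink (T y) (T y))^-1 * (mink (F j y) dt).
  by move=> Uy; rewrite /S minkZl coreTF.
have := pD_ext i oU E Uq.
rewrite (pD_mink i smooth_S (sF j) Uq) (pDM i smooth_thV (smooth_t j) Uq) core_Dt//.
by rewrite core_DSE// minkZl.
Qed.

(** In [core_SF] the second derivatives and the term with [u] are symmetric in i and j; hence so is
    t_i <Q, F_j>, and <Q, F_j> is proportional to t_j. *)
Lemma core_QF i q : U q -> mink (Q q) (F i q) = mink (Q q) (S q) * (mink (F i q) dt).
Proof.
move=> Uq; have sym : (mink (F 0 q) dt) * mink (Q q) (F 1 q) = (mink (F 1 q) dt) * mink (Q q) (F 0 q).
  have e0 := core_SF 0 1 Uq; have e1 := core_SF 1 0 Uq.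
  rewrite (DF 1 0 Uq) in e1; rewrite !core_u// in e0 e1.
  move: e0 e1; move: (mink (S q) _) (mink (pD _ _ _) dt) (_^-1) => a b d.
  by move: (mink _ _) (mink _ _) (mink _ _) (mink _ _) (mink _ _) => *; lra.
have Q1 : mink (Q q) (T q) = coef0 q * mink (Q q) (F 0 q) + coef1 q * mink (Q q) (F 1 q).
  by rewrite tangent_dtE minkDr !minkZr.
have QT : mink (Q q) (S q) = coef0 q / (mink (T q) (T q)) * mink (Q q) (F 0 q)
    + coef1 q / (mink (T q) (T q)) * mink (Q q) (F 1 q).
  by rewrite /S minkZr Q1; ring.
have [h0 h1] := @divide_share _ R^o _ _ _ _ _ _ _ (core_th Uq) (th0 Uq) sym.
by rewrite mulrC QT; move: i; apply: ord2P.
Qed.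

Let eta q := dt - T q.

Lemma core_eta_orth q k : U q -> mink (eta q) (F k q) = 0.
Proof. by move=> Uq; rewrite /eta minkDl minkNl coreTF// (minkC dt) subrr. Qed.

Lemma tr2_scale a b (k B00 B01 B10 B11 : R) :
  tr2 a b (k * B00) (k * B01) (k * B10) (k * B11) = k * tr2 a b B00 B01 B10 B11.
Proof. by rewrite /tr2; ring. Qed.

Lemma core_tr_tt q : U q -> tr2 (F 0 q) (F 1 q) ((mink (F 0 q) dt) * (mink (F 0 q) dt)) ((mink (F 0 q) dt) * (mink (F 1 q) dt))
  ((mink (F 1 q) dt) * (mink (F 0 q) dt)) ((mink (F 1 q) dt) * (mink (F 1 q) dt)) = (mink (T q) (T q)).
Proof. by move=> Uq; rewrite (tan2_sqr _ (d0 Uq)) !(minkC dt). Qed.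

(** The trace formula at eta = dt - T, which is orthogonal to H and N: there <D_i F_j, eta> = -
    |T|^2 mu t_i t_j has trace - |T|^4 mu, so mu = 0. By [core_u] this is what makes |T|
    constant. *)
Lemma core_QS q : U q -> mink (Q q) (S q) = 0.
Proof.
move=> Uq; set mu := mink (Q q) (S q).
have etaE x : mink x (eta q) = mink x dt - mink (T q) (T q) * mink (S q) x.
  by rewrite /eta minkDr minkNr /S minkZl mulrA mulfV ?th0// mul1r (minkC (T q)).
have Feta i j : mink (pD i (F j) q) (eta q) = (- ((mink (T q) (T q)) * mu)) * ((mink (F i q) dt) * (mink (F j q) dt)).
  have := core_SF i j Uq; rewrite core_QF// core_u// -/mu => e.
  rewrite etaE.
  move: e; move: (mink (S q) _) (mink (pD _ _ _) dt) => a b e.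
  have -> : a = 2 * ((mink (F i q) dt) * mu) * (mink (F j q) dt) + (mink (T q) (T q))^-1 * b - (mink (F i q) dt) * (mu * (mink (F j q) dt)).
    by rewrite -e; ring.
  by have := th0 Uq; move: (mink (T q) (T q)) => z z0; field.
have := Htr Uq (fun k => core_eta_orth k Uq).
have -> : mink (H q) (eta q) = 0.
  by rewrite /eta minkDr minkNr Hdt// coreHT// subrr.
have -> : mink (N q) (eta q) = 0.
  by rewrite /eta minkDr minkNr Ndt// coreTN// subrr.
rewrite !mulr0 addr0.
have -> : tr2 (F 0 q) (F 1 q) (mink (pD 0 (F 0) q) (eta q)) (mink (pD 0 (F 1) q) (eta q))
    (mink (pD 1 (F 0) q) (eta q)) (mink (pD 1 (F 1) q) (eta q)) = - ((mink (T q) (T q)) * mu) * (mink (T q) (T q)).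
  rewrite -[X in _ = _ * X](core_tr_tt Uq) -tr2_scale.
  by congr tr2; exact: Feta.
move=> /esym/eqP; rewrite mulf_eq0 oppr_eq0 mulf_eq0.
by have /negbTE-> := th0 Uq; rewrite orbF => /eqP.
Qed.

(* The vector [C] with [pD i T = t i *: C]. *)
Definition accel q : E6 R := (mink (T q) (T q)) *: Q q.
Local Notation C := accel.

Lemma smooth_C : smooth_on U C.
Proof. exact: (smoothZ oU smooth_th smooth_Q). Qed.

Lemma core_Dth i q : U q -> pD i th q = 0.
Proof.
move=> Uq; have TE y : U y -> T y = (mink (T y) (T y)) *: S y.
  by move=> Uy; rewrite /S scalerA mulfV ?th0// scale1r.
rewrite (pD_mink i smooth_T smooth_T Uq) minkC -mulr2n.
(* Inserting T = th S in 2 <T, D_i T> gives 2 D_i th, because <T, S> = 1 and <T, Q> = 0. *)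
have : pD i th q = pD i th q *+ 2.
  rewrite {1}(pD_mink i smooth_T smooth_T Uq) minkC -mulr2n; congr (_ *+ 2).
  rewrite (pD_ext i oU TE Uq) (pDZ i smooth_th smooth_S Uq) minkDr.
  have -> : mink (T q) (pD i th q *: S q) = pD i th q by rewrite minkZr coreST// mulr1.
  have TQ : mink (T q) (Q q) = 0.
    rewrite TE//; have := core_QS Uq; rewrite minkC => SQ.
    by rewrite minkZl SQ mulr0.
  by rewrite core_DSE// !minkZr TQ !mulr0 addr0.
by rewrite (pD_mink i smooth_T smooth_T Uq) minkC -mulr2n; move: (_ *+ 2) => a; lra.
Qed.

Lemma core_DT i q : U q -> pD i T q = (mink (F i q) dt) *: C q.
Proof.
move=> Uq; have TE y : U y -> T y = (mink (T y) (T y)) *: S y.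
  by move=> Uy; rewrite /S scalerA mulfV ?th0// scale1r.
rewrite (pD_ext i oU TE Uq) (pDZ i smooth_th smooth_S Uq) core_Dth// scale0r add0r.
by rewrite core_DSE// /C !scalerA mulrC.
Qed.

Lemma core_CF k q : U q -> mink (C q) (F k q) = 0.
Proof. by move=> Uq; rewrite /C minkZl core_QF// core_QS// mul0r mulr0. Qed.

Lemma core_Cdt q : U q -> mink (C q) dt = 0.
Proof. by move=> Uq; rewrite /C minkZl core_Qdt// mulr0. Qed.

Lemma core_CN q : U q -> mink (C q) (N q) = - (1 + (mink (T q) (T q))).
Proof.
move=> Uq; apply/eqP; rewrite -addr_eq0; apply/eqP.
apply: (core_t_scale_eq0 Uq) => i; rewrite mulrDr -minkZl -core_DT//.
have TN y : U y -> mink (T y) (N y) = 0 by move=> Uy; rewrite minkC coreTN.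
rewrite (pD_mink_cst oU i smooth_T sN TN Uq) DN// minkDr minkZr coreTdt// coreTF//.
by ring.
Qed.

Lemma core_CH q : U q -> mink (C q) (H q) = 0.
Proof.
move=> Uq; apply: (core_t_scale_eq0 Uq) => i; rewrite -minkZl -core_DT//.
have TH y : U y -> mink (T y) (H y) = 0 by move=> Uy; rewrite minkC coreHT.
by rewrite (pD_mink_cst oU i smooth_T sH TH Uq) minkC core_DH_T// oppr0.
Qed.

Lemma core_CT q : U q -> mink (C q) (T q) = 0.
Proof. by move=> Uq; apply: core_orth => // k; exact: core_CF. Qed.

(* Symmetry of the second derivatives of [T]. *)
Lemma core_DC_sym q : U q -> (mink (F 0 q) dt) *: pD 1 C q = (mink (F 1 q) dt) *: pD 0 C q.
Proof.
move=> Uq; have := pD2_comm oU smooth_T 0 1 Uq.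
have DT i := fun y (Uy : U y) => core_DT i Uy.
rewrite (pD_ext 0 oU (DT 1) Uq) (pD_ext 1 oU (DT 0) Uq).
rewrite (pDZ 0 (smooth_t 1) smooth_C Uq) (pDZ 1 (smooth_t 0) smooth_C Uq).
by rewrite !core_Dt// (DF 0 1 Uq) => /addrI.
Qed.

Let K q := (coef0 q / (mink (T q) (T q))) *: pD 0 C q + (coef1 q / (mink (T q) (T q))) *: pD 1 C q.

Lemma core_DCK i q : U q -> pD i C q = (mink (F i q) dt) *: K q.
Proof.
move=> Uq; have [h0 h1] := divide_share (core_th Uq) (th0 Uq) (core_DC_sym Uq).
by move: i; apply: ord2P.
Qed.

Lemma core_CDF i j q : U q ->
  mink (pD i (F j) q) (C q) = - ((mink (F i q) dt) * mink (K q) (F j q)).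
Proof.
move=> Uq; rewrite -minkZl -core_DCK//.
by rewrite minkC (pD_mink_cst oU i smooth_C (sF j) (core_CF j) Uq) opprK.
Qed.

Lemma core_KF i q : U q -> mink (K q) (F i q) = mink (K q) (S q) * (mink (F i q) dt).
Proof.
move=> Uq; have sym : (mink (F 0 q) dt) * mink (K q) (F 1 q) = (mink (F 1 q) dt) * mink (K q) (F 0 q).
  by apply: oppr_inj; rewrite -!core_CDF// DF.
have K1 : mink (K q) (T q) = coef0 q * mink (K q) (F 0 q) + coef1 q * mink (K q) (F 1 q).
  by rewrite tangent_dtE minkDr !minkZr.
have KT : mink (K q) (S q) = coef0 q / (mink (T q) (T q)) * mink (K q) (F 0 q)
    + coef1 q / (mink (T q) (T q)) * mink (K q) (F 1 q).
  by rewrite /S minkZr K1; ring.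
have [h0 h1] := @divide_share _ R^o _ _ _ _ _ _ _ (core_th Uq) (th0 Uq) sym.
by rewrite mulrC KT; move: i; apply: ord2P.
Qed.

(** The trace formula at C: as <C, F_j> = 0, the product <D_i F_j, C> equals - t_i <K, F_j> = - <K,
    S> t_i t_j, whose trace is - <K, S> |T|^2. *)
Lemma core_KS q : U q -> mink (K q) (S q) * (mink (T q) (T q)) = - ((2 + (mink (T q) (T q))) * (1 + (mink (T q) (T q)))).
Proof.
move=> Uq; have := Htr Uq (fun k => core_CF k Uq).
rewrite (minkC (H q)) core_CH// mulr0 (minkC (N q)) core_CN//.
have -> : tr2 (F 0 q) (F 1 q) (mink (pD 0 (F 0) q) (C q)) (mink (pD 0 (F 1) q) (C q))
    (mink (pD 1 (F 0) q) (C q)) (mink (pD 1 (F 1) q) (C q)) = - mink (K q) (S q) * (mink (T q) (T q)).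
  rewrite -[X in _ = _ * X](core_tr_tt Uq) -tr2_scale.
  by congr tr2; rewrite core_CDF// core_KF//; ring.
by move: (mink (K q) _ ) (mink (T q) (T q)) => a b; lra.
Qed.

Lemma core_CC q : U q -> mink (C q) (C q) = (2 + (mink (T q) (T q))) * (1 + (mink (T q) (T q))).
Proof.
move=> Uq; apply/eqP; rewrite -subr_eq0; apply/eqP.
apply: (core_t_scale_eq0 Uq) => i; rewrite mulrBr -minkZl -core_DT//.
have TC y : U y -> mink (T y) (C y) = 0 by move=> Uy; rewrite minkC core_CT.
rewrite (pD_mink_cst oU i smooth_T smooth_C TC Uq) core_DCK// minkZr.
have -> : mink (T q) (K q) = mink (K q) (S q) * (mink (T q) (T q)).
  by rewrite minkC /S minkZr mulrC mulrA mulfV ?th0// mul1r.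
by rewrite core_KS//; ring.
Qed.

(** Needed for <C, N> and |C|^2, which are polynomials in |T|^2. *)
Lemma pD_poly_th i q (a b d : R) : U q ->
  pD i (fun y => a + b * (mink (T y) (T y)) + d * ((mink (T y) (T y)) * (mink (T y) (T y)))) q = 0.
Proof.
move=> Uq; have st := smooth_th; have sc (w : R) := smooth_cst U w.
rewrite (pD_add i (smoothD oU (sc a) (smoothM oU (sc b) st))
  (smoothM oU (sc d) (smoothM oU st st)) Uq).
rewrite (pD_add i (sc a) (smoothM oU (sc b) st) Uq) (pDM i (sc b) st Uq).
rewrite (pDM i (sc d) (smoothM oU st st) Uq) (pDM i st st Uq) core_Dth//.
by rewrite !pD_cst; ring.
Qed.

(** Both sides have the same products with six orthogonal nonnull vectors: T, N, H, the timelike eta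
    = dt - T, the tangent vector [Y] orthogonal to T, and [V], which is C without its component
    along N. *)
Lemma core_K q : U q -> K q = - (2 + (mink (T q) (T q))) *: (S q + dt).
Proof.
move=> Uq; set z := mink (T q) (T q); have z0 : 0 < z := th_gt0 Uq.
have KS : mink (K q) (S q) = - ((2 + z) * (1 + z)) / z.
  by rewrite -core_KS// mulfK// th0.
have Kdt : mink (K q) dt = 0.
  apply: (core_t_scale_eq0 Uq) => i; rewrite -minkZl -core_DCK//.
  rewrite -(pD_mink_dt i smooth_C Uq) pD_deriveE.
  exact: (derive_cst_on oU _ core_Cdt Uq).
have KN : mink (K q) (N q) = 0.
  apply: (core_t_scale_eq0 Uq) => i; rewrite -minkZl -core_DCK//.
  have E y : U y -> mink (C y) (N y) = -1 + (-1) * (mink (T y) (T y)) + 0 * ((mink (T y) (T y)) * (mink (T y) (T y))).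
    by move=> Uy; rewrite core_CN//; ring.
  have := pD_ext i oU E Uq; rewrite pD_poly_th// (pD_mink i smooth_C sN Uq) DN//.
  by rewrite minkDr minkZr core_CF// core_Cdt// mulr0 !addr0.
have KC : mink (K q) (C q) = 0.
  apply: (core_t_scale_eq0 Uq) => i; rewrite -minkZl -core_DCK//.
  have E y : U y -> mink (C y) (C y) = 2 + 3 * (mink (T y) (T y)) + 1 * ((mink (T y) (T y)) * (mink (T y) (T y))).
    by move=> Uy; rewrite core_CC//; ring.
  have := pD_ext i oU E Uq; rewrite pD_poly_th// (pD_mink i smooth_C smooth_C Uq).
  by rewrite (minkC (C q)); move: (mink _ _) => a; lra.
have KH : mink (K q) (H q) = 0.
  apply: (core_t_scale_eq0 Uq) => i; rewrite -minkZl -core_DCK//.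
  rewrite (pD_mink_cst oU i smooth_C sH core_CH Uq) minkC core_DH_orth ?oppr0// => k.
  exact: core_CF.
apply/eqP; rewrite scaleNr -addr_eq0; apply/eqP.
set Z := K q + _.
have SE x : mink (S q) x = z^-1 * mink (T q) x by rewrite /S minkZl.
have ZE x : mink Z x = mink (K q) x + (2 + z) * (mink (S q) x + mink dt x).
  by rewrite /Z (minkDl (K q)) (minkZl (2 + z)) (minkDl (S q)).
have ZF k : mink Z (F k q) = 0.
  rewrite ZE core_KF// KS SE coreTF// (minkC dt).
  by move: (mink _ _) => a; field; rewrite gt_eqF.
have Tdt := coreTdt Uq; have TN := coreTN Uq; have HT := coreHT Uq.
have CT := core_CT Uq; have dtdt := @mink_dtdt R.
pose Y := (mink (F 1 q) dt) *: F 0 q - (mink (F 0 q) dt) *: F 1 q.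
have YE x : mink Y x = (mink (F 1 q) dt) * mink (F 0 q) x - (mink (F 0 q) dt) * mink (F 1 q) x.
  by rewrite /Y minkDl minkNl !minkZl.
have TY : mink (T q) Y = 0.
  by rewrite minkC YE !(minkC _ (T q)) !coreTF//; ring.
have Ydt : mink Y dt = 0 by rewrite YE; ring.
have YY : mink Y Y != 0.
  have : mink Y Y = gdet (F 0 q) (F 1 q) * z.
    rewrite -[z](core_tr_tt Uq) /tr2 mulrCA mulfV ?d0// mulr1 YE !(minkC _ Y) !YE.
    rewrite (minkC (F 1 q) (F 0 q)).
    by move: (mink _ _) (mink _ _) (mink _ _) (mink _ _) (mink _ _) => *; ring.
  by move=> ->; rewrite mulf_neq0 ?d0// gt_eqF.
have Yorth x : (forall k, mink x (F k q) = 0) -> mink Y x = 0.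
  by move=> xF; rewrite YE !(minkC _ x) !xF !mulr0 subrr.
have HFq k : mink (H q) (F k q) = 0 := HF k Uq.
have NFq k : mink (N q) (F k q) = 0 by rewrite minkC FN.
have CFq k : mink (C q) (F k q) = 0 := core_CF k Uq.
have etaF k : mink (eta q) (F k q) = 0 := core_eta_orth k Uq.
pose V := C q + (1 + z) *: N q.
have VF k : mink V (F k q) = 0 by rewrite /V minkDl minkZl CFq NFq mulr0 addr0.
have CN := core_CN Uq; rewrite -/z in CN.
have CC := core_CC Uq; rewrite -/z in CC.
have [Nn Nd] := (NN Uq, Ndt Uq).
have [Hn Hd] := (HN Uq, Hdt Uq).
have [Cd Ch] := (core_Cdt Uq, core_CH Uq).
have TT : mink (T q) (T q) = z by [].
have VE x : mink V x = mink (C q) x + (1 + z) * mink (N q) x.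
  by rewrite /V (minkDl (C q)) (minkZl (1 + z)).
have eE x : mink (eta q) x = mink dt x - mink (T q) x.
  by rewrite /eta (minkDl dt) (minkNl (T q)).
have dT : mink dt (T q) = z by rewrite minkC.
have dN : mink dt (N q) = 0 by rewrite minkC.
have dH : mink dt (H q) = 0 by rewrite minkC.
have dC : mink dt (C q) = 0 by rewrite minkC.
have TN' : mink (T q) (N q) = 0 by rewrite minkC.
have TH : mink (T q) (H q) = 0 by rewrite minkC.
have TC : mink (T q) (C q) = 0 by rewrite minkC.
have NC : mink (N q) (C q) = - (1 + z) by rewrite minkC.
have NH : mink (N q) (H q) = 0 by rewrite minkC.
have Teta : mink (eta q) (T q) = 0 by rewrite eE dT TT subrr.
have VT : mink V (T q) = 0 by rewrite VE CT TN mulr0 addr0.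
have VN : mink V (N q) = 0 by rewrite VE CN Nn; ring.
have VH : mink V (H q) = 0 by rewrite VE Ch NH mulr0 addr0.
have Vd : mink V dt = 0 by rewrite VE Cd Nd mulr0 addr0.
have VC : mink V (C q) = 1 + z by rewrite VE CC NC; ring.
have etaV : mink (eta q) V = 0 by rewrite eE minkC Vd minkC VT subrr.
have etaN : mink (eta q) (N q) = 0 by rewrite eE dN TN' subrr.
have etaH : mink (eta q) (H q) = 0 by rewrite eE dH TH subrr.
have Zdt : mink Z dt = 0 by rewrite ZE Kdt SE Tdt dtdt -/z mulVf ?gt_eqF//; ring.
have ZT : mink Z (T q) = 0.
  by rewrite tangent_dtE minkDr !minkZr !ZF !mulr0 addr0.
apply: (@frame6_eq0 _ (T q) Y (N q) (eta q) (H q) V).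
- by rewrite TT Nn oner_neq0 YY gt_eqF.
- split; last 2 first.
  + by rewrite gt_eqF// c_gt0.
  + rewrite VE minkC VC minkC VN mulr0 addr0.
    by rewrite gt_eqF// addr_gt0.
  + rewrite eE minkC eE dtdt (minkC (T q) dt) dT minkC Teta subr0.
    rewrite (_ : _ - _ = - (1 + z)); last by ring.
    by rewrite oppr_eq0 gt_eqF// addr_gt0.
- by split=> //; rewrite minkC.
- split.
  + by apply: Yorth => k; exact: NFq.
  + by apply: Yorth => k; exact: etaF.
  + by apply: Yorth => k; exact: HFq.
  + by apply: Yorth => k; exact: VF.
- by split=> //; rewrite minkC.
- by split=> //; rewrite minkC.
- split=> //.
    by rewrite minkC YE (minkC _ Z) (minkC _ Z) !ZF !mulr0 subrr.
  by rewrite ZE KN SE TN' dN; ring.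
- split.
  + by rewrite minkC eE minkC Zdt minkC ZT subrr.
  + by rewrite ZE KH SE TH dH; ring.
  + by rewrite minkC VE minkC ZE KC SE TC dC minkC ZE KN SE TN' dN; ring.
Qed.

Lemma core_DC i q : U q ->
  pD i C q = (- (2 + (mink (T q) (T q))) * (mink (F i q) dt)) *: ((mink (T q) (T q))^-1 *: T q + dt).
Proof. by move=> Uq; rewrite core_DCK// core_K// scalerA mulrC. Qed.

End Core.

(** * The bitension field *)

Section Curvature.
Context {R : realType}.
Implicit Types (p v w x y z : E6 R).

Local Notation sp a b := (mink a (unormal b)).

Lemma unormalD x y : unormal (x + y) = unormal x + unormal y.
Proof. by apply/rowP => i; rewrite !mxE; case: eqP; rewrite ?addr0. Qed.

Lemma unormalZ (a : R) x : unormal (a *: x) = a *: unormal x.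
Proof. by apply/rowP => i; rewrite !mxE; case: eqP; rewrite ?mulr0. Qed.

Lemma unormalN x : unormal (- x) = - unormal x.
Proof. by rewrite -scaleN1r unormalZ scaleN1r. Qed.

Lemma unormalK x : unormal (unormal x) = unormal x.
Proof. by apply/rowP => i; rewrite !mxE; case: eqP. Qed.

Lemma spC x y : sp x y = sp y x.
Proof. by rewrite !mink_unormal (minkC x y) mulrC. Qed.

Lemma sp_unormal x y : sp (unormal x) y = sp x y.
Proof. by rewrite spC unormalK spC. Qed.

Lemma is_derive_unormal p v : is_derive p v (@unormal R) (unormal v).
Proof.
have H := is_derive_mink (is_derive_id p v) (is_derive_cst (dt : E6 R) p v).
have H' := is_deriveD (is_derive_id p v)
  (is_deriveZ_rV H (is_derive_cst (dt : E6 R) p v)).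
have -> : @unormal R = id + (fun q => mink (id q) (cst dt q) *: cst dt q).
  by apply/funext => q; rewrite unormalE.
by apply: (is_derive_eq H'); rewrite mink0r addr0 scaler0 addr0.
Qed.

Lemma is_derive_sp z p v : is_derive p v (fun q => sp z q) (sp z v).
Proof.
have H := is_derive_mink (is_derive_cst (z : E6 R) p v) (is_derive_unormal p v).
by apply: (is_derive_eq H); rewrite mink0l add0r.
Qed.

Lemma is_derive_extend z p v : is_derive p v (Defs.extend z)
  (- (sp z v *: unormal p + sp z p *: unormal v)).
Proof.
have H := is_deriveZ_rV (is_derive_sp z p v) (is_derive_unormal p v).
have H' := is_deriveB (is_derive_cst (z : E6 R) p v) H.
have -> : Defs.extend z = cst z - (fun q => sp z q *: unormal q) by apply/funext.
by apply: (is_derive_eq H'); rewrite sub0r.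
Qed.

(** Computed on all of E^6_1, without sp q q = 1: this field is differentiated once more, and the
    derivative is taken in the ambient space before projecting. *)
Lemma covd_extend y z : Defs.covd (Defs.extend y) (Defs.extend z) =
  fun q => - ((1 - sp q q) * (sp z y - sp y q * sp z q)) *: unormal q
    - (sp z q *: unormal y - (sp z q * (sp y q * (2 - sp q q))) *: unormal q).
Proof.
apply/funext => q; rewrite /Defs.covd.
rewrite (derive_unique (is_derive_extend z q (Defs.extend y q))).
have zY : sp z (Defs.extend y q) = sp z y - sp y q * sp z q.
  by rewrite /Defs.extend /Defs.proj unormalD unormalN unormalZ unormalK minkDr minkNr minkZr.
have NY : unormal (Defs.extend y q) = unormal y - sp y q *: unormal q.
  by rewrite /Defs.extend /Defs.proj unormalD unormalN unormalZ unormalK.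
rewrite zY NY /Defs.proj; set k := sp z y - _.
set w := - _; have -> : sp w q = - (k * sp q q + sp z q * (sp y q - sp y q * sp q q)).
  by rewrite /w minkNl minkDl !minkZl minkDl minkNl minkZl !sp_unormal.
by rewrite /w; apply/rowP => i; rewrite ![in LHS]mxE ![in RHS]mxE; ring.
Qed.

(** The curvature of the unit sphere on spherical components: [unormal] and [sp] drop the flat time
    direction. *)
Lemma curvatureE p x y z : RxS4 p -> sp x p = 0 -> sp y p = 0 -> sp z p = 0 ->
  Defs.curvature p x y z = sp y z *: unormal x - sp x z *: unormal y.
Proof.
move=> /RxS4P pp.
have ext0 w : sp w p = 0 -> Defs.extend w p = w.
  by move=> w0; rewrite /Defs.extend /Defs.proj w0 scale0r subr0.
have key a b : sp a p = 0 -> sp b p = 0 -> sp z p = 0 ->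
    Defs.covd (Defs.extend a) (Defs.covd (Defs.extend b) (Defs.extend z)) p =
    - (sp z a *: unormal b).
  move=> a0 b0 z0; rewrite covd_extend {1}/Defs.covd ext0//.
  have Hn := is_derive_mink (is_derive_id p a) (is_derive_unormal p a).
  have Hz := is_derive_sp z p a; have Hb := is_derive_sp b p a.
  have HN := is_derive_unormal p a.
  have c (V : normedModType R) (u : V) := is_derive_cst u p a.
  have H1 := is_deriveZ_rV (is_deriveN (is_deriveM
    (is_deriveB (c R^o 1) Hn) (is_deriveB (c R^o (sp z b)) (is_deriveM Hb Hz)))) HN.
  have H2 := is_deriveZ_rV Hz (c (E6 R) (unormal b)).
  have H3 := is_deriveZ_rV (is_deriveM Hz (is_deriveM Hb (is_deriveB (c R^o 2) Hn))) HN.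
  have H := is_deriveB H1 (is_deriveB H2 H3).
  rewrite (derive_unique H) /=.
  rewrite !fctE /= -![_ *: (_ : R^o)]/(_ * _) pp b0 z0 (spC p a) a0.
  set w := (X in Defs.proj p X).
  have -> : w = - (sp z a *: unormal b).
    by rewrite /w; apply/rowP => i; rewrite ![in LHS]mxE ![in RHS]mxE; ring.
  by rewrite /Defs.proj minkNl minkZl sp_unormal b0 mulr0 oppr0 scale0r subr0.
move=> x0 y0 z0; rewrite /Defs.curvature /Defs.curvature_field !key// /Defs.covd.
(* The bracket of the two extensions vanishes at [p] by the symmetry of [sp], so only the iterated
   derivatives contribute. *)
have -> : Defs.lie (Defs.extend x) (Defs.extend y) p = 0.
  rewrite /Defs.lie !ext0// (derive_unique (is_derive_extend y p x)).
  rewrite (derive_unique (is_derive_extend x p y)) x0 y0 !scale0r !addr0 (spC y x).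
  exact: subrr.
rewrite derive0 /Defs.proj mink0l scale0r subr0 subr0 (spC z y) (spC z x).
by rewrite opprK addrC.
Qed.

End Curvature.

(** * The Codazzi equation for the shape operator of H *)

Section Codazzi.
Context {R : realType}.
Implicit Types (a b x : E6 R).

Lemma gram_coef_tan2 (x : 'I_2 -> E6 R) w : gdet (x 0) (x 1) != 0 ->
  \sum_k (\sum_l invmx (\matrix_(i, j) mink (x i) (x j)) k l * mink w (x l)) *: x k =
  tan2 (x 0) (x 1) w.
Proof.
move=> /gram_invmx[i00 i01 i10 i11]; rewrite !sum_ord2 i00 i01 i10 i11 /tan2.
by congr (_ *: _ + _ *: _); ring.
Qed.

Lemma tan2_swap a b x (u : E6 R) : gdet a b != 0 ->
  u = tan2 a b u -> mink (tan2 a b x) u = mink x u.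
Proof.
move=> d0 uE; rewrite uE /tan2 !minkDl !minkDr !minkZl !minkZr (minkC b a) /gdet in d0 *.
by field.
Qed.

Variables (U : set (E2 R)) (F : 'I_2 -> E2 R -> E6 R) (N H : E2 R -> E6 R)
  (W : 'I_2 -> E2 R -> E6 R).
Hypotheses (oU : open U) (sF : forall i, smooth_on U (F i)) (sN : smooth_on U N)
  (sH : smooth_on U H) (sW : forall i, smooth_on U (W i)).
Implicit Types (q : E2 R) (i j k l : 'I_2).
Hypotheses
  (DF : forall i j q, U q -> pD i (F j) q = pD j (F i) q)
  (DN : forall i q, U q -> pD i N q = F i q + mink (F i q) dt *: dt)
  (FN : forall i q, U q -> mink (F i q) (N q) = 0)
  (NN : forall q, U q -> mink (N q) (N q) = 1)
  (d0 : forall q, U q -> gdet (F 0 q) (F 1 q) != 0)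
  (HF : forall i q, U q -> mink (H q) (F i q) = 0)
  (HN : forall q, U q -> mink (H q) (N q) = 0)
  (Htr : forall q, U q ->
    2 * mink (H q) (H q) = tr2 (F 0 q) (F 1 q)
      (mink (pD 0 (F 0) q) (H q)) (mink (pD 0 (F 1) q) (H q))
      (mink (pD 1 (F 0) q) (H q)) (mink (pD 1 (F 1) q) (H q)))
  (WE : forall i q, U q -> W i q = 2 *: (pD i H q - mink (pD i H q) (N q) *: N q))
  (Wtan : forall i q, U q -> W i q = tan2 (F 0 q) (F 1 q) (W i q)).

(** [W j] is - 2 A_H F_j, and this is the (i, j, l) component of its covariant derivative; the
    Christoffel term takes the form <D_i F_j, W_l> because [W] is tangent and symmetric. *)
Definition cod i j l q : R := mink (pD i (W j) q) (F l q) - mink (pD i (F j) q) (W l q).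

Lemma cod_W_F j l q : U q -> mink (W j q) (F l q) = - 2 * mink (pD j (F l) q) (H q).
Proof.
move=> Uq; rewrite WE// minkZl minkDl minkNl minkZl (minkC (N q)) FN// mulr0 subr0.
by rewrite (pD_mink_cst oU j sH (sF l) (HF l) Uq) (minkC (H q)); ring.
Qed.

Lemma cod_DHN i q : U q -> mink (pD i H q) (N q) = - (mink (F i q) dt * mink (H q) dt).
Proof.
move=> Uq; rewrite (pD_mink_cst oU i sH sN HN Uq) DN// minkDr minkZr HF//; ring.
Qed.

Lemma cod_Dc l q : U q -> pD l (fun y => mink (H y) (H y)) q = 0.
Proof.
move=> Uq; rewrite (pD_mink l sH sH Uq) (minkC (H q)).
have : mink (W l q) (H q) = 2 * mink (pD l H q) (H q).
  by rewrite WE// minkZl minkDl minkNl minkZl (minkC (N q)) HN//; ring.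
have -> : mink (W l q) (H q) = 0.
  by rewrite minkC Wtan// /tan2 minkDr !minkZr !HF// !mulr0 addr0.
by move: (mink (pD l H q) _) => z; lra.
Qed.

Lemma smooth_pD1 i (V : E2 R -> E6 R) : smooth_on U V -> smooth_on U (pD i V).
Proof. by rewrite pD_derive; exact: smooth_derive. Qed.

(** Differentiating <W_j, F_l> = - 2 <D_j F_l, H> isolates what is symmetric in all three indices;
    only the last term, due to the component of D_i H along N, is not. *)
Lemma codE i j l q : U q -> cod i j l q =
  - 2 * mink (pD i (pD j (F l)) q) (H q)
  - (mink (W i q) (pD j (F l) q) + mink (W j q) (pD i (F l) q) + mink (W l q) (pD i (F j) q))
  + 2 * (mink (F i q) dt * mink (H q) dt) * mink (N q) (pD j (F l) q).
Proof.
move=> Uq; rewrite /cod.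
have E y : U y -> mink (W j y) (F l y) = (-2) * mink (pD j (F l) y) (H y).
  by move=> Uy; rewrite cod_W_F.
have := pD_ext i oU E Uq; rewrite (pD_mink i (sW j) (sF l) Uq).
rewrite (pDM i (smooth_cst U (-2 : R)) (smooth_mink oU (smooth_pD1 j (sF l)) sH) Uq).
rewrite pD_cst mul0r add0r (pD_mink i (smooth_pD1 j (sF l)) sH Uq).
have -> : mink (pD j (F l) q) (pD i H q) =
    2^-1 * mink (W i q) (pD j (F l) q)
    - mink (F i q) dt * mink (H q) dt * mink (N q) (pD j (F l) q).
  rewrite WE// minkZl minkDl minkNl minkZl cod_DHN// (minkC (pD j (F l) q)).
  by field.
rewrite (minkC (W l q)).
move: (mink (pD i (W j) q) _) (mink (W j q) _) (mink (pD i (pD j (F l)) q) _) => x1 x2 x3.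
move: (mink (W i q) _) (mink (F i q) dt) (mink (H q) dt) (mink (N q) _) (mink _ (W l q)).
move=> x4 x5 x6 x7 x8 e; have -> : x1 = (x1 + x2) - x2 by ring.
by rewrite e; field.
Qed.

(** The Codazzi equation; the right side is its curvature term. *)
Lemma cod_swap i j l q : U q -> cod i j l q - cod l i j q =
  2 * (mink (F i q) dt * mink (H q) dt) * mink (N q) (pD j (F l) q)
  - 2 * (mink (F l q) dt * mink (H q) dt) * mink (N q) (pD i (F j) q).
Proof.
move=> Uq; rewrite !codE//.
have -> : pD i (pD j (F l)) q = pD l (pD i (F j)) q.
  have E y : U y -> pD j (F l) y = pD l (F j) y by move=> Uy; rewrite DF.
  by rewrite (pD_ext i oU E Uq) (pD2_comm oU (sF j) _ _ Uq).
rewrite (DF l j Uq) (DF l i Uq); move: (mink _ _) (mink _ _) (mink _ _) (mink _ _) (mink _ _)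
  (mink _ _) (mink _ _) (mink _ _) (mink _ _) => *; ring.
Qed.

(* The trace of the covariant derivative of the shape operator of [H] is the
   derivative of its trace, which is constant. *)
Lemma cod_trace l q : U q -> tr2 (F 0 q) (F 1 q)
  (cod l 0 0 q) (cod l 0 1 q) (cod l 1 0 q) (cod l 1 1 q) = 0.
Proof.
move=> Uq; pose g i j y := mink (F i y) (F j y); pose w i j y := mink (W i y) (F j y).
have sg i j : smooth_on U (g i j) by exact: smooth_mink.
have sw i j : smooth_on U (w i j) by exact: smooth_mink.
have sc := smooth_mink oU sH sH; have sk (r : R) := smooth_cst U r.
(* The trace formula multiplied by the Gram determinant, so that only polynomials are
   differentiated. *)
have E y : U y -> g 1 1 y * w 0 0 y + g 0 0 y * w 1 1 y
    + (-1) * (g 0 1 y * (w 0 1 y + w 1 0 y)) =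
    (-4) * (mink (H y) (H y) * (g 0 0 y * g 1 1 y + (-1) * (g 0 1 y * g 0 1 y))).
  move=> Uy; have := Htr Uy; rewrite /w !cod_W_F// /g /tr2 => h.
  have -> : mink (H y) (H y) = 2^-1 * (2 * mink (H y) (H y)) by field.
  have := d0 Uy; rewrite h /gdet => dd; field; exact: dd.
have := pD_ext l oU E Uq.
rewrite (pD_add l (smoothD oU (smoothM oU (sg 1 1) (sw 0 0)) (smoothM oU (sg 0 0) (sw 1 1)))
  (smoothM oU (sk (-1)) (smoothM oU (sg 0 1) (smoothD oU (sw 0 1) (sw 1 0)))) Uq).
rewrite (pD_add l (smoothM oU (sg 1 1) (sw 0 0)) (smoothM oU (sg 0 0) (sw 1 1)) Uq).
rewrite (pDM l (sk (-1)) (smoothM oU (sg 0 1) (smoothD oU (sw 0 1) (sw 1 0))) Uq).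
rewrite (pDM l (sg 0 1) (smoothD oU (sw 0 1) (sw 1 0)) Uq) (pD_add l (sw 0 1) (sw 1 0) Uq).
rewrite (pDM l (sg 1 1) (sw 0 0) Uq) (pDM l (sg 0 0) (sw 1 1) Uq).
rewrite (pDM l (sk (-4)) (smoothM oU sc (smoothD oU (smoothM oU (sg 0 0) (sg 1 1))
  (smoothM oU (sk (-1)) (smoothM oU (sg 0 1) (sg 0 1))))) Uq).
rewrite (pDM l sc (smoothD oU (smoothM oU (sg 0 0) (sg 1 1))
  (smoothM oU (sk (-1)) (smoothM oU (sg 0 1) (sg 0 1)))) Uq).
rewrite (pD_add l (smoothM oU (sg 0 0) (sg 1 1))
  (smoothM oU (sk (-1)) (smoothM oU (sg 0 1) (sg 0 1))) Uq).
rewrite (pDM l (sg 0 0) (sg 1 1) Uq) (pDM l (sk (-1)) (smoothM oU (sg 0 1) (sg 0 1)) Uq).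
rewrite (pDM l (sg 0 1) (sg 0 1) Uq) !pD_cst cod_Dc// !mul0r !add0r.
have Dg i j : pD l (g i j) q = mink (pD l (F i) q) (F j q) + mink (F i q) (pD l (F j) q).
  exact: pD_mink Uq.
have Dw i j : pD l (w i j) q = mink (pD l (W i) q) (F j q) + mink (W i q) (pD l (F j) q).
  exact: pD_mink Uq.
rewrite !Dg !Dw; move: (E q Uq).
have Wx i x : mink x (W i q) = ((g 1 1 q * w i 0 q - g 0 1 q * w i 1 q) * mink x (F 0 q)
    + (g 0 0 q * w i 1 q - g 0 1 q * w i 0 q) * mink x (F 1 q)) / gdet (F 0 q) (F 1 q).
  by rewrite Wtan// /tan2 minkDr !minkZr /g /w; ring.
have w10 : w 1 0 q = w 0 1 q by rewrite /w !cod_W_F// DF.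
have := d0 Uq; rewrite /tr2 /cod !(minkC (W _ q)) !Wx w10.
have -> : gdet (F 0 q) (F 1 q) = g 0 0 q * g 1 1 q - g 0 1 q * g 0 1 q by [].
rewrite !(minkC (F _ q) (pD l _ q)) -/(g 1 1 q) -/(g 0 0 q) -/(g 0 1 q).
move: (mink (pD l (W 0) q) (F 0 q)) (mink (pD l (W 0) q) (F 1 q))
  (mink (pD l (W 1) q) (F 0 q)) (mink (pD l (W 1) q) (F 1 q)) => p00 p01 p10 p11.
move: (mink (pD l (F 0) q) (F 0 q)) (mink (pD l (F 0) q) (F 1 q))
  (mink (pD l (F 1) q) (F 0 q)) (mink (pD l (F 1) q) (F 1 q)) => f00 f01 f10 f11.
move: (g 0 0 q) (g 0 1 q) (g 1 1 q) (w 0 0 q) (w 0 1 q) (w 1 1 q) (mink (H q) (H q)).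
move=> e b d w00 w01 w11 h D0 e1 e2.
(* [e1], the identity [E] at the point itself, eliminates |H|^2 from the differentiated identity
   [e2]. *)
have hE : h = - (d * w00 + e * w11 - b * (w01 + w01)) / (4 * (e * d - b * b)).
  have -> : d * w00 + e * w11 - b * (w01 + w01) = -4 * (h * (e * d + -1 * (b * b))).
    by rewrite -e1; ring.
  by field.
move: e2; set L2 := (X in X = _); set R2 := (X in _ = X) => e2.
rewrite [LHS](_ : _ = (L2 - R2) / (e * d - b * b)); first by rewrite e2 subrr mul0r.
by rewrite /L2 /R2 hE; field.
Qed.

(** By Codazzi the index l moves to the front, where the trace vanishes; the curvature term
    contracts to 2 <H, dt> (2 t_l - t_l). *)
Lemma cod_trace_swap l q : U q ->
  (forall i j, mink (pD i (F j) q) (N q) =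
     - (mink (F i q) (F j q) + mink (F i q) dt * mink (F j q) dt)) ->
  tr2 (F 0 q) (F 1 q) (cod 0 0 l q) (cod 0 1 l q) (cod 1 0 l q) (cod 1 1 l q) =
  2 * mink (H q) dt * mink (F l q) dt.
Proof.
move=> Uq FFN; have c i j : cod i j l q = cod l i j q +
    2 * mink (H q) dt * (mink (F l q) dt * mink (F i q) (F j q)
      - mink (F i q) dt * mink (F j q) (F l q)).
  rewrite -[LHS](subrK (cod l i j q)) addrC cod_swap// !(minkC (N q)) !FFN.
  by rewrite (minkC (F j q) (F l q)); ring.
have T0 := cod_trace l Uq; have D0 := d0 Uq.
have -> : tr2 (F 0 q) (F 1 q) (cod 0 0 l q) (cod 0 1 l q) (cod 1 0 l q) (cod 1 1 l q) =
  tr2 (F 0 q) (F 1 q) (cod l 0 0 q) (cod l 0 1 q) (cod l 1 0 q) (cod l 1 1 q)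
  + 2 * mink (H q) dt * mink (F l q) dt.
  rewrite !c; move: (cod l 0 0 q) (cod l 0 1 q) (cod l 1 0 q) (cod l 1 1 q) => a1 a2 a3 a4.
  move: l {c T0}; apply: ord2P; move: D0; rewrite /tr2 /gdet !(minkC (F 1 q) (F 0 q));
  by move=> D0; field.
by rewrite T0 add0r.
Qed.

End Codazzi.

(** * The tangential part of the bitension field *)

Section BitensionField.
Context {R : realType}.
Variables (U : set (E2 R)) (f : E2 R -> E6 R).
Hypotheses (oU : open U) (sf : smooth_on U f).
Hypothesis fS : forall q, U q -> RxS4 (f q).
Hypothesis f_pos : forall q, U q -> forall v : E2 R, v != 0 ->
  0 < mink ('D_v f q) ('D_v f q).
Implicit Types (q : E2 R) (w x : E6 R) (i j k l : 'I_2).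

Let d0 q : U q -> gdet (pD 0 f q) (pD 1 f q) != 0.
Proof. exact: gram_det_neq0. Qed.
Let oN i q : U q -> mink (pD i f q) (unormal (f q)) = 0.
Proof. by move=> Uq; exact: (pD_orth_unormal oU sf fS i Uq). Qed.

Lemma mink_proj q w x : U q -> mink x (unormal (f q)) = 0 ->
  mink (Defs.proj (f q) w) x = mink w x.
Proof.
by move=> Uq xN; rewrite /Defs.proj minkDl minkNl minkZl (minkC (unormal _)) xN mulr0 subr0.
Qed.

Lemma tang_proj q w : U q -> tang f q (Defs.proj (f q) w) = tang f q w.
Proof.
move=> Uq; rewrite (tangE sf f_pos _ Uq) (tangE sf f_pos w Uq) /tan2.
by rewrite !mink_proj// ?oN.
Qed.

(** Of the six terms in the derivatives of the metric, four cancel by symmetry of the second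
    derivatives and the other two are equal. *)
Lemma christoffelE k i j q : U q -> christoffel f k i j q =
  \sum_l fform_inv f q k l * mink (pD i (pD j f) q) (pD l f q).
Proof.
move=> Uq; rewrite /christoffel mulr_sumr; apply: eq_bigr => l _.
have ffE a b : (fun r => fform f r a b) = (fun r => mink (pD a f r) (pD b f r)).
  by apply/funext => r; rewrite mxE pdE.
have sp a := smooth_pD sf a.
rewrite !pdE !ffE !(fun a b c => pD_mink a (sp b) (sp c) Uq).
rewrite (pD2_comm oU sf l j Uq) (pD2_comm oU sf l i Uq) (pD2_comm oU sf j i Uq).
rewrite (minkC (pD i f q)) (minkC (pD j f q) (pD i (pD l f) q)).
move: (mink _ _) (mink _ _) (mink _ _) (fform_inv f q k l) => a b c d; by field.
Qed.

Lemma sum_christoffel i j q : U q ->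
  \sum_k christoffel f k i j q *: pD k f q =
  tan2 (pD 0 f q) (pD 1 f q) (pD i (pD j f) q).
Proof.
move=> Uq; rewrite -(@gram_coef_tan2 _ (fun a => pD a f q) _ (d0 Uq)).
by apply: eq_bigr => k _; rewrite christoffelE// /fform_inv /fform pdE.
Qed.

Lemma tensionE q : U q -> tension f q = 2 *: mean_curvature f q.
Proof.
move=> Uq; rewrite /mean_curvature scalerA divff ?pnatr_eq0// scale1r /tension.
rewrite !trace_g_gtrace /gtrace; apply: eq_bigr => i _; apply: eq_bigr => j _.
congr (_ *: _); rewrite pdE sum_christoffel// /sff /norm_part pdE; congr (_ - _).
by rewrite /nabla pdE tang_proj// (tangE sf f_pos _ Uq).
Qed.

Hypothesis f_pmcv : forall q, U q -> forall i,
  nabla_perp f i (mean_curvature f) q = 0.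

Let H := mean_curvature f.
Let W j q := nabla f j (tension f) q.
Let sH : smooth_on U H. Proof. exact: smooth_mean_curvature. Qed.
Let sN : smooth_on U (fun y => unormal (f y)). Proof. exact: smooth_unormal. Qed.
Let sF i : smooth_on U (pD i f). Proof. exact: smooth_pD. Qed.

Lemma nabla_mean_curvature_tan i q : U q ->
  Defs.proj (f q) (pD i H q) = tan2 (pD 0 f q) (pD 1 f q) (Defs.proj (f q) (pD i H q)).
Proof.
move=> Uq; have := f_pmcv Uq i; rewrite /nabla_perp /norm_part /nabla pdE.
by rewrite -(tangE sf f_pos _ Uq) => /subr0_eq.
Qed.

Lemma mean_curvature_HN q : U q -> mink (H q) (unormal (f q)) = 0.
Proof. by move=> Uq; apply: (@mean_curvature_orth_unormal _ U). Qed.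

Lemma mean_curvature_HF i q : U q -> mink (H q) (pD i f q) = 0.
Proof. by move=> Uq; apply: (@mean_curvature_orth _ U). Qed.

Lemma nabla_tensionE i q : U q ->
  W i q = 2 *: (pD i H q - mink (pD i H q) (unormal (f q)) *: unormal (f q)).
Proof.
move=> Uq; rewrite /W /nabla pdE.
rewrite (pD_ext i oU tensionE Uq) (pDZ i (smooth_cst U (2 : R)) sH Uq).
by rewrite pD_cst scale0r add0r /Defs.proj minkZl scalerBr scalerA.
Qed.

Lemma tan2Z a b w (r : R) : tan2 a b (r *: w) = r *: tan2 a b w.
Proof. by rewrite /tan2 !minkZl scalerDr !scalerA; congr (_ *: _ + _ *: _); ring. Qed.

Lemma nabla_tension_tan i q : U q ->
  W i q = tan2 (pD 0 f q) (pD 1 f q) (W i q).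
Proof.
by move=> Uq; rewrite nabla_tensionE// tan2Z; congr (_ *: _); exact: nabla_mean_curvature_tan.
Qed.

Lemma smooth_nabla_tension i : smooth_on U (W i).
Proof.
apply: smooth_nabla => //.
apply: (smooth_ext oU _ (smoothZ oU (smooth_cst U (2 : R)) sH)) => y Uy.
by rewrite tensionE.
Qed.

Lemma mean_curvature_trace q : U q -> 2 * mink (H q) (H q) =
  tr2 (pD 0 f q) (pD 1 f q)
      (mink (pD 0 (pD 0 f) q) (H q)) (mink (pD 0 (pD 1 f) q) (H q))
      (mink (pD 1 (pD 0 f) q) (H q)) (mink (pD 1 (pD 1 f) q) (H q)).
Proof.
move=> Uq; have := mink_mean_curvature oU sf fS f_pos Uq (fun k => mean_curvature_HF k Uq).
by rewrite (minkC (unormal _)) mean_curvature_HN// mulr0 addr0.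
Qed.

Lemma mean_curvature_sqr_cst i q : U q -> pD i (fun y => mink (H y) (H y)) q = 0.
Proof.
move=> Uq; apply: (@cod_Dc _ U (fun i => pD i f) (fun y => unormal (f y)) H W) => //.
- exact: mean_curvature_HF.
- exact: mean_curvature_HN.
- exact: nabla_tensionE.
- exact: nabla_tension_tan.
Qed.

(** By PMCV the covariant derivative [W] of the tension field is tangent, so its second covariant
    derivative tested on d_l f is [cod], and the contracted Codazzi equation applies. *)
Lemma rough_laplacian_tension l q : U q ->
  mink (rough_laplacian f (tension f) q) (pD l f q) =
  2 * mink (H q) dt * mink (pD l f q) dt.
Proof.
move=> Uq; rewrite /rough_laplacian (mink_trace_g sf f_pos _ _ Uq).
have DF i j y : U y -> pD i (pD j f) y = pD j (pD i f) y by move=> Uy; exact: pD2_comm Uy.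
have DN i y : U y -> pD i (fun z => unormal (f z)) y = pD i f y + mink (pD i f y) dt *: dt.
  by move=> Uy; exact: pD_unormal Uy.
have NN y : U y -> mink (unormal (f y)) (unormal (f y)) = 1.
  by move=> Uy; exact: (mink_unormal_unormal fS Uy).
have WF := cod_W_F oU sF sH oN mean_curvature_HF nabla_tensionE.
rewrite -(@cod_trace_swap _ U (fun i => pD i f) (fun y => unormal (f y)) H W oU sF sN sH
  smooth_nabla_tension DF DN oN d0 mean_curvature_HF mean_curvature_HN mean_curvature_trace
  nabla_tensionE nabla_tension_tan l q Uq); last first.
  by move=> i j; exact: (mink_pD2_unormal oU sf fS).
have sym a b : mink (W a q) (pD b f q) = mink (pD a f q) (W b q).
  refine (etrans (WF a b q Uq) (etrans _ (etrans (esym (WF b a q Uq)) (minkC _ _)))).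
  exact: (congr1 (fun z => -2 * mink z (H q)) (DF a b q Uq)).
have E i j : mink (nabla f i (W j) q - \sum_k christoffel f k i j q *: W k q) (pD l f q) =
    cod (fun i => pD i f) W i j l q.
  rewrite minkDl minkNl mink_suml /cod /nabla pdE mink_proj ?oN//; congr (_ - _).
  rewrite -(tan2_swap _ (d0 Uq) (nabla_tension_tan l Uq)) -sum_christoffel// mink_suml.
  apply: eq_bigr => k _; rewrite !minkZl; congr (_ * _).
  exact: sym.
by congr tr2; exact: E.
Qed.

(** The tension field is normal, so the curvature sees it through [sp] as 2 <H, dt> t_a only; the
    trace contracts to 2 <H, dt> (t_l - 2 t_l). *)
Lemma trace_curvature_tension l q : U q ->
  mink (trace_g f q (fun i j => Defs.curvature (f q) (pd i f q) (tension f q) (pd j f q)))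
    (pD l f q) = - 2 * mink (H q) dt * mink (pD l f q) dt.
Proof.
move=> Uq; rewrite (mink_trace_g sf f_pos _ _ Uq) pdE.
have VN : mink (tension f q) (unormal (f q)) = 0.
  by rewrite tensionE// minkZl mean_curvature_HN// mulr0.
have sV a : mink (tension f q) (unormal (pD a f q)) =
    2 * mink (H q) dt * mink (pD a f q) dt.
  by rewrite tensionE// minkZl mink_unormal mean_curvature_HF// add0r mulrA.
have E i j : mink (Defs.curvature (f q) (pD i f q) (tension f q) (pD j f q)) (pD l f q) =
    2 * mink (H q) dt * (mink (pD j f q) dt * mink (pD i f q) (pD l f q)
      - mink (pD l f q) dt * mink (pD i f q) (pD j f q)).
  rewrite curvatureE ?oN//; last exact: fS.
  rewrite minkDl minkNl (minkZl _ (unormal (pD i f q))) (minkZl _ (unormal (tension f q))).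
  rewrite (minkC (unormal (pD i f q))) (minkC (unormal (tension f q))).
  rewrite (spC (pD l f q) (tension f q)) !sV (spC (pD l f q)) !mink_unormal; ring.
have D0 := d0 Uq; rewrite /tr_g.
transitivity (tr2 (pD 0 f q) (pD 1 f q)
  (2 * mink (H q) dt * (mink (pD 0 f q) dt * mink (pD 0 f q) (pD l f q)
      - mink (pD l f q) dt * mink (pD 0 f q) (pD 0 f q)))
  (2 * mink (H q) dt * (mink (pD 1 f q) dt * mink (pD 0 f q) (pD l f q)
      - mink (pD l f q) dt * mink (pD 0 f q) (pD 1 f q)))
  (2 * mink (H q) dt * (mink (pD 0 f q) dt * mink (pD 1 f q) (pD l f q)
      - mink (pD l f q) dt * mink (pD 1 f q) (pD 0 f q)))
  (2 * mink (H q) dt * (mink (pD 1 f q) dt * mink (pD 1 f q) (pD l f q)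
      - mink (pD l f q) dt * mink (pD 1 f q) (pD 1 f q)))).
  by congr tr2; exact: E.
move: l {E}; apply: ord2P; move: D0; rewrite /tr2 /gdet !(minkC (pD 1 f q) (pD 0 f q));
by move=> D0; field.
Qed.

Lemma bitension_tangent l q : U q ->
  mink (bitension f q) (pD l f q) = 4 * mink (H q) dt * mink (pD l f q) dt.
Proof.
move=> Uq; rewrite /bitension minkDl minkNl rough_laplacian_tension//.
by rewrite trace_curvature_tension//; ring.
Qed.

Lemma biconservative_at q : U q -> tang f q dt != 0 ->
  tang f q (bitension f q) = 0 <-> mink (H q) dt = 0.
Proof.
move=> Uq T0; split=> [/(tang_eq0 sf f_pos _ Uq) b0|H0]; last first.
  by apply/(tang_eq0 sf f_pos _ Uq) => l; rewrite bitension_tangent// H0; ring.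
apply/eqP; apply: contraNT T0 => H0; apply/eqP/(tang_eq0 sf f_pos _ Uq) => l.
have := b0 l; rewrite bitension_tangent// => /eqP.
by rewrite mulf_eq0 mulf_eq0 pnatr_eq0/= (negbTE H0)/= (minkC dt) => /eqP.
Qed.

End BitensionField.

(** * Reparametrizations *)

Section ChangeOfBasis.
Context {R : realType}.
Implicit Types (a b w : E6 R).
Variables (k00 k01 k10 k11 : R).
Hypothesis k0 : k00 * k11 - k01 * k10 != 0.

Lemma gdet_basis a b : gdet (k00 *: a + k01 *: b) (k10 *: a + k11 *: b) =
  (k00 * k11 - k01 * k10) ^+ 2 * gdet a b.
Proof. by rewrite /gdet !minkL (minkC b a); ring. Qed.

Lemma tan2_basis a b w : gdet a b != 0 ->
  tan2 (k00 *: a + k01 *: b) (k10 *: a + k11 *: b) w = tan2 a b w.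
Proof.
move=> d0; rewrite /tan2 gdet_basis !minkL (minkC b a) /gdet in d0 *.
apply/rowP => i; rewrite ![in LHS]mxE ![in RHS]mxE; field.
by rewrite d0 k0.
Qed.

Lemma gtrace_basis (x x' : 'I_2 -> E6 R) (B B' : 'I_2 -> 'I_2 -> E6 R) :
  gdet (x 0) (x 1) != 0 ->
  x' 0 = k00 *: x 0 + k01 *: x 1 -> x' 1 = k10 *: x 0 + k11 *: x 1 ->
  B' 0 0 = k00 *: (k00 *: B 0 0 + k01 *: B 0 1) + k01 *: (k00 *: B 1 0 + k01 *: B 1 1) ->
  B' 0 1 = k00 *: (k10 *: B 0 0 + k11 *: B 0 1) + k01 *: (k10 *: B 1 0 + k11 *: B 1 1) ->
  B' 1 0 = k10 *: (k00 *: B 0 0 + k01 *: B 0 1) + k11 *: (k00 *: B 1 0 + k01 *: B 1 1) ->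
  B' 1 1 = k10 *: (k10 *: B 0 0 + k11 *: B 0 1) + k11 *: (k10 *: B 1 0 + k11 *: B 1 1) ->
  gtrace x' B' = gtrace x B.
Proof.
move=> d0 x0 x1 b00 b01 b10 b11; have d0' : gdet (x' 0) (x' 1) != 0.
  by rewrite x0 x1 gdet_basis mulf_neq0// expf_neq0.
rewrite (gtraceE _ d0) (gtraceE _ d0') x0 x1 b00 b01 b10 b11 gdet_basis !minkL.
rewrite (minkC (x 1) (x 0)) /gdet in d0 *.
move: (B 0 0) (B 0 1) (B 1 0) (B 1 1) d0.
move: (mink (x 0) (x 0)) (mink (x 0) (x 1)) (mink (x 1) (x 1)).
move=> e b d B0 B1 B2 B3 d0.
apply/rowP => i; rewrite ![in LHS]mxE ![in RHS]mxE; field.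
by rewrite d0 k0.
Qed.

End ChangeOfBasis.

Section NormalProjection.
Context {R : realType}.
Variables (U : set (E2 R)) (f : E2 R -> E6 R).
Hypotheses (oU : open U) (sf : smooth_on U f).
Hypothesis fS : forall q, U q -> RxS4 (f q).
Hypothesis f_pos : forall q, U q -> forall v : E2 R, v != 0 ->
  0 < mink ('D_v f q) ('D_v f q).

Definition normal_proj (a b n w : E6 R) : E6 R := w - mink w n *: n - tan2 a b w.

Lemma tan2D (a b w w' : E6 R) : tan2 a b (w + w') = tan2 a b w + tan2 a b w'.
Proof. by rewrite /tan2 !minkDl; apply/rowP => i; rewrite !mxE; ring. Qed.

Lemma normal_projD a b n w w' :
  normal_proj a b n (w + w') = normal_proj a b n w + normal_proj a b n w'.
Proof. by rewrite /normal_proj tan2D minkDl; apply/rowP => i; rewrite !mxE; ring. Qed.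

Lemma normal_projZ a b n (r : R) w :
  normal_proj a b n (r *: w) = r *: normal_proj a b n w.
Proof. by rewrite /normal_proj tan2Z minkZl; apply/rowP => i; rewrite !mxE; ring. Qed.

Lemma normal_proj_tangent a b n (r s : R) : gdet a b != 0 -> mink a n = 0 -> mink b n = 0 ->
  normal_proj a b n (r *: a + s *: b) = 0.
Proof.
move=> d0 an bn; rewrite /normal_proj tan2_lincomb// minkDl !minkZl an bn !mulr0 addr0.
by rewrite scale0r subr0 subrr.
Qed.

Lemma nabla_perpE i V q : U q -> nabla_perp f i V q =
  normal_proj (pD 0 f q) (pD 1 f q) (unormal (f q)) (pD i V q).
Proof.
move=> Uq; rewrite /nabla_perp /norm_part /nabla pdE.
by rewrite (tang_proj oU sf fS f_pos _ Uq) (tangE sf f_pos _ Uq).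
Qed.

Lemma sffE i j q : U q -> sff f i j q =
  normal_proj (pD 0 f q) (pD 1 f q) (unormal (f q)) (pD i (pD j f) q).
Proof. by move=> Uq; rewrite /sff pdE; exact: nabla_perpE. Qed.

End NormalProjection.

Section Reparametrization.
Context {R : realType}.
Variables (U U' : set (E2 R)) (f f' : E2 R -> E6 R) (h : E2 R -> E2 R).
Hypotheses (oU : open U) (sf : smooth_on U f).
Hypothesis fS : forall q, U q -> RxS4 (f q).
Hypothesis f_pos : forall q, U q -> forall v : E2 R, v != 0 ->
  0 < mink ('D_v f q) ('D_v f q).
Hypotheses (oU' : open U') (sh : smooth_on U' h) (hU : forall q, U' q -> U (h q)).
Hypothesis h_inj : forall q v, U' q -> 'D_v h q = 0 -> v = 0.
Hypothesis f'E : forall q, U' q -> f' q = f (h q).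

Let k i a q : R := pD i h q 0 a.

Lemma smooth_reparam (V : E2 R -> E6 R) : smooth_on U V -> smooth_on U' (fun q => V (h q)).
Proof. by move=> sV; exact: (smooth_comp_rV oU' oU hU sh sV). Qed.

Lemma smooth_k i a : smooth_on U' (k i a).
Proof.
have sD : smooth_on U' (pD i h) by rewrite pD_derive; exact: smooth_derive.
exact: (smooth_rVP oU' _).1 sD a.
Qed.

Lemma pD_reparam i (V : E2 R -> E6 R) q : smooth_on U V -> U' q ->
  pD i (fun y => V (h y)) q = k i 0 q *: pD 0 V (h q) + k i 1 q *: pD 1 V (h q).
Proof.
move=> sV Uq; have dV := smooth_differentiable sV (hU Uq).
rewrite pD_deriveE; refine (etrans (derive_compE _ (smooth_differentiable sh Uq) dV) _).
by rewrite derive_pD// /k !pD_deriveE.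
Qed.

Lemma smooth_reparam_surface : smooth_on U' f'.
Proof.
by apply: (smooth_ext oU' _ (smooth_reparam sf)) => y Uy; rewrite f'E.
Qed.

Lemma pD_reparam_surface i q : U' q ->
  pD i f' q = k i 0 q *: pD 0 f (h q) + k i 1 q *: pD 1 f (h q).
Proof. by move=> Uq; rewrite (pD_ext i oU' f'E Uq) pD_reparam. Qed.

Lemma RxS4_reparam q : U' q -> RxS4 (f' q).
Proof. by move=> Uq; rewrite f'E//; exact/fS/hU. Qed.

Lemma derive_reparam_surface q v : U' q -> 'D_v f' q = 'D_('D_v h q) f (h q).
Proof.
move=> Uq; refine (etrans (near_eq_deriveU v oU' Uq f'E) _).
apply: derive_compE; first exact: smooth_differentiable Uq.
exact: smooth_differentiable (hU Uq).
Qed.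

Lemma spacelike_reparam q : U' q -> forall v : E2 R, v != 0 -> 0 < mink ('D_v f' q) ('D_v f' q).
Proof.
move=> Uq v vn; rewrite derive_reparam_surface//; apply: f_pos; first exact: hU.
by apply: contra vn => /eqP/(h_inj Uq)->.
Qed.

(** Read off from the Gram determinant of [f'], which is the square of this determinant times that
    of [f]. *)
Lemma k_det q : U' q -> k 0 0 q * k 1 1 q - k 0 1 q * k 1 0 q != 0.
Proof.
move=> Uq; have := gram_det_neq0 smooth_reparam_surface spacelike_reparam Uq; rewrite /gram_det !pD_reparam_surface//.
by rewrite gdet_basis mulf_eq0 negb_or sqrf_eq0 => /andP[].
Qed.

Lemma tang_reparam q w : U' q -> tang f' q w = tang f (h q) w.
Proof.
move=> Uq; rewrite (tangE smooth_reparam_surface spacelike_reparam _ Uq) (tangE sf f_pos _ (hU Uq)) !pD_reparam_surface//.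
by rewrite tan2_basis//; [exact: k_det|exact: (gram_det_neq0 sf f_pos (hU Uq))].
Qed.

Lemma normal_proj_reparam q w : U' q ->
  normal_proj (pD 0 f' q) (pD 1 f' q) (unormal (f' q)) w =
  normal_proj (pD 0 f (h q)) (pD 1 f (h q)) (unormal (f (h q))) w.
Proof.
move=> Uq; rewrite /normal_proj f'E// !pD_reparam_surface// tan2_basis//; first exact: k_det.
exact: (gram_det_neq0 sf f_pos (hU Uq)).
Qed.

Lemma nabla_perp_reparam i (V V' : E2 R -> E6 R) q : smooth_on U V ->
  (forall y, U' y -> V' y = V (h y)) -> U' q ->
  nabla_perp f' i V' q =
  k i 0 q *: nabla_perp f 0 V (h q) + k i 1 q *: nabla_perp f 1 V (h q).
Proof.
move=> sV VE Uq; rewrite (nabla_perpE oU' smooth_reparam_surface RxS4_reparam spacelike_reparam i V' Uq).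
rewrite !(nabla_perpE oU sf fS f_pos _ V (hU Uq)) normal_proj_reparam//.
by rewrite (pD_ext i oU' VE Uq) pD_reparam// normal_projD !normal_projZ.
Qed.

Lemma pD2_reparam_surface i j q : U' q -> pD i (pD j f') q =
  (k i 0 q *: (k j 0 q *: pD 0 (pD 0 f) (h q) + k j 1 q *: pD 0 (pD 1 f) (h q))
   + k i 1 q *: (k j 0 q *: pD 1 (pD 0 f) (h q) + k j 1 q *: pD 1 (pD 1 f) (h q)))
  + (pD i (k j 0) q *: pD 0 f (h q) + pD i (k j 1) q *: pD 1 f (h q)).
Proof.
move=> Uq; have s0 := smooth_pD sf 0; have s1 := smooth_pD sf 1.
have E y : U' y -> pD j f' y = k j 0 y *: pD 0 f (h y) + k j 1 y *: pD 1 f (h y).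
  by move=> Uy; exact: pD_reparam_surface.
rewrite (pD_ext i oU' E Uq).
rewrite (pD_add i (smoothZ oU' (smooth_k j 0) (smooth_reparam s0))
  (smoothZ oU' (smooth_k j 1) (smooth_reparam s1)) Uq).
rewrite (pDZ i (smooth_k j 0) (smooth_reparam s0) Uq).
rewrite (pDZ i (smooth_k j 1) (smooth_reparam s1) Uq).
rewrite (pD_reparam i s0 Uq) (pD_reparam i s1 Uq).
move: (pD i (k j 0) q) (pD i (k j 1) q) (k i 0 q) (k i 1 q) (k j 0 q) (k j 1 q).
move: (pD 0 (pD 0 f) (h q)) (pD 1 (pD 0 f) (h q)) (pD 0 (pD 1 f) (h q)) (pD 1 (pD 1 f) (h q)).
move: (pD 0 f (h q)) (pD 1 f (h q)) => *.
by apply/rowP => l; rewrite ![in LHS]mxE ![in RHS]mxE; ring.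
Qed.

(** The derivatives of the coefficients [k] contribute tangent vectors only, and [normal_proj] kills
    these. *)
Lemma sff_reparam i j q : U' q -> sff f' i j q =
  k i 0 q *: (k j 0 q *: sff f 0 0 (h q) + k j 1 q *: sff f 0 1 (h q))
   + k i 1 q *: (k j 0 q *: sff f 1 0 (h q) + k j 1 q *: sff f 1 1 (h q)).
Proof.
move=> Uq; rewrite (sffE oU' smooth_reparam_surface RxS4_reparam spacelike_reparam _ _ Uq).
rewrite !(sffE oU sf fS f_pos _ _ (hU Uq)) normal_proj_reparam// pD2_reparam_surface//.
rewrite normal_projD [X in _ + X]normal_proj_tangent ?addr0; last first.
- exact: (pD_orth_unormal oU sf fS _ (hU Uq)).
- exact: (pD_orth_unormal oU sf fS _ (hU Uq)).
- exact: (gram_det_neq0 sf f_pos (hU Uq)).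
by rewrite !(normal_projD, normal_projZ).
Qed.

Lemma mean_curvature_reparam q : U' q -> mean_curvature f' q = mean_curvature f (h q).
Proof.
move=> Uq; refine (congr1 (fun z : E6 R => 2^-1 *: z) _).
refine (etrans (trace_g_gtrace _ _ _) (etrans _ (esym (trace_g_gtrace _ _ _)))).
apply: (@gtrace_basis _ (k 0 0 q) (k 0 1 q) (k 1 0 q) (k 1 1 q)).
- exact: k_det.
- exact: (gram_det_neq0 sf f_pos (hU Uq)).
- exact: pD_reparam_surface.
- exact: pD_reparam_surface.
- exact: sff_reparam.
- exact: sff_reparam.
- exact: sff_reparam.
- exact: sff_reparam.
Qed.

End Reparametrization.

(** * The model surface *)

Section SmoothTrig.
Context {R : realType} {V : normedModType R}.
Variable U : set V.
Hypothesis oU : open U.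

Lemma derive_compR (a : V -> R) (g : R -> R) q v (dg : R) : differentiable a q ->
  is_derive (a q) 1 g dg ->
  differentiable (fun y => g (a y)) q /\ 'D_v (fun y => g (a y)) q = 'D_v a q * dg.
Proof.
move=> da Hg; have dfg : differentiable g (a q).
  by apply/derivable1_diffP; case: Hg.
split; first exact: (differentiable_comp da dfg).
refine (etrans (derive_compE v da dfg) _).
rewrite deriveE// -[X in 'd g _ X]mulr1 -[X in 'd g _ X]/('D_v a q *: (1 : R)) linearZ.
by rewrite -deriveE// derive_val.
Qed.

(** Sine and cosine are treated together, as each occurs in the derivative of the other. *)
Lemma Ck_sincos (a : V -> R) k : Ck U k a ->
  Ck U k (fun y => sin (a y)) /\ Ck U k (fun y => cos (a y)).
Proof.
elim: k => [|k IH] ca.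
  by split=> x Ux; [apply: (continuous_comp (ca x Ux)); exact: continuous_sin|
    apply: (continuous_comp (ca x Ux)); exact: continuous_cos].
have [cs cc] := IH (CkW ca); have da x := @Ck_differentiable _ _ _ U k a x ca.
split; (split=> [x Ux|v]; first by
  exact: (derive_compR 0 (da x Ux) (is_derive_sin _)).1 ||
  exact: (derive_compR 0 (da x Ux) (is_derive_cos _)).1).
  apply: Ck_ext (CkM oU (ca.2 v) cc) => // y Uy.
  by rewrite (derive_compR v (da y Uy) (is_derive_sin _)).2.
apply: Ck_ext (CkM oU (ca.2 v) (CkM oU (Ck_cst U k (-1 : R)) cs)) => // y Uy.
by rewrite (derive_compR v (da y Uy) (is_derive_cos _)).2 /cst mulN1r.
Qed.

Lemma smooth_sin (a : V -> R) : smooth_on U a -> smooth_on U (fun y => sin (a y)).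
Proof. by move=> sa k; exact: (Ck_sincos (sa k)).1. Qed.

Lemma smooth_cos (a : V -> R) : smooth_on U a -> smooth_on U (fun y => cos (a y)).
Proof. by move=> sa k; exact: (Ck_sincos (sa k)).2. Qed.

Lemma smooth_atan (a : V -> R) : smooth_on U a -> smooth_on U (fun y => atan (a y)).
Proof.
move=> sa; elim=> [|k IH].
  move=> x Ux; apply: (continuous_comp (Ck_continuous (sa 0) Ux)).
  exact: continuous_atan.
have da x (Ux : U x) := smooth_differentiable sa Ux.
split=> [x Ux|v]; first exact: (derive_compR 0 (da x Ux) (is_derive1_atan _)).1.
have p1 y : 1 + a y * a y != 0.
  by rewrite gt_eqF// ltr_pwDl// -expr2 sqr_ge0.
have sI := smoothV oU (fun y _ => p1 y) (smoothD oU (smooth_cst U (1 : R)) (smoothM oU sa sa)).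
apply: Ck_ext (CkM oU ((sa k.+1).2 v) (sI k)) => // y Uy.
by rewrite (derive_compR v (da y Uy) (is_derive1_atan _)).2 expr2.
Qed.

Lemma derive_sin (a : V -> R) q v : smooth_on U a -> U q ->
  'D_v (fun y => sin (a y)) q = 'D_v a q * cos (a q).
Proof.
by move=> sa Uq; exact: (derive_compR v (smooth_differentiable sa Uq) (is_derive_sin _)).2.
Qed.

Lemma derive_cos (a : V -> R) q v : smooth_on U a -> U q ->
  'D_v (fun y => cos (a y)) q = - ('D_v a q * sin (a q)).
Proof.
move=> sa Uq; rewrite -mulrN.
exact: (derive_compR v (smooth_differentiable sa Uq) (is_derive_cos _)).2.
Qed.

End SmoothTrig.

Section Coordinates.
Context {R : realType} {n : nat}.

Lemma derive_coord (q v : 'rV[R]_n) i : 'D_v (fun y : 'rV[R]_n => y 0 i) q = v 0 i.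
Proof.
have H := is_derive_id q v.
by apply: derive_unique; exact: (is_derive_rVP _ _ _ _).1 H i.
Qed.

Lemma smooth_coord (U : set 'rV[R]_n) i : open U ->
  smooth_on U (fun y : 'rV[R]_n => y 0 i).
Proof.
move=> oU [|k]; first by move=> x Ux; exact: coord_continuous.
split=> [x _|v]; first exact: differentiable_coord.
by apply: Ck_ext (Ck_cst U k (v 0 i)) => // y _; rewrite derive_coord.
Qed.

End Coordinates.

Lemma tan2_eq0 {R : realType} (a b w : E6 R) :
  mink w a = 0 -> mink w b = 0 -> tan2 a b w = 0.
Proof. by move=> wa wb; rewrite /tan2 wa wb !mulr0 !subrr !mul0r !scale0r addr0. Qed.

Lemma gtrace_orthonormal {R : realType} (x : 'I_2 -> E6 R) B :
  mink (x 0) (x 0) = 1 -> mink (x 0) (x 1) = 0 -> mink (x 1) (x 1) = 1 ->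
  gtrace x B = B 0 0 + B 1 1.
Proof.
move=> g00 g01 g11; have d1 : gdet (x 0) (x 1) = 1 by rewrite /gdet g00 g01 g11; ring.
by rewrite gtraceE d1 ?oner_neq0// invr1 g00 g01 g11 scale0r subr0 !scale1r.
Qed.

Record spatial_frame {R : realType} (e1 e2 e3 e4 e5 : E6 R) : Prop := SpatialFrame {
  fe1dt : mink e1 dt = 0;
  fe2dt : mink e2 dt = 0;
  fe3dt : mink e3 dt = 0;
  fe4dt : mink e4 dt = 0;
  fe5dt : mink e5 dt = 0;
  fe11 : mink e1 e1 = 1;
  fe22 : mink e2 e2 = 1;
  fe33 : mink e3 e3 = 1;
  fe44 : mink e4 e4 = 1;
  fe55 : mink e5 e5 = 1;
  fe12 : mink e1 e2 = 0;
  fe13 : mink e1 e3 = 0;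
  fe14 : mink e1 e4 = 0;
  fe15 : mink e1 e5 = 0;
  fe23 : mink e2 e3 = 0;
  fe24 : mink e2 e4 = 0;
  fe25 : mink e2 e5 = 0;
  fe34 : mink e3 e4 = 0;
  fe35 : mink e3 e5 = 0;
  fe45 : mink e4 e5 = 0 }.

Section ModelSurface.
Context {R : realType}.
Variables (e1 e2 e3 e4 e5 : E6 R) (t0 bt b1 b2 b3 : R).
Hypothesis e_frame : spatial_frame e1 e2 e3 e4 e5.
Hypotheses (btE : bt ^+ 2 = b1 ^+ 2) (b3n : b3 != 0)
  (bE : b2 ^+ 2 + b3 ^+ 2 = (b1 ^+ 2 + 2)^-1).

Variables (s r : R) (cu su cv sv : E2 R -> R).
Hypotheses (ss : s * s = b1 ^+ 2 + 2) (rr : r * r = b1 ^+ 2 + 1) (s0 : s != 0).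
Hypotheses (scu : smooth_on setT cu) (ssu : smooth_on setT su)
  (scv : smooth_on setT cv) (ssv : smooth_on setT sv).
Hypotheses
  (pD_cu : forall i q, pD i cu q = - (s * (i == 0)%:R * su q))
  (pD_su : forall i q, pD i su q = s * (i == 0)%:R * cu q)
  (pD_cv : forall i q, pD i cv q = - ((i == 1)%:R / b3 * sv q))
  (pD_sv : forall i q, pD i sv q = (i == 1)%:R / b3 * cv q)
  (cs2u : forall q, su q * su q = 1 - cu q * cu q)
  (cs2v : forall q, sv q * sv q = 1 - cv q * cv q).

Let oT : open [set: E2 R] := openT.
Let sT i : smooth_on [set: E2 R] (fun y : E2 R => y 0 i).
Proof. exact: smooth_coord. Qed.
Let sK (w : R) : smooth_on [set: E2 R] (fun _ => w). Proof. exact: smooth_cst. Qed.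
Let Ut (q : E2 R) : [set: E2 R] q. Proof. by []. Qed.

Definition lc (a0 a1 a2 a3 a4 a5 : R) : E6 R :=
  a0 *: dt + a1 *: e1 + a2 *: e2 + a3 *: e3 + a4 *: e4 + a5 *: e5.

Lemma mink_lc a0 a1 a2 a3 a4 a5 c0 c1 c2 c3 c4 c5 :
  mink (lc a0 a1 a2 a3 a4 a5) (lc c0 c1 c2 c3 c4 c5) =
  - (a0 * c0) + a1 * c1 + a2 * c2 + a3 * c3 + a4 * c4 + a5 * c5.
Proof.
have [e1dt e2dt e3dt e4dt e5dt e11 e22 e33 e44 e55 e12 e13 e14 e15 e23 e24 e25 e34 e35 e45]
  := e_frame.
have [dt1 dt2] : mink dt e1 = 0 /\ mink dt e2 = 0 by split; rewrite minkC.
have [dt3 dt4] : mink dt e3 = 0 /\ mink dt e4 = 0 by split; rewrite minkC.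
have dt5 : mink dt e5 = 0 by rewrite minkC.
rewrite /lc !minkDl !minkDr !minkZl !minkZr mink_dtdt e1dt e2dt e3dt e4dt e5dt.
rewrite dt1 dt2 dt3 dt4 dt5 (minkC e2 e1) (minkC e3 e1) (minkC e4 e1) (minkC e5 e1).
rewrite (minkC e3 e2) (minkC e4 e2) (minkC e5 e2) (minkC e4 e3) (minkC e5 e3) (minkC e5 e4).
by rewrite e11 e22 e33 e44 e55 e12 e13 e14 e15 e23 e24 e25 e34 e35 e45; ring.
Qed.

Lemma lc_dt : dt = lc 1 0 0 0 0 0.
Proof. by rewrite /lc !scale0r !addr0 scale1r. Qed.

Lemma unormal_lc a0 a1 a2 a3 a4 a5 :
  unormal (lc a0 a1 a2 a3 a4 a5) = lc 0 a1 a2 a3 a4 a5.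
Proof.
rewrite unormalE [X in mink _ X]lc_dt mink_lc.
by rewrite /lc; apply/rowP => i; rewrite ![in LHS]mxE ![in RHS]mxE; ring.
Qed.

Lemma lc_eq a0 a1 a2 a3 a4 a5 c0 c1 c2 c3 c4 c5 :
  a0 = c0 -> a1 = c1 -> a2 = c2 -> a3 = c3 -> a4 = c4 -> a5 = c5 ->
  lc a0 a1 a2 a3 a4 a5 = lc c0 c1 c2 c3 c4 c5.
Proof. by move=> -> -> -> -> -> ->. Qed.

Lemma lcD a0 a1 a2 a3 a4 a5 c0 c1 c2 c3 c4 c5 :
  lc a0 a1 a2 a3 a4 a5 + lc c0 c1 c2 c3 c4 c5 =
  lc (a0 + c0) (a1 + c1) (a2 + c2) (a3 + c3) (a4 + c4) (a5 + c5).
Proof. by rewrite /lc; apply/rowP => i; rewrite ![in LHS]mxE ![in RHS]mxE; ring. Qed.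

Lemma lcZ w a0 a1 a2 a3 a4 a5 :
  w *: lc a0 a1 a2 a3 a4 a5 = lc (w * a0) (w * a1) (w * a2) (w * a3) (w * a4) (w * a5).
Proof. by rewrite /lc; apply/rowP => i; rewrite ![in LHS]mxE ![in RHS]mxE; ring. Qed.

Section LcFun.
Variables A0 A1 A2 A3 A4 A5 : E2 R -> R.
Hypotheses (sA0 : smooth_on setT A0) (sA1 : smooth_on setT A1) (sA2 : smooth_on setT A2)
  (sA3 : smooth_on setT A3) (sA4 : smooth_on setT A4) (sA5 : smooth_on setT A5).

Let z (A : E2 R -> R) (sA : smooth_on setT A) (e : E6 R) := smoothZ oT sA (smooth_cst setT e).

Lemma smooth_lc : smooth_on setT (fun y => lc (A0 y) (A1 y) (A2 y) (A3 y) (A4 y) (A5 y)).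
Proof.
exact: (smoothD_rV oT (smoothD_rV oT (smoothD_rV oT (smoothD_rV oT (smoothD_rV oT
  (z sA0 dt) (z sA1 e1)) (z sA2 e2)) (z sA3 e3)) (z sA4 e4)) (z sA5 e5)).
Qed.

Lemma pD_lc i q : pD i (fun y => lc (A0 y) (A1 y) (A2 y) (A3 y) (A4 y) (A5 y)) q =
  lc (pD i A0 q) (pD i A1 q) (pD i A2 q) (pD i A3 q) (pD i A4 q) (pD i A5 q).
Proof.
have p (A : E2 R -> R) (sA : smooth_on setT A) (e : E6 R) :
    pD i (fun y => A y *: e) q = pD i A q *: e.
  by rewrite (pDZ i sA (smooth_cst setT e) (Ut q)) pD_cst scaler0 addr0.
have sD := @smoothD_rV R _ _ oT 6.
have s1 := sD _ _ (z sA0 dt) (z sA1 e1); have s2 := sD _ _ s1 (z sA2 e2).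
have s3 := sD _ _ s2 (z sA3 e3); have s4 := sD _ _ s3 (z sA4 e4).
rewrite /lc (pD_add i s4 (z sA5 e5) (Ut q)) (pD_add i s3 (z sA4 e4) (Ut q)).
rewrite (pD_add i s2 (z sA3 e3) (Ut q)) (pD_add i s1 (z sA2 e2) (Ut q)).
by rewrite (pD_add i (z sA0 dt) (z sA1 e1) (Ut q)) !p.
Qed.

End LcFun.

(** [t0] and [bt], with bt^2 = b1^2, allow for the time translation and the time reversal in an
    isometry. [cu], [su], [cv], [sv] stand for cosines and sines and enter through smoothness, their
    derivatives and the Pythagorean identities. *)
Definition model_in_frame (y : E2 R) : E6 R :=
  lc (t0 + bt * y 0 0) (r / s * cu y) (r / s * su y) b2 (b3 * sv y) (b3 * cv y).
Local Notation f := model_in_frame.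

Lemma modelE : f = fun y => lc (t0 + bt * y 0 0) (r / s * cu y) (r / s * su y) b2
  (b3 * sv y) (b3 * cv y).
Proof. by []. Qed.

Let sM w (A : E2 R -> R) : smooth_on setT A -> smooth_on setT (fun y => w * A y).
Proof. by move=> sA; exact: smoothM. Qed.

Lemma pD_coord i j q : pD i (fun y : E2 R => y 0 j) q = (i == j)%:R.
Proof. by rewrite pD_deriveE derive_coord mxE eqxx/= eq_sym. Qed.

Lemma pD_scal i w (A : E2 R -> R) q : smooth_on setT A ->
  pD i (fun y => w * A y) q = w * pD i A q.
Proof. by move=> sA; rewrite (pDM i (sK w) sA (Ut q)) pD_cst mul0r add0r. Qed.

Let sA0 : smooth_on setT (fun y : E2 R => t0 + bt * y 0 0).
Proof. by apply: smoothD => //; exact: sM. Qed.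

Lemma smooth_model : smooth_on setT f.
Proof. by rewrite modelE; apply: smooth_lc => //; exact: sM. Qed.

Lemma pD0_model : pD 0 f = fun q => lc bt (- r * su q) (r * cu q) 0 0 0.
Proof.
apply/funext => q; rewrite modelE pD_lc//; try exact: sM.
rewrite (pD_add 0 (sK t0) (sM bt (sT 0)) (Ut q)) !pD_scal// !pD_cst.
rewrite pD_coord pD_cu pD_su pD_cv pD_sv /=.
by apply: lc_eq; field; rewrite ?s0 ?b3n.
Qed.

Lemma pD1_model : pD 1 f = fun q => lc 0 0 0 0 (cv q) (- 1 * sv q).
Proof.
apply/funext => q; rewrite modelE pD_lc//; try exact: sM.
rewrite (pD_add 1 (sK t0) (sM bt (sT 0)) (Ut q)) !pD_scal// !pD_cst.
rewrite pD_coord pD_cu pD_su pD_cv pD_sv /=.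
by apply: lc_eq; field; rewrite ?s0 ?b3n.
Qed.

Lemma pD00_model q : pD 0 (pD 0 f) q = lc 0 (- r * s * cu q) (- r * s * su q) 0 0 0.
Proof.
rewrite pD0_model pD_lc//; try exact: sM.
rewrite !pD_scal// !pD_cst pD_cu pD_su /=; apply: lc_eq; ring.
Qed.

Lemma pD11_model q : pD 1 (pD 1 f) q = lc 0 0 0 0 (- sv q / b3) (- cv q / b3).
Proof.
rewrite pD1_model pD_lc//; try exact: sM.
rewrite !pD_scal// !pD_cst pD_cv pD_sv /=; apply: lc_eq; ring.
Qed.

Lemma model_g00 q : mink (pD 0 f q) (pD 0 f q) = 1.
Proof.
rewrite pD0_model mink_lc.
rewrite (_ : _ + _ = - bt ^+ 2 + r * r * (su q * su q + cu q * cu q)); last by ring.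
by rewrite cs2u subrK rr btE; ring.
Qed.

Lemma model_g01 q : mink (pD 0 f q) (pD 1 f q) = 0.
Proof. by rewrite pD0_model pD1_model mink_lc; ring. Qed.

Lemma model_g11 q : mink (pD 1 f q) (pD 1 f q) = 1.
Proof.
rewrite pD1_model mink_lc.
rewrite (_ : _ + _ = sv q * sv q + cv q * cv q); last by ring.
by rewrite cs2v subrK.
Qed.

Lemma model_RxS4 q : RxS4 (f q).
Proof.
apply/RxS4P; rewrite modelE unormal_lc mink_lc.
rewrite (_ : _ + _ = r * r / (s * s) * (su q * su q + cu q * cu q) + b2 ^+ 2
  + b3 ^+ 2 * (sv q * sv q + cv q * cv q)); last by field.
have p : b1 ^+ 2 + 2 != 0 by rewrite -ss mulf_neq0.
rewrite cs2u cs2v !subrK !mulr1 -addrA bE rr ss; by field.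
Qed.

Lemma model_pos q (v : E2 R) : v != 0 -> 0 < mink ('D_v f q) ('D_v f q).
Proof.
move=> vn; rewrite derive_pD; last exact: smooth_differentiable smooth_model (Ut q).
rewrite !minkL (minkC (pD 1 f q)) model_g00 model_g01 model_g11.
rewrite (_ : _ + _ = v 0 0 ^+ 2 + v 0 1 ^+ 2); last by ring.
rewrite lt_def addr_ge0 ?sqr_ge0// andbT paddr_eq0 ?sqr_ge0// !sqrf_eq0.
apply: contra vn => /andP[/eqP v0 /eqP v1]; apply/eqP/rowP.
by apply: ord2P; rewrite ?v0 ?v1 mxE.
Qed.

Let h3 : R := 2^-1 * (s * s * b2).
Let h4 : R := 2^-1 * (s * s * b3 - b3^-1).

Local Opaque lc.

(** The coordinate fields are orthonormal, so 2 H is the sum of two values of the second fundamental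
    form; its components on [e1] and [e2] cancel because s^2 = r^2 + 1. *)
Lemma mean_curvature_model q :
  mean_curvature f q = lc 0 0 0 h3 (h4 * sv q) (h4 * cv q).
Proof.
have fS' y (_ : [set: E2 R] y) := model_RxS4 y.
have fp' y (_ : [set: E2 R] y) := @model_pos y.
have d1 : gdet (pD 0 f q) (pD 1 f q) = 1 by rewrite /gdet model_g00 model_g01 model_g11; ring.
have Nf : unormal (f q) = lc 0 (r / s * cu q) (r / s * su q) b2 (b3 * sv q) (b3 * cv q).
  exact: unormal_lc.
have np00 : sff f 0 0 q = lc 0 (- r * s * cu q) (- r * s * su q) 0 0 0
    + (r * r) *: unormal (f q).
  rewrite (sffE oT smooth_model fS' fp' _ _ (Ut q)) /normal_proj pD00_model Nf mink_lc.
  rewrite (_ : tan2 _ _ _ = 0) ?subr0; last first.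
    by apply: tan2_eq0; rewrite ?pD0_model ?pD1_model mink_lc; ring.
  rewrite -scaleNr; congr (_ + _ *: _).
  rewrite [LHS](_ : _ = r * r * (su q * su q + cu q * cu q)); last by field.
  by rewrite cs2u subrK mulr1.
have np11 : sff f 1 1 q = lc 0 0 0 0 (- sv q / b3) (- cv q / b3) + unormal (f q).
  rewrite (sffE oT smooth_model fS' fp' _ _ (Ut q)) /normal_proj pD11_model Nf mink_lc.
  rewrite (_ : tan2 _ _ _ = 0) ?subr0; last first.
    by apply: tan2_eq0; rewrite ?pD0_model ?pD1_model mink_lc; ring.
  rewrite -scaleNr -[in RHS](scale1r (lc 0 (r / s * cu q) _ _ _ _)).
  congr (_ + _ *: _); rewrite [LHS](_ : _ = sv q * sv q + cv q * cv q).
    by rewrite cs2v subrK.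
  by field; rewrite b3n s0.
have E : mean_curvature f q = 2^-1 *: (sff f 0 0 q + sff f 1 1 q).
  rewrite /mean_curvature; refine (congr1 (fun w : E6 R => 2^-1 *: w) _).
  rewrite trace_g_gtrace.
  exact: (@gtrace_orthonormal _ (fun i => pD i f q) _ (model_g00 q) (model_g01 q) (model_g11 q)).
have E2 := f_equal2 (fun w w' : E6 R => 2^-1 *: (w + w')) np00 np11.
refine (etrans E (etrans E2 _)); rewrite Nf.
have key : s * s = r * r + 1 by rewrite ss rr; ring.
rewrite (lcZ (r * r)) lcD lcD lcD lcZ; apply: lc_eq; rewrite /h3 /h4.
- by ring.
- rewrite [LHS](_ : _ = 2^-1 * (cu q / s * (r * r - s * s + 1) * r)); last by field.
  by rewrite key; ring.
- rewrite [LHS](_ : _ = 2^-1 * (su q / s * (r * r - s * s + 1) * r)); last by field.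
  by rewrite key; ring.
- by rewrite key; field.
- by rewrite key; field.
- by rewrite key; field.
Qed.

Lemma smooth_mean_curvature_model : smooth_on setT (mean_curvature f).
Proof.
have -> : mean_curvature f = fun q => lc 0 0 0 h3 (h4 * sv q) (h4 * cv q).
  by apply/funext => q; rewrite mean_curvature_model.
by apply: smooth_lc => //; exact: sM.
Qed.

Lemma mean_curvature_model_dt q : mink (mean_curvature f q) dt = 0.
Proof. by rewrite mean_curvature_model lc_dt mink_lc; ring. Qed.

(** Only the circle coordinates of H vary, and D_i H is a multiple of the tangent vector
    [pD 1 f]. *)
Lemma PMCV_model i q : nabla_perp f i (mean_curvature f) q = 0.
Proof.
have fS' y (_ : [set: E2 R] y) := model_RxS4 y.
have fp' y (_ : [set: E2 R] y) := @model_pos y.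
rewrite (nabla_perpE oT smooth_model fS' fp' i _ (Ut q)).
have -> : mean_curvature f = fun q => lc 0 0 0 h3 (h4 * sv q) (h4 * cv q).
  by apply/funext => y; rewrite mean_curvature_model.
rewrite pD_lc//; try exact: sM.
rewrite !pD_scal// !pD_cst pD_cv pD_sv.
set w := (X in normal_proj _ _ _ X).
have -> : w = 0 *: pD 0 f q + (h4 * ((i == 1)%:R / b3)) *: pD 1 f q.
  by rewrite /w scale0r add0r pD1_model lcZ; apply: lc_eq; ring.
apply: normal_proj_tangent.
- by rewrite /gdet model_g00 model_g01 model_g11 mulr0 subr0 mulr1 oner_neq0.
- by have := pD_orth_unormal oT smooth_model fS' 0 (Ut q).
- by have := pD_orth_unormal oT smooth_model fS' 1 (Ut q).
Qed.

End ModelSurface.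

(** * The helix and the circle *)

Section Helix.
Context {R : realType}.
Variables (U : set (E2 R)) (f T C H : E2 R -> E6 R) (th c : R).
Hypotheses (oU : open U) (sf : smooth_on U f) (sT : smooth_on U T)
  (sC : smooth_on U C) (sH : smooth_on U H) (th_gt0 : 0 < th) (c_gt0 : 0 < c).
Implicit Types (q : E2 R) (i : 'I_2).
Local Notation N := (fun q => unormal (f q)).
Hypotheses
  (DT : forall i q, U q -> pD i T q = mink (pD i f q) dt *: C q)
  (DC : forall i q, U q ->
    pD i C q = (- (2 + th) * mink (pD i f q) dt) *: (th^-1 *: T q + dt))
  (DH : forall i q, U q ->
    pD i H q = (- (2 * c)) *: (pD i f q - (mink (pD i f q) dt / th) *: T q))
  (TT : forall q, U q -> mink (T q) (T q) = th)
  (Tdt : forall q, U q -> mink (T q) dt = th)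
  (TN : forall q, U q -> mink (T q) (unormal (f q)) = 0)
  (CT : forall q, U q -> mink (C q) (T q) = 0)
  (Cdt : forall q, U q -> mink (C q) dt = 0)
  (CN : forall q, U q -> mink (C q) (unormal (f q)) = - (1 + th))
  (CC : forall q, U q -> mink (C q) (C q) = (2 + th) * (1 + th))
  (CH : forall q, U q -> mink (C q) (H q) = 0)
  (HH : forall q, U q -> mink (H q) (H q) = c)
  (Hdt : forall q, U q -> mink (H q) dt = 0)
  (HN : forall q, U q -> mink (H q) (unormal (f q)) = 0)
  (HT : forall q, U q -> mink (H q) (T q) = 0)
  (NN : forall q, U q -> mink (unormal (f q)) (unormal (f q)) = 1).

(* With [th = |T|^2] and [c = |H|^2], [hb1], [hb2], [hb3] are the constants of the
   model surface, [hs = sqrt (b1^2 + 2)] and [ha = sqrt (b1^2 + 1)]. *)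
Definition hs : R := Num.sqrt (th + 2).
Definition ha : R := Num.sqrt (th + 1).
Definition hb1 : R := Num.sqrt th.
Definition hb3 : R := Num.sqrt ((4 * c + (th + 2))^-1).
Definition hb2 : R := Num.sqrt ((th + 2)^-1 - (4 * c + (th + 2))^-1).

Lemma hs_sqr : hs * hs = th + 2.
Proof. by rewrite -expr2 sqr_sqrtr// addr_ge0// ltW. Qed.
Lemma ha_sqr : ha * ha = th + 1.
Proof. by rewrite -expr2 sqr_sqrtr// addr_ge0// ltW. Qed.
Lemma hb1_sqr : hb1 * hb1 = th.
Proof. by rewrite -expr2 sqr_sqrtr// ltW. Qed.
Let c4 : 0 < 4 * c + (th + 2).
Proof. by rewrite addr_gt0 ?mulr_gt0// addr_gt0. Qed.
Let t2 : 0 < th + 2. Proof. by rewrite addr_gt0. Qed.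
Lemma hb3_sqr : hb3 * hb3 = (4 * c + (th + 2))^-1.
Proof. by rewrite -expr2 sqr_sqrtr// invr_ge0 ltW. Qed.
Let b2_gt0 : 0 < (th + 2)^-1 - (4 * c + (th + 2))^-1.
Proof. by rewrite subr_gt0 ltf_pV2 ?posrE// ltrDr mulr_gt0. Qed.
Lemma hb2_sqr : hb2 * hb2 = (th + 2)^-1 - (4 * c + (th + 2))^-1.
Proof. by rewrite -expr2 sqr_sqrtr// ltW. Qed.
Lemma hs_gt0 : 0 < hs. Proof. by rewrite sqrtr_gt0. Qed.
Lemma ha_gt0 : 0 < ha. Proof. by rewrite sqrtr_gt0 addr_gt0. Qed.
Lemma hb1_gt0 : 0 < hb1. Proof. by rewrite sqrtr_gt0. Qed.
Lemma hb2_gt0 : 0 < hb2. Proof. by rewrite sqrtr_gt0. Qed.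
Lemma hb3_gt0 : 0 < hb3. Proof. by rewrite sqrtr_gt0 invr_gt0. Qed.

Definition hu q : R := mink (f q) dt / hb1.
(** [C] has length ha hs; with this sign the helix part of [f] is (ha / hs) hc. *)
Definition hc q : E6 R := (- (ha * hs)^-1) *: C q.
(** T / th + dt is orthogonal to dt and has square (1 + th) / th, whence the factor. *)
Definition hc' q : E6 R := (hb1 / ha) *: (th^-1 *: T q + dt).
(** As u varies, the pair [hc], [hc'] rotates with speed [hs]; [hE1] and [hE2] undo the rotation and
    are constant. *)
Definition hE1 q : E6 R := cos (hs * hu q) *: hc q + (- sin (hs * hu q)) *: hc' q.
Definition hE2 q : E6 R := sin (hs * hu q) *: hc q + cos (hs * hu q) *: hc' q.
(** The derivatives of C + (th + 2) N - 2 H are 4c + th + 2 = 1 / hb3^2 times f_i - t_i T / th, the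
    component of f_i orthogonal to T. So [hd] follows the motion of [f] across T: it is the vector
    that runs on the circle. *)
Definition hd q : E6 R := (hb3 * hb3) *: (C q + (th + 2) *: unormal (f q) - 2 *: H q).
(** N + C / (th + 2) has the same derivatives as [hd], so the difference is constant; its length is
    [hb2]. *)
Definition hE4 q : E6 R :=
  hb2^-1 *: (unormal (f q) + (th + 2)^-1 *: C q - hd q).

Let snz : hs != 0. Proof. exact/lt0r_neq0/hs_gt0. Qed.
Let anz : ha != 0. Proof. exact/lt0r_neq0/ha_gt0. Qed.
Let b1nz : hb1 != 0. Proof. exact/lt0r_neq0/hb1_gt0. Qed.
Let b2nz : hb2 != 0. Proof. exact/lt0r_neq0/hb2_gt0. Qed.
Let b3nz : hb3 != 0. Proof. exact/lt0r_neq0/hb3_gt0. Qed.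
Let thnz : th != 0. Proof. exact/lt0r_neq0/th_gt0. Qed.

Let pD_cZ i (w : R) (V : E2 R -> E6 R) q : smooth_on U V -> U q ->
  pD i (fun y => w *: V y) q = w *: pD i V q.
Proof.
by move=> sV Uq; rewrite (pDZ i (smooth_cst U w) sV Uq) pD_cst scale0r add0r.
Qed.
Let smooth_cZ (w : R) (V : E2 R -> E6 R) : smooth_on U V -> smooth_on U (fun y => w *: V y).
Proof. by move=> sV; exact: (smoothZ oU (smooth_cst U w) sV). Qed.
Let sdt : smooth_on U (fun _ : E2 R => dt : E6 R). Proof. exact: smooth_cst. Qed.
Let sN : smooth_on U N. Proof. exact: smooth_unormal. Qed.

Lemma smooth_hu : smooth_on U hu.
Proof.
by apply: (smoothM oU (smooth_mink oU sf sdt)); exact: smooth_cst.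
Qed.

Lemma pD_hu i q : U q -> pD i hu q = mink (pD i f q) dt / hb1.
Proof.
move=> Uq; rewrite (pDM i (smooth_mink oU sf sdt) (smooth_cst U hb1^-1) Uq).
by rewrite pD_cst mulr0 addr0 (pD_mink_dt i sf Uq).
Qed.

Lemma smooth_hc : smooth_on U hc. Proof. exact: smooth_cZ. Qed.

Let sSdt : smooth_on U (fun y => th^-1 *: T y + dt).
Proof. exact: (smoothD_rV oU (smooth_cZ _ sT) sdt). Qed.

Lemma smooth_hc' : smooth_on U hc'. Proof. exact: smooth_cZ. Qed.

Lemma pD_hc i q : U q -> pD i hc q = (hs * (mink (pD i f q) dt / hb1)) *: hc' q.
Proof.
move=> Uq; rewrite pD_cZ// DC// /hc' !scalerA; congr (_ *: _).
rewrite (_ : 2 + th = hs * hs); last by rewrite hs_sqr addrC.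
by field; rewrite snz anz b1nz.
Qed.

Lemma pD_hc' i q : U q -> pD i hc' q = (- (hs * (mink (pD i f q) dt / hb1))) *: hc q.
Proof.
move=> Uq; rewrite pD_cZ// (pD_add i (smooth_cZ _ sT) sdt Uq) pD_cst addr0 pD_cZ// DT//.
rewrite /hc !scalerA; congr (_ *: _); rewrite -[in LHS]hb1_sqr.
by field; rewrite snz anz b1nz.
Qed.

Let shu : smooth_on U (fun y => hs * hu y).
Proof. exact: (smoothM oU (smooth_cst U hs) smooth_hu). Qed.
Let pD_shu i q : U q -> pD i (fun y => hs * hu y) q = hs * (mink (pD i f q) dt / hb1).
Proof.
by move=> Uq; rewrite (pDM i (smooth_cst U hs) smooth_hu Uq) pD_cst mul0r add0r pD_hu.
Qed.
Let scos := smooth_cos oU shu.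
Let ssin := smooth_sin oU shu.
Let pD_cos i q : U q -> pD i (fun y => cos (hs * hu y)) q =
  - (hs * (mink (pD i f q) dt / hb1) * sin (hs * hu q)).
Proof. by move=> Uq; rewrite pD_deriveE (derive_cos _ shu Uq) -pD_deriveE pD_shu. Qed.
Let pD_sin i q : U q -> pD i (fun y => sin (hs * hu y)) q =
  hs * (mink (pD i f q) dt / hb1) * cos (hs * hu q).
Proof. by move=> Uq; rewrite pD_deriveE (derive_sin _ shu Uq) -pD_deriveE pD_shu. Qed.

Lemma smooth_hE1 : smooth_on U hE1.
Proof.
exact: (smoothD_rV oU (smoothZ oU scos smooth_hc) (smoothZ oU (smoothN oU ssin) smooth_hc')).
Qed.

Lemma smooth_hE2 : smooth_on U hE2.
Proof.
exact: (smoothD_rV oU (smoothZ oU ssin smooth_hc) (smoothZ oU scos smooth_hc')).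
Qed.

Let pD_nsin i q : U q -> pD i (fun y => - sin (hs * hu y)) q =
  - (hs * (mink (pD i f q) dt / hb1) * cos (hs * hu q)).
Proof.
move=> Uq; have E y : U y -> - sin (hs * hu y) = (-1) * sin (hs * hu y) by rewrite mulN1r.
rewrite (pD_ext i oU E Uq) (pDM i (smooth_cst U (-1 : R)) ssin Uq) pD_cst pD_sin//.
by rewrite mul0r add0r mulN1r.
Qed.

Lemma pD_hE1 i q : U q -> pD i hE1 q = 0.
Proof.
move=> Uq.
rewrite (pD_add i (smoothZ oU scos smooth_hc) (smoothZ oU (smoothN oU ssin) smooth_hc') Uq).
rewrite (pDZ i scos smooth_hc Uq) (pDZ i (smoothN oU ssin) smooth_hc' Uq).
rewrite pD_cos// pD_nsin// pD_hc// pD_hc'//.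
move: (hc q) (hc' q) (cos _) (sin _) (_ * (_ / _)) => x y a b k.
by apply/rowP => j; rewrite ![in LHS]mxE [in RHS]mxE; ring.
Qed.

Lemma pD_hE2 i q : U q -> pD i hE2 q = 0.
Proof.
move=> Uq.
rewrite (pD_add i (smoothZ oU ssin smooth_hc) (smoothZ oU scos smooth_hc') Uq).
rewrite (pDZ i ssin smooth_hc Uq) (pDZ i scos smooth_hc' Uq).
rewrite pD_cos// pD_sin// pD_hc// pD_hc'//.
move: (hc q) (hc' q) (cos _) (sin _) (_ * (_ / _)) => x y a b k.
by apply/rowP => j; rewrite ![in LHS]mxE [in RHS]mxE; ring.
Qed.

Let sX : smooth_on U (fun y => C y + (th + 2) *: unormal (f y)).
Proof. exact: (smoothD_rV oU sC (smooth_cZ _ sN)). Qed.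
Let sX' : smooth_on U (fun y => C y + (th + 2) *: unormal (f y) - 2 *: H y).
Proof. exact: (smoothD_rV oU sX (smoothN_rV oU (smooth_cZ 2 sH))). Qed.

Lemma smooth_hd : smooth_on U hd. Proof. exact: smooth_cZ. Qed.

Let pD_opp i (V : E2 R -> E6 R) q : smooth_on U V -> U q ->
  pD i (fun y => - V y) q = - pD i V q.
Proof.
move=> sV Uq; have E y : U y -> - V y = (-1 : R) *: V y by rewrite scaleN1r.
by rewrite (pD_ext i oU E Uq) pD_cZ// scaleN1r.
Qed.

Lemma pD_hd i q : U q -> pD i hd q = pD i f q - (mink (pD i f q) dt / th) *: T q.
Proof.
move=> Uq; rewrite pD_cZ// (pD_add i sX (smoothN_rV oU (smooth_cZ 2 sH)) Uq).
rewrite (pD_add i sC (smooth_cZ _ sN) Uq) pD_opp//; last exact: smooth_cZ.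
rewrite !pD_cZ// DC// DH// (pD_unormal oU sf i Uq) hb3_sqr.
have := lt0r_neq0 c4; move: (pD i f q) (mink _ _) (T q) => x t y c4n.
by apply/rowP => j; rewrite ![in LHS]mxE ![in RHS]mxE; field; rewrite c4n thnz.
Qed.

Let sZ : smooth_on U (fun y => unormal (f y) + (th + 2)^-1 *: C y).
Proof. exact: (smoothD_rV oU sN (smooth_cZ _ sC)). Qed.

Lemma smooth_hE4 : smooth_on U hE4.
Proof. exact: (smooth_cZ _ (smoothD_rV oU sZ (smoothN_rV oU smooth_hd))). Qed.

Lemma pD_hE4 i q : U q -> pD i hE4 q = 0.
Proof.
move=> Uq; rewrite pD_cZ//; last exact: (smoothD_rV oU sZ (smoothN_rV oU smooth_hd)).
rewrite (pD_add i sZ (smoothN_rV oU smooth_hd) Uq) pD_opp//; last exact: smooth_hd.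
rewrite (pD_add i sN (smooth_cZ _ sC) Uq) pD_cZ// pD_hd// DC// (pD_unormal oU sf i Uq).
have := lt0r_neq0 t2; move: (pD i f q) (mink _ _) (T q) => x t y t2n.
by apply/rowP => j; rewrite ![in LHS]mxE ![in RHS]mxE; field; rewrite t2n thnz.
Qed.

Section Products.
Variable q : E2 R.
Hypothesis Uq : U q.

Let mC x : mink (hc q) x = - (ha * hs)^-1 * mink (C q) x. Proof. exact: minkZl. Qed.
Let mC' x : mink (hc' q) x = hb1 / ha * (th^-1 * mink (T q) x + mink dt x).
Proof. by rewrite /hc' minkZl minkDl minkZl. Qed.
Let md x : mink (hd q) x = hb3 * hb3 *
  (mink (C q) x + (th + 2) * mink (unormal (f q)) x - 2 * mink (H q) x).
Proof. by rewrite /hd minkZl !minkDl minkNl !minkZl. Qed.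
Let mE4 x : mink (hE4 q) x = hb2^-1 * (mink (unormal (f q)) x
  + (th + 2)^-1 * mink (C q) x - mink (hd q) x).
Proof. by rewrite /hE4 minkZl !minkDl minkNl minkZl. Qed.

Let Ndt : mink (unormal (f q)) dt = 0. Proof. exact: mink_unormal_dt. Qed.

Lemma hcc : mink (hc q) (hc q) = 1.
Proof.
rewrite mC minkC mC CC// (_ : 2 + th = hs * hs); last by rewrite hs_sqr addrC.
rewrite (_ : 1 + th = ha * ha); last by rewrite ha_sqr addrC.
by field; rewrite snz anz.
Qed.

Lemma hcc' : mink (hc q) (hc' q) = 0.
Proof. by rewrite minkC mC' !(minkC _ (hc q)) !mC CT// Cdt//; ring. Qed.

Lemma hc'c' : mink (hc' q) (hc' q) = 1.
Proof.
rewrite mC' !(minkC _ (hc' q)) !mC' TT// Tdt// (minkC dt) Tdt// mink_dtdt.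
rewrite [LHS](_ : _ = hb1 * hb1 / (ha * ha) * (th^-1 + 1)); last first.
  by field; rewrite anz thnz.
by rewrite hb1_sqr ha_sqr; field; rewrite thnz gt_eqF ?addr_gt0.
Qed.

Lemma hcdt : mink (hc q) dt = 0.
Proof. by rewrite mC Cdt// mulr0. Qed.

Lemma hc'dt : mink (hc' q) dt = 0.
Proof. by rewrite mC' Tdt// mink_dtdt mulVf// subrr mulr0. Qed.

Lemma hddt : mink (hd q) dt = 0.
Proof. by rewrite md Cdt// Ndt Hdt//; ring. Qed.

Lemma hdC : mink (hd q) (C q) = 0.
Proof.
by rewrite md CC// (minkC _ (C q)) CN// (minkC _ (C q)) CH//; ring.
Qed.

Lemma hdN : mink (hd q) (unormal (f q)) = hb3 * hb3.
Proof. by rewrite md CN// NN// HN//; ring. Qed.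

Lemma hdT : mink (hd q) (T q) = 0.
Proof. by rewrite md CT// (minkC _ (T q)) TN// HT//; ring. Qed.

Lemma hdH : mink (hd q) (H q) = - (hb3 * hb3 * (2 * c)).
Proof. by rewrite md CH// (minkC _ (H q)) HN// HH//; ring. Qed.

Lemma hdd : mink (hd q) (hd q) = hb3 * hb3.
Proof.
rewrite md (minkC (C q)) hdC (minkC (unormal _)) hdN (minkC (H q)) hdH.
rewrite [LHS](_ : _ = hb3 * hb3 * (hb3 * hb3 * (4 * c + (th + 2)))); last by ring.
by rewrite [X in _ * (X * _)]hb3_sqr mulVf ?mulr1// lt0r_neq0.
Qed.

Lemma hE4dt : mink (hE4 q) dt = 0.
Proof. by rewrite mE4 Ndt Cdt// hddt; ring. Qed.

Lemma hE4C : mink (hE4 q) (C q) = 0.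
Proof.
rewrite mE4 (minkC _ (C q)) CN// CC// hdC.
by rewrite [LHS](_ : _ = 0)//; field; rewrite b2nz lt0r_neq0.
Qed.

Lemma hE4T : mink (hE4 q) (T q) = 0.
Proof. by rewrite mE4 (minkC _ (T q)) TN// CT// hdT; ring. Qed.

Lemma hE4d : mink (hE4 q) (hd q) = 0.
Proof. by rewrite mE4 !(minkC _ (hd q)) hdN hdC hdd; ring. Qed.

Lemma hE4N : mink (hE4 q) (unormal (f q)) = hb2.
Proof.
rewrite mE4 NN// CN// hdN hb3_sqr.
rewrite [X in _ * X](_ : _ = hb2 * hb2); first by rewrite mulKf.
rewrite hb2_sqr; have := lt0r_neq0 t2; move: (4 * c + _)^-1 => k t2n.
by field.
Qed.

Lemma hE44 : mink (hE4 q) (hE4 q) = 1.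
Proof.
by rewrite mE4 !(minkC _ (hE4 q)) hE4N hE4C hE4d mulr0 addr0 subr0 mulVf.
Qed.

Lemma hE4c : mink (hE4 q) (hc q) = 0.
Proof. by rewrite minkC mC minkC hE4C mulr0. Qed.

Lemma hE4c' : mink (hE4 q) (hc' q) = 0.
Proof. by rewrite minkC mC' minkC hE4T minkC hE4dt; ring. Qed.

Lemma hdc : mink (hd q) (hc q) = 0.
Proof. by rewrite minkC mC minkC hdC mulr0. Qed.

Lemma hdc' : mink (hd q) (hc' q) = 0.
Proof. by rewrite minkC mC' minkC hdT minkC hddt; ring. Qed.

Let co := cos (hs * hu q).
Let si := sin (hs * hu q).
Let cs : si * si = 1 - co * co. Proof. by rewrite -!expr2 sin2cos2. Qed.

Let m1 x : mink (hE1 q) x = co * mink (hc q) x - si * mink (hc' q) x.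
Proof.
by rewrite minkDl (minkZl (cos (hs * hu q))) (minkZl (- sin (hs * hu q))) mulNr.
Qed.
Let m2 x : mink (hE2 q) x = si * mink (hc q) x + co * mink (hc' q) x.
Proof.
by rewrite minkDl (minkZl (sin (hs * hu q))) (minkZl (cos (hs * hu q))).
Qed.

Lemma hE1dt : mink (hE1 q) dt = 0. Proof. by rewrite m1 hcdt hc'dt; ring. Qed.
Lemma hE2dt : mink (hE2 q) dt = 0. Proof. by rewrite m2 hcdt hc'dt; ring. Qed.
Lemma hE11 : mink (hE1 q) (hE1 q) = 1.
Proof.
rewrite m1 !(minkC _ (hE1 q)) !m1 hcc hcc' (minkC (hc' q) (hc q)) hcc' hc'c'.
rewrite [LHS](_ : _ = co * co + si * si); last by ring.
by rewrite cs; ring.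
Qed.
Lemma hE22 : mink (hE2 q) (hE2 q) = 1.
Proof.
rewrite m2 !(minkC _ (hE2 q)) !m2 hcc hcc' (minkC (hc' q) (hc q)) hcc' hc'c'.
rewrite [LHS](_ : _ = co * co + si * si); last by ring.
by rewrite cs; ring.
Qed.
Lemma hE12 : mink (hE1 q) (hE2 q) = 0.
Proof.
rewrite m1 !(minkC _ (hE2 q)) !m2 hcc hcc' (minkC (hc' q) (hc q)) hcc' hc'c'.
by ring.
Qed.
Lemma hE14 : mink (hE1 q) (hE4 q) = 0.
Proof. by rewrite m1 !(minkC _ (hE4 q)) hE4c hE4c'; ring. Qed.
Lemma hE24 : mink (hE2 q) (hE4 q) = 0.
Proof. by rewrite m2 !(minkC _ (hE4 q)) hE4c hE4c'; ring. Qed.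
Lemma hE1d : mink (hE1 q) (hd q) = 0.
Proof. by rewrite m1 !(minkC _ (hd q)) hdc hdc'; ring. Qed.
Lemma hE2d : mink (hE2 q) (hd q) = 0.
Proof. by rewrite m2 !(minkC _ (hd q)) hdc hdc'; ring. Qed.

Lemma helix_decomposition : f q = (- hb1 * hu q) *: dt
  + ((ha / hs * cos (hs * hu q)) *: hE1 q + (ha / hs * sin (hs * hu q)) *: hE2 q)
  + hb2 *: hE4 q + hd q.
Proof.
have fN : f q = unormal (f q) - mink (f q) dt *: dt.
  by rewrite unormalE addrK.
have uE : - hb1 * hu q = - mink (f q) dt.
  by rewrite /hu mulNr mulrC divfK.
rewrite {1}fN uE /hE1 /hE2 /hE4 -/co -/si.
have -> : hb2 *: (hb2^-1 *: (unormal (f q) + (th + 2)^-1 *: C q - hd q)) =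
    unormal (f q) + (th + 2)^-1 *: C q - hd q by rewrite scalerA mulfV// scale1r.
have -> : (ha / hs * co) *: (co *: hc q + - si *: hc' q)
    + (ha / hs * si) *: (si *: hc q + co *: hc' q) = - ((th + 2)^-1 *: C q).
  have -> : - ((th + 2)^-1 *: C q) = (ha / hs * (co * co + si * si)) *: hc q.
    rewrite cs (addrC (co * co)) subrK mulr1 /hc scalerA -scaleNr; congr (_ *: _).
    by rewrite -hs_sqr; field; rewrite snz anz.
  move: (hc q) (hc' q) => x y.
  by apply/rowP => j; rewrite ![in LHS]mxE ![in RHS]mxE; ring.
move: (unormal _) (mink _ _) (_ *: C q) (hd q) => x k y z.
by apply/rowP => j; rewrite ![in LHS]mxE ![in RHS]mxE; ring.
Qed.

Lemma helix_frame y : 0 < mink y y -> mink y dt = 0 -> mink y (C q) = 0 ->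
  mink y (T q) = 0 -> mink y (unormal (f q)) = 0 -> mink y (H q) = 0 ->
  spatial_frame (hE1 q) (hE2 q) (hE4 q) ((Num.sqrt (mink y y))^-1 *: y) (hb3^-1 *: hd q).
Proof.
move=> y0 ydt yC yT yN yH; set n := Num.sqrt _.
have nn : n * n = mink y y by rewrite -expr2 sqr_sqrtr// ltW.
have n0 : n != 0 by rewrite sqrtr_eq0 -ltNge.
have zy x : mink x y = 0 -> mink x (n^-1 *: y) = 0.
  by move=> xy; rewrite (minkZr n^-1) xy mulr0.
have zd x : mink x (hd q) = 0 -> mink x (hb3^-1 *: hd q) = 0.
  by move=> xd; rewrite (minkZr hb3^-1) xd mulr0.
have yc : mink (hc q) y = 0 by rewrite mC minkC yC mulr0.
have yc' : mink (hc' q) y = 0 by rewrite mC' (minkC _ y) yT (minkC dt) ydt !(mulr0, addr0).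
have yd : mink (hd q) y = 0.
  by rewrite md (minkC (C q)) yC (minkC (unormal _)) yN (minkC (H q)) yH; ring.
split.
- exact: hE1dt.
- exact: hE2dt.
- exact: hE4dt.
- by rewrite minkC; apply: zy; rewrite minkC.
- by rewrite minkC; apply: zd; rewrite minkC; exact: hddt.
- exact: hE11.
- exact: hE22.
- exact: hE44.
- by rewrite (minkZl n^-1) (minkZr n^-1) -nn; field.
- by rewrite (minkZl hb3^-1) (minkZr hb3^-1) hdd; field.
- exact: hE12.
- exact: hE14.
- by apply: zy; rewrite m1 yc yc'; ring.
- exact/zd/hE1d.
- exact: hE24.
- by apply: zy; rewrite m2 yc yc'; ring.
- exact/zd/hE2d.
- by apply: zy; rewrite mE4 yd (minkC _ y) yN (minkC _ y) yC; ring.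
- exact/zd/hE4d.
- by apply: zd; rewrite (minkZl n^-1) minkC yd mulr0.
Qed.

End Products.

Lemma helix_cst : [/\ smooth_on U hE1, smooth_on U hE2, smooth_on U hE4 &
  forall i q, U q -> [/\ pD i hE1 q = 0, pD i hE2 q = 0 & pD i hE4 q = 0]].
Proof.
split; [exact: smooth_hE1|exact: smooth_hE2|exact: smooth_hE4|].
by move=> i q Uq; split; [exact: pD_hE1|exact: pD_hE2|exact: pD_hE4].
Qed.

Lemma helix_relations q : U q -> [/\ mink (hd q) (hd q) = hb3 * hb3, mink (hd q) dt = 0,
  mink (hE1 q) (hd q) = 0, mink (hE2 q) (hd q) = 0 & mink (hE4 q) (hd q) = 0].
Proof.
by move=> Uq; split; [exact: hdd|exact: hddt|exact: hE1d|exact: hE2d|exact: hE4d].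
Qed.

Lemma hb2_hb3 : hb2 ^+ 2 + hb3 ^+ 2 = (hb1 ^+ 2 + 2)^-1.
Proof. by rewrite !expr2 hb2_sqr hb3_sqr hb1_sqr subrK. Qed.

End Helix.

(** * From charts to the surface *)

Section Transitions.
Context {R : realType} {M : topologicalType}.
Implicit Types (c d : chart R M) (q v : E2 R) (p : M).

Lemma transition_dom_open c d : open (transition_dom c d).
Proof.
rewrite openE => q [cq dq]; rewrite /interior; apply: filterI.
  by apply: open_nbhs_nbhs; split => //; exact: chart_cod_open.
apply: (chart_from_continuous cq); apply: open_nbhs_nbhs.
by split => //; exact: chart_dom_open.
Qed.

Lemma transition_domP c d q : transition_dom c d q ->
  [/\ transition_dom d c (transition c d q), chart_cod d (transition c d q),
      chart_from d (transition c d q) = chart_from c q &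
      transition d c (transition c d q) = q].
Proof.
move=> [cq dq]; have dK := chart_toK dq.
split => //; last by rewrite /transition /= dK chart_fromK.
  by split; [exact: chart_to_cod|rewrite /preimage /transition /= dK; exact: chart_from_dom].
exact: chart_to_cod.
Qed.

Lemma transition_inj c d q v : compatible c d -> transition_dom c d q ->
  'D_v (transition c d) q = 0 -> v = 0.
Proof.
move=> [scd sdc] cdq D0; have [dcq _ _ _] := transition_domP cdq.
have oU := @transition_dom_open c d.
have K y : transition_dom c d y -> y = (transition d c \o transition c d) y.
  by move=> /transition_domP[].
have <- : 'D_v (id : E2 R -> E2 R) q = v.
  by rewrite deriveE// diff_val.
refine (etrans (near_eq_deriveU v oU cdq K) _).
rewrite derive_compE//; first by rewrite D0 deriveE ?linear0//; exact: smooth_differentiable dcq.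
- exact: smooth_differentiable cdq.
- exact: smooth_differentiable dcq.
Qed.

End Transitions.

Section ConstantOnSurface.
Context {R : realType} {M : surface R}.

(** [g] is locally constant, so its level set through [p'] and the complement of that set are both
    open. *)
Lemma surface_cst (g : M -> R) :
  (forall c, atlas c -> smooth_on (chart_cod c) (fun q => g (chart_from c q))) ->
  (forall c, atlas c -> forall q, chart_cod c q -> forall i,
    pD i (fun q => g (chart_from c q)) q = 0) ->
  forall p p', g p = g p'.
Proof.
move=> sg Dg p p'.
have loc (x : M) : \forall y \near x, g y = g x.
  have [c ac cx] := atlas_cover x.
  have cq := chart_to_cod cx.
  have /nbhs_ballP[r /= r0 rU] : nbhs (chart_to c x) (chart_cod c).
    by apply: open_nbhs_nbhs; split => //; exact: chart_cod_open.
  have : \forall y \near x, ball (chart_to c x) r (chart_to c y).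
    by apply: (chart_to_continuous cx); exact: nbhsx_ballx.
  have : \forall y \near x, chart_dom c y.
    by apply: open_nbhs_nbhs; split => //; exact: chart_dom_open.
  apply: filter_app2; apply: nearW => y cy by_.
  rewrite -(chart_toK cy) -[in RHS](chart_toK cx).
  apply: (@derive0_ball_cst R _ (fun q => g (chart_from c q)) (chart_to c x) r) by_.
    by move=> z /rU cz; exact: (smooth_differentiable (sg c ac) cz).
  move=> z v /rU cz; have dz := smooth_differentiable (sg c ac) cz.
  by rewrite (derive_pD v dz) !Dg// !scaler0 addr0.
have e1 : [set x | g x = g p'] !=set0 by exists p'.
have O (b : R -> Prop) : open [set x | b (g x)].
  rewrite openE => x /= bx; rewrite /interior; have := loc x.
  by apply: filterS => y /= ->.
suff E : [set x | g x = g p'] = [set: M] by have : [set: M] p by []; rewrite -E.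
apply: (@surface_connected _ M _ e1).
  by exists [set x | g x = g p']; rewrite ?setTI//; exact: (O (fun a => a = g p')).
exists [set x | g x = g p']; rewrite ?setTI//.
rewrite -openC; have := O (fun a => a <> g p'); congr open.
Qed.

End ConstantOnSurface.

Section LocalBiconservative.
Context {R : realType}.
Variables (U : set (E2 R)) (f : E2 R -> E6 R).
Hypotheses (oU : open U) (sf : smooth_on U f).
Hypothesis fS : forall q, U q -> RxS4 (f q).
Hypothesis f_pos : forall q, U q -> forall v : E2 R, v != 0 ->
  0 < mink ('D_v f q) ('D_v f q).
Implicit Types (q : E2 R) (i j k : 'I_2).

Lemma tang_gt0 q w : U q -> tang f q w != 0 -> 0 < mink (tang f q w) (tang f q w).
Proof.
move=> Uq; rewrite (tangE sf f_pos _ Uq) /tan2; set a := _ / _; set b := _ / _.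
move=> n0; apply: (pD_lincomb_gt0 sf f_pos Uq); rewrite -negb_and.
by apply: contra n0 => /andP[/eqP-> /eqP->]; rewrite !scale0r addr0.
Qed.

Local Notation H := (mean_curvature f).
Definition local_T q : E6 R := tangent_dt (fun i => pD i f) q.
Local Notation T := local_T.

Lemma local_TE q : U q -> tang f q dt = T q.
Proof. exact: tangE. Qed.

Hypotheses (f_pmcv : forall q, U q -> forall i, nabla_perp f i H q = 0)
  (Hdt : forall q, U q -> mink (H q) dt = 0)
  (T_neq0 : forall q, U q -> tang f q dt != 0).

Let d0 q : U q -> gdet (pD 0 f q) (pD 1 f q) != 0.
Proof. exact: gram_det_neq0. Qed.

Lemma local_th_gt0 q : U q -> 0 < mink (T q) (T q).
Proof. by move=> Uq; rewrite -local_TE//; apply: tang_gt0 => //; exact: T_neq0. Qed.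

Lemma local_smooth_T : smooth_on U T.
Proof. exact: (smooth_T oU (fun i => smooth_pD sf i) d0). Qed.

Lemma local_c_ge0 q : U q -> 0 <= mink (H q) (H q) /\ (H q != 0 -> 0 < mink (H q) (H q)).
Proof.
move=> Uq; have P : H q != 0 -> 0 < mink (H q) (H q).
  apply: (@mink_orth_timelike _ (H q) (dt - T q)).
    rewrite minkDl minkNl !minkDr !minkNr mink_dtdt (minkC dt).
    have -> : mink (T q) dt = mink (T q) (T q) by exact: (coreTdt d0 Uq).
    by have := local_th_gt0 Uq; lra.
  rewrite minkDr minkNr Hdt// -local_TE// (tang_orth sf f_pos dt Uq) ?subrr// => i.
  exact: mean_curvature_orth.
by split=> //; case: (eqVneq (H q) 0) => [->|/P/ltW//]; rewrite mink0l.
Qed.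

Let Htr q x : U q -> (forall k, mink x (pD k f q) = 0) ->
  2 * mink (H q) x = tr2 (pD 0 f q) (pD 1 f q)
      (mink (pD 0 (pD 0 f) q) x) (mink (pD 0 (pD 1 f) q) x)
      (mink (pD 1 (pD 0 f) q) x) (mink (pD 1 (pD 1 f) q) x)
      + (2 + (mink (T q) (T q))) * mink (unormal (f q)) x.
Proof.
by move=> Uq xF; rewrite -local_TE//; exact: (mink_mean_curvature oU sf fS f_pos Uq xF).
Qed.

Let HF i q : U q -> mink (H q) (pD i f q) = 0.
Proof. exact: mean_curvature_HF. Qed.
Let HN q : U q -> mink (H q) (unormal (f q)) = 0.
Proof. exact: mean_curvature_HN. Qed.
Let sH : smooth_on U H. Proof. exact: smooth_mean_curvature. Qed.
Let sN : smooth_on U (fun y => unormal (f y)). Proof. exact: smooth_unormal. Qed.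

(** Here <H, dt> = 0 enters: D_i H has no component along the normal of R x S^4, so PMCV makes the
    derivative in E^6_1 itself tangent. *)
Let DH i q : U q -> pD i H q = tan2 (pD 0 f q) (pD 1 f q) (pD i H q).
Proof.
move=> Uq; have := nabla_mean_curvature_tan sf f_pos f_pmcv i Uq.
suff -> : Defs.proj (f q) (pD i H q) = pD i H q by [].
rewrite /Defs.proj (pD_mink_cst oU i sH sN HN Uq) (pD_unormal oU sf i Uq) minkDr minkZr.
by rewrite HF// Hdt// mulr0 addr0 oppr0 scale0r subr0.
Qed.

Lemma local_Dc i q : U q -> pD i (fun y => mink (H y) (H y)) q = 0.
Proof. exact: mean_curvature_sqr_cst. Qed.

Hypothesis c_gt0 : forall q, U q -> 0 < mink (H q) (H q).
Let F i := pD i f.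
Local Notation N := (fun y => unormal (f y)).
Let sF i : smooth_on U (F i). Proof. exact: smooth_pD. Qed.
Let DF i j q : U q -> pD i (F j) q = pD j (F i) q. Proof. exact: pD2_comm. Qed.
Let DN i q : U q -> pD i N q = F i q + mink (F i q) dt *: dt.
Proof. exact: pD_unormal. Qed.
Let FN i q : U q -> mink (F i q) (N q) = 0. Proof. exact: pD_orth_unormal. Qed.
Let NN q : U q -> mink (N q) (N q) = 1. Proof. exact: mink_unormal_unormal. Qed.
Let Ndt q : U q -> mink (N q) dt = 0. Proof. by move=> _; exact: mink_unormal_dt. Qed.

Lemma local_Dth i q : U q -> pD i (fun y => mink (T y) (T y)) q = 0.
Proof.
exact: (core_Dth oU sF sH DF FN Ndt d0 HF HN Hdt Htr DH local_th_gt0 c_gt0 i).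
Qed.

Definition local_C q : E6 R := accel (fun i => pD i f) q.
Local Notation C := local_C.
Lemma local_DT i q : U q -> pD i T q = mink (pD i f q) dt *: C q.
Proof. exact: (core_DT oU sF sH DF FN Ndt d0 HF HN Hdt Htr DH local_th_gt0 c_gt0 i). Qed.

Lemma local_t_neq0 q : U q -> exists i, mink (pD i f q) dt != 0.
Proof. exact: (core_t_neq0 d0 local_th_gt0). Qed.

Variables (th c : R).
Hypotheses (th0 : 0 < th) (c0 : 0 < c) (thE : forall q, U q -> mink (T q) (T q) = th)
  (cE : forall q, U q -> mink (H q) (H q) = c).

Let sC : smooth_on U C. Proof. exact: (smooth_C oU sF d0 local_th_gt0). Qed.
Let DC i q : U q ->
    pD i C q = (- (2 + th) * mink (pD i f q) dt) *: (th^-1 *: T q + dt).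
Proof.
move=> Uq; rewrite -(thE Uq).
exact: (core_DC oU sF sN sH DF DN FN NN Ndt d0 HF HN Hdt Htr DH local_th_gt0 c_gt0 i Uq).
Qed.
Let DHf i q : U q ->
    pD i H q = (- (2 * c)) *: (pD i f q - (mink (pD i f q) dt / th) *: T q).
Proof.
move=> Uq; rewrite -(thE Uq) -(cE Uq).
exact: (core_DH oU sF sH DF d0 HF HN Hdt Htr DH local_th_gt0 i Uq).
Qed.
Let Tdt q : U q -> mink (T q) dt = th.
Proof. by move=> Uq; rewrite -(thE Uq); exact: (coreTdt d0 Uq). Qed.
Let TN q : U q -> mink (T q) (unormal (f q)) = 0.
Proof. by move=> Uq; rewrite minkC; exact: (coreTN FN Uq). Qed.
Let CT q : U q -> mink (C q) (T q) = 0.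
Proof. exact: (core_CT oU sF sH DF FN Ndt d0 HF HN Hdt Htr DH local_th_gt0 c_gt0). Qed.
Let Cdt q : U q -> mink (C q) dt = 0.
Proof. exact: (core_Cdt oU sF sH DF d0 HF HN Hdt Htr DH local_th_gt0). Qed.
Let CN q : U q -> mink (C q) (unormal (f q)) = - (1 + th).
Proof.
move=> Uq; rewrite -(thE Uq).
exact: (core_CN oU sF sN sH DF DN FN Ndt d0 HF HN Hdt Htr DH local_th_gt0 c_gt0 Uq).
Qed.
Let CC q : U q -> mink (C q) (C q) = (2 + th) * (1 + th).
Proof.
move=> Uq; rewrite -(thE Uq).
exact: (core_CC oU sF sN sH DF DN FN Ndt d0 HF HN Hdt Htr DH local_th_gt0 c_gt0 Uq).
Qed.
Let CH q : U q -> mink (C q) (H q) = 0.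
Proof. exact: (core_CH oU sF sH DF FN Ndt d0 HF HN Hdt Htr DH local_th_gt0 c_gt0). Qed.
Let HT q : U q -> mink (H q) (T q) = 0.
Proof. exact: (coreHT HF). Qed.
Let sT := local_smooth_T.

Definition local_E1 q := hE1 f T C th q.
Definition local_E2 q := hE2 f T C th q.
Definition local_E4 q := hE4 f C H th c q.
Definition local_d q := hd f C H th c q.

Lemma local_helix_cst :
  [/\ smooth_on U local_E1, smooth_on U local_E2, smooth_on U local_E4 &
  forall i q, U q ->
    [/\ pD i local_E1 q = 0, pD i local_E2 q = 0 & pD i local_E4 q = 0]].
Proof. exact: (helix_cst oU sf sT sC sH th0 c0 local_DT DC DHf). Qed.

Lemma local_helix_relations q : U q ->
  [/\ mink (local_d q) (local_d q) = hb3 th c * hb3 th c, mink (local_d q) dt = 0,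
  mink (local_E1 q) (local_d q) = 0, mink (local_E2 q) (local_d q) = 0 &
  mink (local_E4 q) (local_d q) = 0].
Proof. exact: (helix_relations th0 c0 TN CT Cdt CN CC CH cE Hdt HN HT NN). Qed.

Lemma local_helix_decomposition q : f q = (- hb1 th * hu f th q) *: dt
  + ((ha th / hs th * cos (hs th * hu f th q)) *: local_E1 q
     + (ha th / hs th * sin (hs th * hu f th q)) *: local_E2 q)
  + hb2 th c *: local_E4 q + local_d q.
Proof. exact: (helix_decomposition f T C H th0 c0). Qed.

(* The fifth direction is the rotation [t_1 f_0 - t_0 f_1] of [T] in the tangent plane. *)
Lemma local_helix_frame q : U q -> exists e,
  spatial_frame (local_E1 q) (local_E2 q) (local_E4 q) e ((hb3 th c)^-1 *: local_d q).
Proof.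
move=> Uq; set t0 := mink (pD 0 f q) dt; set t1 := mink (pD 1 f q) dt.
set y := t1 *: pD 0 f q + (- t0) *: pD 1 f q.
have yF x : (forall i, mink (pD i f q) x = 0) -> mink y x = 0.
  by move=> xF; rewrite minkDl (minkZl t1) (minkZl (- t0)) !xF !mulr0 addr0.
have y0 : 0 < mink y y.
  apply: (pD_lincomb_gt0 sf f_pos Uq); rewrite oppr_eq0.
  by have [i] := local_t_neq0 Uq; move: i; apply: ord2P => ->; rewrite ?orbT.
exists ((Num.sqrt (mink y y))^-1 *: y).
apply: (helix_frame th0 c0 thE Tdt TN CT Cdt CN CC CH cE Hdt HN HT NN Uq y0).
- by rewrite minkDl (minkZl t1) (minkZl (- t0)) -/t0 -/t1; ring.
- apply: yF => i; rewrite minkC.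
  exact: (core_CF oU sF sH DF FN Ndt d0 HF HN Hdt Htr DH local_th_gt0 c_gt0 i Uq).
- have TF i : mink (pD i f q) (T q) = mink (pD i f q) dt.
    by rewrite minkC; exact: (coreTF (F := fun i => pD i f) d0 i Uq).
  by rewrite minkDl (minkZl t1) (minkZl (- t0)) !TF -/t0 -/t1; ring.
- by apply: yF => i; exact: FN.
- by apply: yF => i; rewrite minkC; exact: HF.
Qed.

End LocalBiconservative.

Section Glue.
Context {R : realType} {M : surface R}.
Implicit Types (c d : chart R M).

(** A family indexed by charts that agrees on overlaps descends to a function on [M], evaluated at
    each point in a chosen chart; [surface_cst] applies to it. *)
Lemma glue_cst (V : chart R M -> E2 R -> R) :
  (forall c d, atlas c -> atlas d -> forall q, transition_dom c d q ->
    V c q = V d (transition c d q)) ->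
  (forall c, atlas c -> smooth_on (chart_cod c) (V c)) ->
  (forall c, atlas c -> forall q, chart_cod c q -> forall i, pD i (V c) q = 0) ->
  forall c d q q', atlas c -> atlas d -> chart_cod c q -> chart_cod d q' ->
  V c q = V d q'.
Proof.
move=> VO sV DV; pose ch (p : M) := sval (cid2 (atlas_cover p)).
have ach p : atlas (ch p) by rewrite /ch; case: cid2.
have dch p : chart_dom (ch p) p by rewrite /ch; case: cid2.
pose g p := V (ch p) (chart_to (ch p) p).
have gE c q : atlas c -> chart_cod c q -> g (chart_from c q) = V c q.
  move=> ac cq; have E := VO c (ch (chart_from c q)) ac (ach _) q.
  by rewrite E//; split=> //; exact: dch.
have oc c := @chart_cod_open _ _ c.
have gC := @surface_cst R M g.
have gS c (ac : atlas c) : smooth_on (chart_cod c) (fun q => g (chart_from c q)).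
  by apply: (smooth_ext (oc c) _ (sV c ac)) => q cq; rewrite gE.
have gD c (ac : atlas c) q : chart_cod c q -> forall i,
    pD i (fun q => g (chart_from c q)) q = 0.
  move=> cq i; rewrite -(DV c ac q cq i); apply: (pD_ext i (oc c)) cq => y cy.
  exact: gE.
move=> c d q q' ac ad cq dq.
by rewrite -(gE c q)// -(gE d q')//; exact: gC gS gD _ _.
Qed.

Lemma glue_cst_rV n (V : chart R M -> E2 R -> 'rV[R]_n) :
  (forall c d, atlas c -> atlas d -> forall q, transition_dom c d q ->
    V c q = V d (transition c d q)) ->
  (forall c, atlas c -> smooth_on (chart_cod c) (V c)) ->
  (forall c, atlas c -> forall q, chart_cod c q -> forall i, pD i (V c) q = 0) ->
  forall c d q q', atlas c -> atlas d -> chart_cod c q -> chart_cod d q' ->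
  V c q = V d q'.
Proof.
move=> VO sV DV c d q q' ac ad cq dq; apply/rowP => j.
have sVj c' (ac' : atlas c') := (smooth_rVP (@chart_cod_open _ _ c') _).1 (sV c' ac') j.
apply: (glue_cst (V := fun c q => V c q 0 j) _ sVj) => //.
  by move=> c1 d1 a1 b1 y cy; rewrite (VO c1 d1).
move=> c1 a1 y cy i; have := DV c1 a1 y cy i.
rewrite !pD_deriveE => /(congr1 (fun w : 'rV[R]_n => w 0 j)).
have dV := smooth_differentiable (sV c1 a1) cy.
by rewrite derive_rV ?mxE//; exact/diff_derivable.
Qed.

End Glue.

Section Overlap.
Context {R : realType} {M : surface R}.
Variable phi : M -> E6 R.
Hypotheses (hphi : spacelike_surface phi) (hT : T_nowhere_zero phi).
Hypotheses (hb : biconservative phi) (hp : PMCV phi).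
Implicit Types (c d : chart R M) (q : E2 R).
Local Notation f := (local_expr phi).

Lemma chart_smooth c : atlas c -> smooth_on (chart_cod c) (f c).
Proof. by move=> /hphi.2[]. Qed.

Lemma chart_RxS4 c q : chart_cod c q -> RxS4 (f c q).
Proof. by move=> _; exact: hphi.1. Qed.

Lemma chart_pos c : atlas c -> forall q, chart_cod c q -> forall v : E2 R, v != 0 ->
  0 < mink ('D_v (f c) q) ('D_v (f c) q).
Proof. by move=> /hphi.2[]. Qed.

Lemma chart_Hdt c : atlas c -> forall q, chart_cod c q -> mink (mean_curvature (f c) q) dt = 0.
Proof.
move=> ac q cq.
apply/(biconservative_at (@chart_cod_open _ _ c) (chart_smooth ac) (@chart_RxS4 c)
  (chart_pos ac) (hp ac) cq (hT ac cq)).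
exact: hb.
Qed.

Lemma local_expr_transition c d q : transition_dom c d q -> f c q = f d (transition c d q).
Proof. by move=> /transition_domP[_ _ E _]; rewrite /local_expr /= E. Qed.

Variables (c d : chart R M).
Hypotheses (ac : atlas c) (ad : atlas d).
Local Notation U' := (transition_dom c d).
Local Notation h := (transition c d).
Let oU := @chart_cod_open _ _ d. Let oU' := @transition_dom_open _ _ c d.
Let sh : smooth_on U' h. Proof. by have [] := atlas_compatible ac ad. Qed.
Let hU q : U' q -> chart_cod d (h q). Proof. by move=> /transition_domP[]. Qed.
Let h_inj q v : U' q -> 'D_v h q = 0 -> v = 0.
Proof. exact/transition_inj/(atlas_compatible ac ad). Qed.
Let f'E q : U' q -> f c q = f d (h q). Proof. exact: local_expr_transition. Qed.

Lemma overlap_H q : U' q -> mean_curvature (f c) q = mean_curvature (f d) (h q).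
Proof.
exact: (mean_curvature_reparam oU (chart_smooth ad) (@chart_RxS4 d) (chart_pos ad)
  oU' sh hU h_inj f'E).
Qed.

Lemma overlap_tang q w : U' q -> tang (f c) q w = tang (f d) (h q) w.
Proof.
exact: (tang_reparam oU (chart_smooth ad) (chart_pos ad) oU' sh hU h_inj f'E).
Qed.

Lemma overlap_T q : U' q -> local_T (f c) q = local_T (f d) (h q).
Proof.
move=> Uq; rewrite -(local_TE (chart_smooth ac) (chart_pos ac) Uq.1).
by rewrite -(local_TE (chart_smooth ad) (chart_pos ad) (hU Uq)) overlap_tang.
Qed.

Hypothesis c_gt0 : forall c, atlas c -> forall q, chart_cod c q ->
  0 < mink (mean_curvature (f c) q) (mean_curvature (f c) q).

(** The formula of [accel] refers to coordinates, so C is compared on overlaps through D_i T = t_i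
    C, for an index with t_i nonzero. *)
Lemma overlap_C q : U' q -> local_C (f c) q = local_C (f d) (h q).
Proof.
move=> Uq; have oc := @chart_cod_open _ _ c.
have DTc i := local_DT oc (chart_smooth ac) (@chart_RxS4 c) (chart_pos ac) (hp ac)
  (chart_Hdt ac) (hT ac) (c_gt0 ac) i Uq.1.
have DTd i := local_DT oU (chart_smooth ad) (@chart_RxS4 d) (chart_pos ad) (hp ad)
  (chart_Hdt ad) (hT ad) (c_gt0 ad) i (hU Uq).
have sT := local_smooth_T oU (chart_smooth ad) (chart_pos ad).
have [i ti] := local_t_neq0 (chart_smooth ac) (chart_pos ac) (hT ac) Uq.1.
have E := pD_ext i oU' overlap_T Uq; rewrite (pD_reparam sh hU i sT Uq) !DTd DTc in E.
have Ef := pD_reparam_surface (chart_smooth ad) oU' sh hU f'E i Uq.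
apply: (scalerI ti); rewrite E Ef minkDl (minkZl (pD i h q 0 0)) (minkZl (pD i h q 0 1)).
by move: (local_C (f d) (h q)) => C; rewrite !scalerA -scalerDl.
Qed.

End Overlap.

Section SpatialFrame.
Context {R : realType}.
Variables e1 e2 e3 e4 e5 : E6 R.
Hypothesis fr : spatial_frame e1 e2 e3 e4 e5.

Lemma spatial_frame_eq0 x : mink x dt = 0 -> mink x e1 = 0 -> mink x e2 = 0 ->
  mink x e3 = 0 -> mink x e4 = 0 -> mink x e5 = 0 -> x = 0.
Proof.
have [e1dt e2dt e3dt e4dt e5dt e11 e22 e33 e44 e55 e12 e13 e14 e15 e23 e24 e25 e34 e35 e45]
  := fr.
move=> x0 x1 x2 x3 x4 x5; have n1 := oner_neq0 R.
by apply: (@frame6_eq0 _ dt e1 e2 e3 e4 e5); split => //;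
  rewrite ?e11 ?e22 ?e33 ?e44 ?e55 ?mink_dtdt ?oppr_eq0// minkC.
Qed.

Lemma mink_lc_frame a0 a1 a2 a3 a4 a5 (y := lc e1 e2 e3 e4 e5 a0 a1 a2 a3 a4 a5) :
  [/\ mink y dt = - a0, mink y e1 = a1 & mink y e2 = a2] /\
  [/\ mink y e3 = a3, mink y e4 = a4 & mink y e5 = a5].
Proof.
have [e1dt e2dt e3dt e4dt e5dt e11 e22 e33 e44 e55 e12 e13 e14 e15 e23 e24 e25 e34 e35 e45]
  := fr.
have E z : mink y z = a0 * mink dt z + a1 * mink e1 z + a2 * mink e2 z + a3 * mink e3 z
    + a4 * mink e4 z + a5 * mink e5 z.
  by rewrite !minkDl (minkZl a0) (minkZl a1) (minkZl a2) (minkZl a3)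
    (minkZl a4) (minkZl a5).
have [d1 d2] : mink dt e1 = 0 /\ mink dt e2 = 0 by split; rewrite minkC.
have [d3 d4] : mink dt e3 = 0 /\ mink dt e4 = 0 by split; rewrite minkC.
have d5 : mink dt e5 = 0 by rewrite minkC.
do 2!split; rewrite E ?mink_dtdt ?e1dt ?e2dt ?e3dt ?e4dt ?e5dt ?d1 ?d2 ?d3 ?d4 ?d5
  ?e11 ?e22 ?e33 ?e44 ?e55 ?(minkC e2 e1) ?(minkC e3 e1) ?(minkC e4 e1) ?(minkC e5 e1)
  ?(minkC e3 e2) ?(minkC e4 e2) ?(minkC e5 e2) ?(minkC e4 e3) ?(minkC e5 e3) ?(minkC e5 e4)
  ?e12 ?e13 ?e14 ?e15 ?e23 ?e24 ?e25 ?e34 ?e35 ?e45; ring.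
Qed.

Lemma spatial_frame_expand x : x = lc e1 e2 e3 e4 e5 (- mink x dt) (mink x e1) (mink x e2)
  (mink x e3) (mink x e4) (mink x e5).
Proof.
apply/eqP; rewrite -subr_eq0; apply/eqP.
have [[E0 E1 E2] [E3 E4 E5]] := mink_lc_frame (- mink x dt) (mink x e1) (mink x e2)
  (mink x e3) (mink x e4) (mink x e5).
by apply: spatial_frame_eq0; rewrite minkDl minkNl ?E0 ?E1 ?E2 ?E3 ?E4 ?E5 ?opprK subrr.
Qed.

End SpatialFrame.

Section Global.
Context {R : realType} {M : surface R}.
Variable phi : M -> E6 R.
Hypotheses (hphi : spacelike_surface phi) (hT : T_nowhere_zero phi) (hH : H_nonzero phi).
Hypotheses (hb : biconservative phi) (hp : PMCV phi).
Implicit Types (c d : chart R M) (q : E2 R).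
Local Notation f := (local_expr phi).
Let oc c := @chart_cod_open _ _ c.
Let cS c q : chart_cod c q -> RxS4 (f c q). Proof. exact: chart_RxS4. Qed.
Let cs c : atlas c -> smooth_on (chart_cod c) (f c). Proof. exact: chart_smooth. Qed.
Let cp c : atlas c -> forall q, chart_cod c q -> forall v : E2 R, v != 0 ->
  0 < mink ('D_v (f c) q) ('D_v (f c) q).
Proof. exact: chart_pos. Qed.
Let cH c : atlas c -> forall q, chart_cod c q -> mink (mean_curvature (f c) q) dt = 0.
Proof. exact: chart_Hdt. Qed.

Lemma global_c : exists2 k, 0 < k & forall c, atlas c -> forall q, chart_cod c q ->
  mink (mean_curvature (f c) q) (mean_curvature (f c) q) = k.
Proof.
have [c0 ac0 [q0 cq0 Hn]] := hH.
exists (mink (mean_curvature (f c0) q0) (mean_curvature (f c0) q0)).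
  by have [_] := local_c_ge0 (cs ac0) (cp ac0) (cH ac0) (hT ac0) cq0; apply.
move=> c ac q cq.
apply: (glue_cst (V := fun c q => mink (mean_curvature (f c) q) (mean_curvature (f c) q)))
  ac ac0 cq cq0.
- by move=> c1 c2 a1 a2 y cy; rewrite (overlap_H hphi a1 a2 cy).
- move=> c1 a1; have sH := smooth_mean_curvature (@oc c1) (cs a1) (cp a1).
  exact: (smooth_mink (@oc c1) sH sH).
- move=> c1 a1 y cy i; exact: (local_Dc (@oc c1) (cs a1) (@cS c1) (cp a1) (hp a1) i cy).
Qed.

Let H_gt0 c (ac : atlas c) q (cq : chart_cod c q) :
  0 < mink (mean_curvature (f c) q) (mean_curvature (f c) q).
Proof. by have [k k0 E] := global_c; rewrite (E c ac q cq). Qed.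

Lemma global_th : exists2 k, 0 < k & forall c, atlas c -> forall q, chart_cod c q ->
  mink (local_T (f c) q) (local_T (f c) q) = k.
Proof.
have [c0 ac0 [q0 cq0 Hn]] := hH.
exists (mink (local_T (f c0) q0) (local_T (f c0) q0)).
  exact: (local_th_gt0 (cs ac0) (cp ac0) (hT ac0) cq0).
move=> c ac q cq.
apply: (glue_cst (V := fun c q => mink (local_T (f c) q) (local_T (f c) q)))
  ac ac0 cq cq0.
- by move=> c1 c2 a1 a2 y cy; rewrite (overlap_T hphi a1 a2 cy).
- move=> c1 a1; have sT := local_smooth_T (@oc c1) (cs a1) (cp a1).
  exact: (smooth_mink (@oc c1) sT sT).
- move=> c1 a1 y cy i.
  exact: (local_Dth (@oc c1) (cs a1) (@cS c1) (cp a1) (hp a1) (cH a1) (hT a1) (H_gt0 a1) i cy).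
Qed.

(** [local_E1], [local_E2] and [local_E4] are constant on the whole surface. The last two vectors of
    the frame are taken at a base point only: [local_d] moves with constant length [hb3] in the
    plane orthogonal to dt and to the three constant vectors. *)
Lemma global_frame : exists th k e1 e2 e3 e4 e5,
  [/\ 0 < th, 0 < k, spatial_frame e1 e2 e3 e4 e5 &
  forall c, atlas c -> forall q, chart_cod c q -> let u := hu (f c) th q in
    let P := mink (f c q) e4 in let Q := mink (f c q) e5 in
    P ^+ 2 + Q ^+ 2 = hb3 th k ^+ 2 /\
    f c q = lc e1 e2 e3 e4 e5 (- hb1 th * u) (ha th / hs th * cos (hs th * u))
      (ha th / hs th * sin (hs th * u)) (hb2 th k) P Q].
Proof.
have [k k0 kE] := global_c; have [th th0 thE] := global_th.
have [c0 ac0 [q0 cq0 Hn]] := hH.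
have HC c (ac : atlas c) := local_helix_cst (@oc c) (cs ac) (@cS c) (cp ac) (hp ac) (cH ac)
  (hT ac) (H_gt0 ac) th0 k0 (thE c ac) (kE c ac).
have HR c (ac : atlas c) q (cq : chart_cod c q) := local_helix_relations (@oc c) (cs ac)
  (@cS c) (cp ac) (hp ac) (cH ac) (hT ac) (H_gt0 ac) th0 k0 (thE c ac) (kE c ac) cq.
have ovf c d (ac : atlas c) (ad : atlas d) q (cq : transition_dom c d q) :
    [/\ f c q = f d (transition c d q),
    local_T (f c) q = local_T (f d) (transition c d q),
    mean_curvature (f c) q = mean_curvature (f d) (transition c d q) &
    local_C (f c) q = local_C (f d) (transition c d q)].
  split; first exact: local_expr_transition.
  - exact: (overlap_T hphi ac ad cq).
  - exact: (overlap_H hphi ac ad cq).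
  - exact: (overlap_C hphi hT hb hp ac ad H_gt0 cq).
have E1 c q (ac : atlas c) (cq : chart_cod c q) :
    local_E1 (f c) th q = local_E1 (f c0) th q0.
  apply: (glue_cst_rV (V := fun c => local_E1 (f c) th)) ac ac0 cq cq0.
  - move=> c1 c2 a1 a2 y /(ovf _ _ a1 a2)[F1 F2 F3 F4].
    by rewrite /local_E1 /hE1 /hc /hc' /hu F1 F2 F4.
  - by move=> c1 /HC[].
  - by move=> c1 a1 y cy i; have [_ _ _ D] := HC c1 a1; have [] := D i y cy.
have E2 c q (ac : atlas c) (cq : chart_cod c q) :
    local_E2 (f c) th q = local_E2 (f c0) th q0.
  apply: (glue_cst_rV (V := fun c => local_E2 (f c) th)) ac ac0 cq cq0.
  - move=> c1 c2 a1 a2 y /(ovf _ _ a1 a2)[F1 F2 F3 F4].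
    by rewrite /local_E2 /hE2 /hc /hc' /hu F1 F2 F4.
  - by move=> c1 /HC[].
  - by move=> c1 a1 y cy i; have [_ _ _ D] := HC c1 a1; have [] := D i y cy.
have E4 c q (ac : atlas c) (cq : chart_cod c q) :
    local_E4 (f c) th k q = local_E4 (f c0) th k q0.
  apply: (glue_cst_rV (V := fun c => local_E4 (f c) th k)) ac ac0 cq cq0.
  - move=> c1 c2 a1 a2 y /(ovf _ _ a1 a2)[F1 F2 F3 F4].
    by rewrite /local_E4 /hE4 /hd F1 F3 F4.
  - by move=> c1 /HC[].
  - by move=> c1 a1 y cy i; have [_ _ _ D] := HC c1 a1; have [] := D i y cy.
have [e fr] := local_helix_frame (@oc c0) (cs ac0) (@cS c0) (cp ac0) (hp ac0) (cH ac0)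
  (hT ac0) (H_gt0 ac0) th0 k0 (thE c0 ac0) (kE c0 ac0) cq0.
set e1 := local_E1 _ _ _ in fr E1; set e2 := local_E2 _ _ _ in fr E2.
set e3 := local_E4 _ _ _ _ in fr E4; set e5 := _ *: _ in fr.
exists th, k, e1, e2, e3, e, e5; split => // c ac q cq u P Q.
have [dd ddt] := HR c ac q cq; rewrite E1// E2// E4//.
set d := local_d _ _ _ _ in dd ddt * => d1 d2 d3.
have fd := local_helix_decomposition (f c) th0 k0 q; rewrite E1// E2// E4// -/d -/u in fd.
have dE := spatial_frame_expand fr d.
rewrite ddt (minkC _ e1) d1 (minkC _ e2) d2 (minkC _ e3) d3 oppr0 in dE.
set a := mink d e in dE; set b := mink d e5 in dE.
have fE : f c q = lc e1 e2 e3 e e5 (- hb1 th * u) (ha th / hs th * cos (hs th * u))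
      (ha th / hs th * sin (hs th * u)) (hb2 th k) a b.
  rewrite fd [in LHS]dE /lc; clearbody e1 e2 e3 e5 a b.
  move: (- hb1 th * u) (_ * cos _) (_ * sin _) (hb2 _ _) => x0 x1 x2 x3.
  by apply/rowP => i; rewrite ![in LHS]mxE ![in RHS]mxE; ring.
have [_ [_ Pa Qb]] := mink_lc_frame fr (- hb1 th * u) (ha th / hs th * cos (hs th * u))
      (ha th / hs th * sin (hs th * u)) (hb2 th k) a b.
have PE : P = a by rewrite /P fE Pa.
have QE : Q = b by rewrite /Q fE Qb.
split; last by rewrite PE QE.
rewrite PE QE [RHS]expr2 -dd dE mink_lc//; ring.
Qed.

End Global.

(** * The congruence *)

Section FrameIsometry.
Context {R : realType}.

Definition row6 (a0 a1 a2 a3 a4 a5 : R) : E6 R :=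
  \row_(i < 6) nth 0 [:: a0; a1; a2; a3; a4; a5] i.

Lemma forall_ord6 (P : 'I_6 -> Prop) : P (inord 0) -> P (inord 1) -> P (inord 2) ->
  P (inord 3) -> P (inord 4) -> P (inord 5) -> forall i, P i.
Proof.
move=> P0 P1 P2 P3 P4 P5 i; rewrite -(inord_val i).
by case: i => [[|[|[|[|[|[|]]]]]]].
Qed.

Lemma row6E (y : E6 R) : y = row6 (y 0 (inord 0)) (y 0 (inord 1)) (y 0 (inord 2)) (y 0 (inord 3))
  (y 0 (inord 4)) (y 0 (inord 5)).
Proof. by apply/rowP; apply: forall_ord6; rewrite mxE inordK. Qed.

Lemma mink_row6 a0 a1 a2 a3 a4 a5 c0 c1 c2 c3 c4 c5 :
  mink (row6 a0 a1 a2 a3 a4 a5) (row6 c0 c1 c2 c3 c4 c5) =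
  - (a0 * c0) + a1 * c1 + a2 * c2 + a3 * c3 + a4 * c4 + a5 * c5.
Proof. by rewrite /mink !big_ord_recl big_ord0 !mxE/=; ring. Qed.

Variables e1 e2 e3 e4 e5 : E6 R.
Hypothesis fr : spatial_frame e1 e2 e3 e4 e5.

(** The isometry of the congruence: it carries the frame to the standard one. *)
Definition frame_coord (x : E6 R) : E6 R :=
  row6 (- mink x dt) (mink x e1) (mink x e2) (mink x e3) (mink x e4) (mink x e5).
Definition frame_point (y : E6 R) : E6 R := lc e1 e2 e3 e4 e5 (y 0 (inord 0))
  (y 0 (inord 1)) (y 0 (inord 2)) (y 0 (inord 3)) (y 0 (inord 4)) (y 0 (inord 5)).

Lemma frame_coord_lc a0 a1 a2 a3 a4 a5 :
  frame_coord (lc e1 e2 e3 e4 e5 a0 a1 a2 a3 a4 a5) = row6 a0 a1 a2 a3 a4 a5.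
Proof.
have [[E0 E1 E2] [E3 E4 E5]] := mink_lc_frame fr a0 a1 a2 a3 a4 a5.
by rewrite /frame_coord E0 E1 E2 E3 E4 E5 opprK.
Qed.

Lemma frame_pointK : cancel frame_point frame_coord.
Proof. by move=> y; rewrite frame_coord_lc -row6E. Qed.

Lemma frame_coordK : cancel frame_coord frame_point.
Proof.
move=> x; rewrite [RHS](spatial_frame_expand fr).
by rewrite /frame_point /frame_coord /row6 !mxE !inordK.
Qed.

Lemma mink_frame_coord x y : mink (frame_coord x) (frame_coord y) = mink x y.
Proof.
rewrite mink_row6 [in RHS](spatial_frame_expand fr x) [in RHS](spatial_frame_expand fr y).
by rewrite mink_lc.
Qed.

Lemma frame_coord_dt x : mink (frame_coord x) dt = mink x dt.
Proof. by rewrite mink_dt mxE/= opprK. Qed.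

Lemma frame_coord_RxS4 x : RxS4 (frame_coord x) <-> RxS4 x.
Proof. by rewrite !RxS4P !mink_unormal mink_frame_coord frame_coord_dt. Qed.

Let smooth_id : smooth_on setT (fun x : E6 R => x).
Proof. by apply/(smooth_rVP openT) => i; exact: (smooth_coord i openT). Qed.

Let D_id p (x : E6 R) : 'D_x (fun y : E6 R => y) p = x.
Proof. by rewrite deriveE// diff_val. Qed.

Lemma smooth_frame_coord : smooth_on setT frame_coord.
Proof.
have s e : smooth_on setT (fun x : E6 R => mink x e).
  exact: (smooth_mink openT smooth_id (smooth_cst setT e)).
have E j (g : E6 R -> R) : smooth_on setT g -> (forall x, frame_coord x 0 j = g x) ->
    smooth_on setT (fun x => frame_coord x 0 j).
  by move=> sg gE; apply: (smooth_ext openT _ sg) => x _; rewrite gE.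
apply/(smooth_rVP openT); apply: forall_ord6.
- by apply: (E _ _ (smoothN openT (s dt))) => x; rewrite mxE inordK.
- by apply: (E _ _ (s e1)) => x; rewrite mxE inordK.
- by apply: (E _ _ (s e2)) => x; rewrite mxE inordK.
- by apply: (E _ _ (s e3)) => x; rewrite mxE inordK.
- by apply: (E _ _ (s e4)) => x; rewrite mxE inordK.
- by apply: (E _ _ (s e5)) => x; rewrite mxE inordK.
Qed.

Lemma smooth_frame_point : smooth_on setT frame_point.
Proof.
have s k (e : E6 R) : smooth_on setT (fun x : E6 R => x 0 (inord k) *: e).
  by apply: (smoothZ openT); [exact: (smooth_coord (inord k) openT)|exact: smooth_cst].
have D := smoothD_rV (@openT (E6 R)).
exact: (D _ _ _ (D _ _ _ (D _ _ _ (D _ _ _ (D _ _ _ (s 0 dt) (s 1 e1)) (s 2 e2)) (s 3 e3)) (s 4 e4)) (s 5 e5)).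
Qed.

Lemma derive_frame_coord p x : 'D_x frame_coord p = frame_coord x.
Proof.
have d := smooth_differentiable smooth_frame_coord (I : setT p).
have m e : 'D_x (fun y : E6 R => mink y e) p = mink x e.
  rewrite (derive_mink x smooth_id (smooth_cst setT e) (I : setT p)) D_id.
  by rewrite (@derive_cst_on _ _ _ openT _ (fun _ => e) e)// mink0r addr0.
have E j e : (forall y, frame_coord y 0 j = mink y e) ->
    'D_x (fun y => frame_coord y 0 j) p = frame_coord x 0 j.
  move=> jE; rewrite jE -m; apply: (near_eq_deriveU x openT (I : setT p)) => y _.
  exact: jE.
apply/rowP => i; rewrite derive_rV; last exact: diff_derivable.
move: i; apply: forall_ord6.
- by apply: (E _ (- dt)) => y; rewrite mxE inordK// minkNr.
- by apply: (E _ e1) => y; rewrite mxE inordK.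
- by apply: (E _ e2) => y; rewrite mxE inordK.
- by apply: (E _ e3) => y; rewrite mxE inordK.
- by apply: (E _ e4) => y; rewrite mxE inordK.
- by apply: (E _ e5) => y; rewrite mxE inordK.
Qed.

Lemma frame_coord_isometry : isometry_RxS4 frame_coord.
Proof.
exists frame_point, setT; split => //.
- by split=> //; exact: openT.
- by split; [exact: smooth_frame_coord|exact: smooth_frame_point].
- move=> p Sp; split; first exact/frame_coord_RxS4.
  by apply/frame_coord_RxS4; rewrite frame_pointK.
- by move=> p _; rewrite frame_coordK frame_pointK.
- by move=> p _ x y _ _; rewrite !derive_frame_coord mink_frame_coord.
Qed.

End FrameIsometry.

(** * The model with actual sines and cosines *)

Section TrigModel.
Context {R : realType}.
Variables e1 e2 e3 e4 e5 : E6 R.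
Hypothesis fr : spatial_frame e1 e2 e3 e4 e5.
Variables t0 bt b1 b2 b3 : R.
Hypotheses (btE : bt ^+ 2 = b1 ^+ 2) (b3n : b3 != 0)
  (bE : b2 ^+ 2 + b3 ^+ 2 = (b1 ^+ 2 + 2)^-1).

Let s := Num.sqrt (b1 ^+ 2 + 2).
Let r := Num.sqrt (b1 ^+ 2 + 1).
Let su (q : E2 R) := sin (s * q 0 0).
Let cu (q : E2 R) := cos (s * q 0 0).
Let sv (q : E2 R) := sin (q 0 1 / b3).
Let cv (q : E2 R) := cos (q 0 1 / b3).

Definition trig_model := model_in_frame e1 e2 e3 e4 e5 t0 bt b2 b3 s r cu su cv sv.

Let ss : s * s = b1 ^+ 2 + 2.
Proof. by rewrite -expr2 sqr_sqrtr// addr_ge0// sqr_ge0. Qed.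
Let rr : r * r = b1 ^+ 2 + 1.
Proof. by rewrite -expr2 sqr_sqrtr// addr_ge0// sqr_ge0. Qed.
Let s0 : s != 0.
Proof. by rewrite lt0r_neq0// sqrtr_gt0 ltr_wpDl// sqr_ge0. Qed.
Let oT : open [set: E2 R] := openT.
Let smu : smooth_on setT (fun q : E2 R => s * q 0 0).
Proof. exact: (smoothM oT (smooth_cst setT s) (smooth_coord 0 oT)). Qed.
Let smv : smooth_on setT (fun q : E2 R => q 0 1 / b3).
Proof. exact: (smoothM oT (smooth_coord 1 oT) (smooth_cst setT b3^-1)). Qed.
Let scu : smooth_on setT cu. Proof. exact: smooth_cos. Qed.
Let ssu : smooth_on setT su. Proof. exact: smooth_sin. Qed.
Let scv : smooth_on setT cv. Proof. exact: smooth_cos. Qed.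
Let ssv : smooth_on setT sv. Proof. exact: smooth_sin. Qed.
Let Du i q : pD i (fun q : E2 R => s * q 0 0) q = s * (i == 0)%:R.
Proof.
rewrite (pDM i (smooth_cst setT s) (smooth_coord 0 oT) (I : setT q)) pD_cst mul0r add0r.
by rewrite pD_coord.
Qed.
Let Dv i q : pD i (fun q : E2 R => q 0 1 / b3) q = (i == 1)%:R / b3.
Proof.
rewrite (pDM i (smooth_coord 1 oT) (smooth_cst setT b3^-1) (I : setT q)) pD_cst mulr0 addr0.
by rewrite pD_coord.
Qed.
Let pD_cu i q : pD i cu q = - (s * (i == 0)%:R * su q).
Proof. by rewrite pD_deriveE (derive_cos _ smu (I : setT q)) -pD_deriveE Du. Qed.
Let pD_su i q : pD i su q = s * (i == 0)%:R * cu q.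
Proof. by rewrite pD_deriveE (derive_sin _ smu (I : setT q)) -pD_deriveE Du. Qed.
Let pD_cv i q : pD i cv q = - ((i == 1)%:R / b3 * sv q).
Proof. by rewrite pD_deriveE (derive_cos _ smv (I : setT q)) -pD_deriveE Dv. Qed.
Let pD_sv i q : pD i sv q = (i == 1)%:R / b3 * cv q.
Proof. by rewrite pD_deriveE (derive_sin _ smv (I : setT q)) -pD_deriveE Dv. Qed.
Let cs2u q : su q * su q = 1 - cu q * cu q. Proof. by rewrite -!expr2 sin2cos2. Qed.
Let cs2v q : sv q * sv q = 1 - cv q * cv q. Proof. by rewrite -!expr2 sin2cos2. Qed.

Lemma trig_modelE q : trig_model q = lc e1 e2 e3 e4 e5 (t0 + bt * q 0 0)
  (r / s * cos (s * q 0 0)) (r / s * sin (s * q 0 0)) b2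
  (b3 * sin (q 0 1 / b3)) (b3 * cos (q 0 1 / b3)).
Proof. by []. Qed.

Lemma smooth_trig_model : smooth_on setT trig_model.
Proof. exact: smooth_model. Qed.

Lemma trig_model_RxS4 q : RxS4 (trig_model q).
Proof. exact: (model_RxS4 t0 bt fr bE ss rr s0 cs2u cs2v). Qed.

Lemma trig_model_pos q (v : E2 R) : v != 0 ->
  0 < mink ('D_v trig_model q) ('D_v trig_model q).
Proof.
exact: (model_pos t0 b2 fr btE b3n rr s0 scu ssu scv ssv pD_cu pD_su pD_cv pD_sv cs2u cs2v).
Qed.

Lemma trig_model_Hdt q : mink (mean_curvature trig_model q) dt = 0.
Proof.
exact: (mean_curvature_model_dt t0 fr btE b3n bE ss rr s0 scu ssu scv ssv
  pD_cu pD_su pD_cv pD_sv cs2u cs2v).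
Qed.

Lemma trig_model_PMCV i q : nabla_perp trig_model i (mean_curvature trig_model) q = 0.
Proof.
exact: (PMCV_model t0 fr btE b3n bE ss rr s0 scu ssu scv ssv
  pD_cu pD_su pD_cv pD_sv cs2u cs2v).
Qed.

Lemma smooth_mean_curvature_trig : smooth_on setT (mean_curvature trig_model).
Proof.
exact: (smooth_mean_curvature_model t0 fr btE b3n bE ss rr s0 scu ssu scv ssv
  pD_cu pD_su pD_cv pD_sv cs2u cs2v).
Qed.

End TrigModel.

Lemma circle_angle {R : realType} (x y : R) : x ^+ 2 + y ^+ 2 = 1 ->
  exists t, x = sin t /\ y = cos t.
Proof.
move=> xy; have y2 : y ^+ 2 <= 1 by rewrite -xy lerDr sqr_ge0.
have yI : -1 <= y <= 1 by rewrite -ler_norml -(@expr_le1 _ 2)// real_normK// num_real.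
have cy : cos (acos y) = y by rewrite acosK// in_itv.
have sy : sin (acos y) = `|x|.
  by rewrite sin_acos// -xy addrK sqrtr_sqr.
have [x0|x0] := leP 0 x.
  by exists (acos y); rewrite cy sy ger0_norm.
by exists (- acos y); rewrite cosN sinN cy sy ltr0_norm// opprK.
Qed.

Lemma cos_sin_atan {R : realType} (P Q b : R) : 0 < b -> 0 < Q -> P ^+ 2 + Q ^+ 2 = b ^+ 2 ->
  cos (atan (P / Q)) = Q / b /\ sin (atan (P / Q)) = P / b.
Proof.
move=> b0 Q0 E; have Qn := lt0r_neq0 Q0; have bn := lt0r_neq0 b0.
have c : cos (atan (P / Q)) = Q / b.
  rewrite cos_atan (_ : 1 + _ = (b / Q) ^+ 2); last first.
    by rewrite [RHS]expr_div_n -E; field.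
  by rewrite sqrtr_sqr ger0_norm ?divr_ge0 ?ltW// invf_div.
split=> //; have cn : cos (atan (P / Q)) != 0 by rewrite c mulf_neq0 ?invr_eq0.
have := @atanK R (P / Q); rewrite /tan => /(congr1 (fun z => z * cos (atan (P / Q)))).
by rewrite divfK// => ->; rewrite c; field; rewrite Qn bn.
Qed.

(** * Charts obtained by a local change of coordinates *)

Section ChangeCoordinates.
Context {R : realType} {M : surface R}.
Variables (d : chart R M) (V W : set (E2 R)) (k g : E2 R -> E2 R).
Hypotheses (oV : open V) (oW : open W) (VU : V `<=` chart_cod d).
Hypotheses (sk : smooth_on V k) (sg : smooth_on W g)
  (kK : forall q, V q -> W (k q) /\ g (k q) = q)
  (gK : forall y, W y -> V (g y) /\ k (g y) = y).

Let dom : set M := chart_dom d `&` chart_to d @^-1` V.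

Let dom_open : open dom.
Proof.
rewrite openE => p [dp Vp]; rewrite /interior; apply: filterI.
  by apply: open_nbhs_nbhs; split => //; exact: chart_dom_open.
by apply: (chart_to_continuous dp); exact: open_nbhs_nbhs.
Qed.

Lemma smooth_continuous (U : set (E2 R)) (h : E2 R -> E2 R) q : smooth_on U h -> U q ->
  {for q, continuous h}.
Proof. by move=> /(_ 0) sh Uq; exact: sh. Qed.

Lemma change_coordinates : exists c : chart R M, [/\ chart_dom c = dom, chart_cod c = W,
  chart_from c = chart_from d \o g & chart_to c = k \o chart_to d].
Proof.
have tc p : dom p -> W ((k \o chart_to d) p) by move=> [_ /kK[]].
have fd q : W q -> dom ((chart_from d \o g) q).
  move=> /gK[Vg _]; split; first exact/chart_from_dom/VU.
  by rewrite /preimage /= chart_fromK//; exact: VU.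
have tK p : dom p -> (chart_from d \o g) ((k \o chart_to d) p) = p.
  by move=> [dp Vp] /=; rewrite (kK Vp).2 chart_toK.
have fK q : W q -> (k \o chart_to d) ((chart_from d \o g) q) = q.
  by move=> Wq /=; have [Vg E] := gK Wq; rewrite chart_fromK ?E//; exact: VU.
have ct p : dom p -> {for p, continuous (k \o chart_to d)}.
  move=> [dp Vp]; apply: continuous_comp; first exact: chart_to_continuous.
  exact: (smooth_continuous sk Vp).
have cf q : W q -> {for q, continuous (chart_from d \o g)}.
  move=> Wq; apply: continuous_comp; first exact: (smooth_continuous sg Wq).
  by apply: chart_from_continuous; apply: VU; exact: (gK Wq).1.
by exists (Chart dom_open oW tc fd tK fK ct cf).
Qed.

(** The new transitions are those of [d] composed with [g] or with [k]. A coordinate system need not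
    be oriented, so [k] may reverse the orientation. *)
Lemma change_coordinates_system c : atlas d -> chart_dom c = dom -> chart_cod c = W ->
  chart_from c = chart_from d \o g -> chart_to c = k \o chart_to d -> coordinate_system c.
Proof.
move=> ad cd cw cf ct e ae; have [sde sed] := atlas_compatible ad ae.
have oce := @transition_dom_open _ _ c e; have ode := @transition_dom_open _ _ d e.
have oec := @transition_dom_open _ _ e c; have oed := @transition_dom_open _ _ e d.
split.
- have E : transition c e = transition d e \o g by rewrite /transition cf.
  rewrite E; apply: (smooth_comp_rV oce ode _ _ sde).
    move=> q; rewrite /transition_dom /preimage /= cw cf => -[Wq eq] /=.
    by split=> //; apply: VU; exact: (gK Wq).1.
  by move=> n; apply: Ck_sub (sg n) => q []; rewrite cw.
- have E : transition e c = k \o transition e d by rewrite /transition ct.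
  rewrite E; apply: (smooth_comp_rV oec oV _ _ sk).
    by move=> q []; rewrite /preimage /= cd => _ [].
  by move=> n; apply: Ck_sub (sed n) => q []; rewrite /preimage /= cd => ? [].
Qed.

End ChangeCoordinates.

Lemma frame_coord_trig_model {R : realType} (e1 e2 e3 e4 e5 : E6 R) (b1 b2 b3 : R) q :
  spatial_frame e1 e2 e3 e4 e5 ->
  frame_coord e1 e2 e3 e4 e5 (trig_model e1 e2 e3 e4 e5 0 (- b1) b1 b2 b3 q) =
  model_surface b1 b2 b3 q.
Proof.
move=> fr; rewrite trig_modelE (frame_coord_lc fr) /row6 /model_surface add0r.
by rewrite (mulrAC _ _^-1) [X in [:: _; _; X; _; _; _]](mulrAC _ _^-1).
Qed.

Section LocalCoordinates.
Context {R : realType}.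
Variables (U : set (E2 R)) (f : E2 R -> E6 R) (e1 e2 e3 e4 e5 : E6 R) (b1 b2 b3 : R).
Hypotheses (oU : open U) (sf : smooth_on U f).
Hypothesis f_pos : forall q, U q -> forall v : E2 R, v != 0 ->
  0 < mink ('D_v f q) ('D_v f q).
Hypothesis b3_gt0 : 0 < b3.
Let u q := mink (f q) dt / b1.
Let P q := mink (f q) e4.
Let Q q := mink (f q) e5.
Let s := Num.sqrt (b1 ^+ 2 + 2).
Let r := Num.sqrt (b1 ^+ 2 + 1).
Hypotheses (PQ : forall q, U q -> P q ^+ 2 + Q q ^+ 2 = b3 ^+ 2)
  (fE : forall q, U q -> f q = lc e1 e2 e3 e4 e5 (- b1 * u q) (r / s * cos (s * u q))
    (r / s * sin (s * u q)) b2 (P q) (Q q)).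

(* Near [q0] the polar angle of [(Q, P)] is [t + atan (A / B)], with [t] its value
   at [q0] and [(B, A)] the vector [(Q, P)] rotated by [- t]. *)
Lemma local_coordinates q0 : U q0 -> exists V W k g,
  [/\ open V /\ V q0, open W /\ V `<=` U, smooth_on V k /\ smooth_on W g,
      (forall q, V q -> W (k q) /\ g (k q) = q) /\
      (forall y, W y -> V (g y) /\ k (g y) = y) &
      forall q, V q -> f q = trig_model e1 e2 e3 e4 e5 0 (- b1) b1 b2 b3 (k q)].
Proof.
move=> Uq0; have b3n := lt0r_neq0 b3_gt0.
have [t [Pt Qt]] : exists t, P q0 / b3 = sin t /\ Q q0 / b3 = cos t.
  apply: circle_angle; rewrite !expr_div_n -mulrDl PQ// mulfV//.
  by rewrite expf_neq0.
have sP : smooth_on U P by exact: (smooth_mink oU sf (smooth_cst U e4)).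
have sQ : smooth_on U Q by exact: (smooth_mink oU sf (smooth_cst U e5)).
pose A q := cos t * P q + - sin t * Q q.
pose B q := sin t * P q + cos t * Q q.
have sA : smooth_on U A.
  exact: (smoothD oU (smoothM oU (smooth_cst U _) sP) (smoothM oU (smooth_cst U _) sQ)).
have sB : smooth_on U B.
  exact: (smoothD oU (smoothM oU (smooth_cst U _) sP) (smoothM oU (smooth_cst U _) sQ)).
have su : smooth_on U u.
  exact: (smoothM oU (smooth_mink oU sf (smooth_cst U dt)) (smooth_cst U b1^-1)).
(* Where B > 0 the angle of (B, A) is atan (A / B); at [q0] the value of B is [b3]. *)
pose U1 : set (E2 R) := U `&` [set q | 0 < B q].
have U1U : U1 `<=` U by move=> q [].
have oU1 : open U1.
  rewrite openE => q [Uq Bq]; rewrite /interior; apply: filterI.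
    exact: open_nbhs_nbhs.
  have cB : {for q, continuous B} by exact: (sB 0 q Uq).
  exact: (cvgr_gt (B q) cB 0 Bq).
have U1q0 : U1 q0.
  split=> //=; rewrite /B -Pt -Qt.
  rewrite (_ : _ + _ = (P q0 ^+ 2 + Q q0 ^+ 2) / b3); last by ring.
  by rewrite PQ// divr_gt0// exprn_gt0.
have sub (h : E2 R -> R) : smooth_on U h -> smooth_on U1 h.
  by move=> sh n; exact: Ck_sub U1U (sh n).
have sAB : smooth_on U1 (fun q => A q / B q).
  apply: (smoothM oU1 (sub _ sA)); apply: (smoothV oU1 _ (sub _ sB)).
  by move=> q [_ /lt0r_neq0].
pose k (q : E2 R) : E2 R := \row_j (if j == 0 then u q else b3 * (t + atan (A q / B q))).
have sk : smooth_on U1 k.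
  apply/(smooth_rVP oU1); apply: ord2P.
    by apply: (smooth_ext oU1 _ (sub _ su)) => q _; rewrite mxE.
  have sb := smoothM oU1 (smooth_cst U1 b3)
    (smoothD oU1 (smooth_cst U1 t) (smooth_atan oU1 sAB)).
  by apply: (smooth_ext oU1 _ sb) => q _; rewrite mxE.
have AB q : U q -> A q ^+ 2 + B q ^+ 2 = b3 ^+ 2.
  move=> Uq; rewrite -(PQ Uq).
  rewrite (_ : _ + _ = (cos t ^+ 2 + sin t ^+ 2) * (P q ^+ 2 + Q q ^+ 2)); last first.
    by rewrite /A /B; ring.
  by rewrite cos2Dsin2 mul1r.
have fk q : U1 q -> f q = trig_model e1 e2 e3 e4 e5 0 (- b1) b1 b2 b3 (k q).
  move=> [Uq Bq]; rewrite trig_modelE [LHS]fE// !mxE /= add0r.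
  have [cA sA'] := cos_sin_atan b3_gt0 Bq (AB q Uq).
  rewrite !(mulrC b3 (t + _)) !mulfK// sinD cosD cA sA'.
  have c2 : cos t * cos t = 1 - sin t * sin t by rewrite -!expr2 cos2sin2.
  apply: lc_eq => //.
  - rewrite [RHS](_ : _ = sin t * B q + cos t * A q); last by field.
    rewrite /A /B [RHS](_ : _ = (sin t * sin t + cos t * cos t) * P q); last by ring.
    by rewrite c2 addrC subrK mul1r.
  - rewrite [RHS](_ : _ = cos t * B q - sin t * A q); last by field.
    rewrite /A /B [RHS](_ : _ = (sin t * sin t + cos t * cos t) * Q q); last by ring.
    by rewrite c2 addrC subrK mul1r.
(* A vector killed by the derivative of [k] is killed by that of [f], which is the model composed
   with [k]; this contradicts positive definiteness. So the inverse function theorem applies to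
   [k]. *)
have k_inj q v : U1 q -> 'D_v k q = 0 -> v = 0.
  move=> Uq k0; apply/eqP/negPn/negP => vn.
  have := f_pos (U1U _ Uq) vn; rewrite (near_eq_deriveU v oU1 Uq fk).
  have sm := smooth_trig_model e1 e2 e3 e4 e5 0 (- b1) b1 b2 b3.
  have dm := smooth_differentiable sm (I : setT (k q)).
  have E := derive_compE v (smooth_differentiable sk Uq) dm.
  rewrite k0 [X in _ = X]deriveE// linear0 in E.
  by rewrite [X in mink X _](_ : _ = 0) ?mink0l ?ltxx//; exact: E.
have [V [W [g [[oV Vq0] oW VU1 sg [kK gK]]]]] := inverse_function oU1 sk k_inj U1q0.
exists V, W, k, g; split => //.
- by split=> // q /VU1/U1U.
- by split=> // n; exact: Ck_sub VU1 (sk n).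
- by move=> q /VU1/fk.
Qed.

End LocalCoordinates.

Theorem biconservative_PMCV_congruent (R : realType) (M : surface R) (phi : M -> E6 R) :
  spacelike_surface phi -> T_nowhere_zero phi -> H_nonzero phi ->
  biconservative phi -> PMCV phi ->
  exists b1 b2 b3 : R,
    [/\ b1 != 0, b2 != 0, b3 != 0,
        b2 ^+ 2 + b3 ^+ 2 = (b1 ^+ 2 + 2)^-1 &
        congruent_to_local phi (model_surface b1 b2 b3)].
Proof.
move=> hphi hT hH hb hp.
have [th [k [e1 [e2 [e3 [e4 [e5 [th0 k0 fr fE]]]]]]]] := global_frame hphi hT hH hb hp.
have b1_gt0 := hb1_gt0 th0; have b3_gt0 := hb3_gt0 th0 k0; have b2_gt0 := hb2_gt0 th0 k0.
exists (hb1 th), (hb2 th k), (hb3 th k); split; try exact: lt0r_neq0.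
  exact: hb2_hb3.
exists (frame_coord e1 e2 e3 e4 e5); first exact: frame_coord_isometry.
move=> p; have [d ad dp] := atlas_cover p.
have cq := chart_to_cod dp.
have b1E : hb1 th ^+ 2 = th by rewrite expr2 hb1_sqr.
pose f := local_expr phi d; pose b1 := hb1 th.
have PQ q : chart_cod d q -> mink (f q) e4 ^+ 2 + mink (f q) e5 ^+ 2 = hb3 th k ^+ 2.
  by move=> Uq; have [] := fE d ad q Uq.
have fE' q : chart_cod d q -> f q = lc e1 e2 e3 e4 e5 (- b1 * (mink (f q) dt / b1))
    (Num.sqrt (b1 ^+ 2 + 1) / Num.sqrt (b1 ^+ 2 + 2)
      * cos (Num.sqrt (b1 ^+ 2 + 2) * (mink (f q) dt / b1)))
    (Num.sqrt (b1 ^+ 2 + 1) / Num.sqrt (b1 ^+ 2 + 2)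
      * sin (Num.sqrt (b1 ^+ 2 + 2) * (mink (f q) dt / b1)))
    (hb2 th k) (mink (f q) e4) (mink (f q) e5).
  by move=> Uq; rewrite b1E; have [_ E] := fE d ad q Uq; exact: E.
have [V [W [k' [g [[oV Vq] [oW VU] [sk sg] [kK gK] fk]]]]] :=
  local_coordinates (@chart_cod_open _ _ d) (chart_smooth hphi ad)
  (chart_pos hphi ad) b3_gt0 PQ fE' cq.
have [c [cd cw cf ct]] := change_coordinates oV oW VU sk sg kK gK.
exists c; split.
- exact: (change_coordinates_system oV VU sk sg gK ad cd cw cf ct).
- by rewrite cd; split.
move=> q; rewrite cw => Wq; have [Vg kg] := gK q Wq.
by rewrite cf /= -(frame_coord_trig_model _ _ _ _ fr) -{2}kg -fk.
Qed.

(** * Isometries of R x S^4 *)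

Section InverseSqrt.
Context {R : realType} {V : normedModType R}.
Variables (U : set V) (a : V -> R).
Hypotheses (oU : open U) (sa : smooth_on U a) (a_gt0 : forall q, U q -> 0 < a q).
Let h q := (Num.sqrt (a q))^-1.

Let h0 q : U q -> Num.sqrt (a q) != 0.
Proof. by move=> /a_gt0 aq; rewrite lt0r_neq0// sqrtr_gt0. Qed.

Let Dh q v : U q -> differentiable h q /\ 'D_v h q = - 2^-1 * ('D_v a q * (h q * h q * h q)).
Proof.
move=> Uq; have da := smooth_differentiable sa Uq.
have Hs := is_derive1_sqrt (a_gt0 Uq).
have Hh : is_derive (a q) 1 (fun z => (Num.sqrt z)^-1)
    (- (Num.sqrt (a q)) ^- 2 *: (2 * Num.sqrt (a q))^-1) by exact: (is_deriveV (h0 Uq) Hs).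
have [d ->] := derive_compR v da Hh; split=> //.
rewrite /h /GRing.scale /=; have := h0 Uq; move: (Num.sqrt _) => z z0.
by field.
Qed.

(** The derivative of h = a^(-1/2) is - a' h^3 / 2, a polynomial in a' and h itself, so each order
    of regularity yields the next. *)
Lemma smooth_inv_sqrt : smooth_on U h.
Proof.
elim=> [|k IH]; first by move=> q Uq; exact: (differentiable_continuous (Dh 0 Uq).1).
split=> [q Uq|v]; first exact: (Dh 0 Uq).1.
have c := Ck_cst U k (- 2^-1 : R).
apply: Ck_ext (CkM oU c (CkM oU ((sa k.+1).2 v) (CkM oU (CkM oU IH IH) IH))) => // y Uy.
by rewrite (Dh v Uy).2.
Qed.

Lemma derive_inv_sqrt q v : U q -> 'D_v h q = - 2^-1 * ('D_v a q * (h q * h q * h q)).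
Proof. by move=> Uq; exact: (Dh v Uq).2. Qed.

End InverseSqrt.

(** * A retraction onto R x S^4 *)

Section Retraction.
Context {R : realType}.

Definition off_axis : set (E6 R) := [set y | 0 < mink y (unormal y)].
(** Radial projection in the sphere factor, off the time axis. Composition with it extends a map
    given on R x S^4 to an open set, with zero derivative along the unit normal at the points of R x
    S^4. *)
Definition retract (y : E6 R) : E6 R :=
  (y 0 0) *: dt + (Num.sqrt (mink y (unormal y)))^-1 *: unormal y.

Lemma RxS4_off_axis : @RxS4 R `<=` off_axis.
Proof. by move=> p /RxS4P E; rewrite /off_axis /= E. Qed.

Let sid : smooth_on setT (fun y : E6 R => y).
Proof. by apply/(smooth_rVP openT) => i; exact: (smooth_coord i openT). Qed.

Lemma smooth_unormal_map : smooth_on setT (@unormal R).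
Proof.
have s := smoothD_rV openT sid (smoothZ openT (smooth_mink openT sid (smooth_cst setT dt))
  (smooth_cst setT dt)).
by apply: (smooth_ext openT _ s) => y _; rewrite unormalE.
Qed.

Let sN := smooth_unormal_map.

Let sa : smooth_on setT (fun y : E6 R => mink y (unormal y)).
Proof. exact: (smooth_mink openT sid sN). Qed.

Lemma off_axis_open : open off_axis.
Proof.
rewrite openE => y y0; rewrite /interior.
have c : {for y, continuous (fun y : E6 R => mink y (unormal y))} by exact: (sa 0 y I).
exact: (cvgr_gt (mink y (unormal y)) c 0 y0).
Qed.

Let sT (W : normedModType R) (f : E6 R -> W) : smooth_on setT f -> smooth_on off_axis f.
Proof. by move=> sf k; exact: Ck_sub (sf k). Qed.

Let sh : smooth_on off_axis (fun y : E6 R => (Num.sqrt (mink y (unormal y)))^-1).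
Proof. exact: (smooth_inv_sqrt off_axis_open (sT sa)). Qed.

Let s0 : smooth_on off_axis (fun y : E6 R => y 0 0).
Proof. exact: (smooth_coord 0 off_axis_open). Qed.

Lemma smooth_retract : smooth_on off_axis retract.
Proof.
exact: (smoothD_rV off_axis_open (smoothZ off_axis_open s0 (smooth_cst _ dt))
  (smoothZ off_axis_open sh (sT sN))).
Qed.

Lemma retract_RxS4 y : off_axis y -> RxS4 (retract y).
Proof.
move=> y0; apply/RxS4P; rewrite /retract unormalD !unormalZ unormalK.
have udt : unormal (dt : E6 R) = 0 by rewrite unormalE mink_dtdt scaleN1r subrr.
have nn : mink (unormal y) (unormal y) = mink y (unormal y).
  by rewrite mink_unormal mink_unormal_dt mul0r addr0 minkC.
rewrite udt scaler0 add0r; set h := Num.sqrt _.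
rewrite minkDl (minkZl (y 0 0)) (minkZr h^-1) (minkZl h^-1) (minkZr h^-1) nn.
rewrite (minkC dt) mink_unormal_dt !mulr0 add0r.
have hh : mink y (unormal y) = h * h by rewrite -expr2 sqr_sqrtr// ltW.
have h0 : h != 0 by rewrite lt0r_neq0// sqrtr_gt0.
by rewrite hh; field.
Qed.

Lemma retract_id p : RxS4 p -> retract p = p.
Proof.
move=> /RxS4P E; rewrite /retract E sqrtr1 invr1 scale1r unormalE mink_dt scaleNr.
by rewrite addrCA subrr addr0.
Qed.

Lemma derive_retract p x : RxS4 p -> 'D_x retract p = Defs.proj p x.
Proof.
move=> Sp; have Op := RxS4_off_axis Sp; have /RxS4P E := Sp.
have oO := off_axis_open.
rewrite (deriveD_fun x (smoothZ oO s0 (smooth_cst _ dt)) (smoothZ oO sh (sT sN)) Op).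
rewrite (deriveZ_rV x s0 (smooth_cst _ dt) Op) (deriveZ_rV x sh (sT sN) Op).
rewrite (derive_inv_sqrt (sT sa) (fun q => id) x Op) E sqrtr1 invr1 !mulr1.
rewrite (derive_unique (is_derive_unormal p x)) scale1r.
rewrite (@derive_cst_on _ _ off_axis oO _ (fun=> dt) dt)// scaler0 addr0 derive_coord.
rewrite (derive_mink x (sT sid) (sT sN) Op) (derive_unique (is_derive_unormal p x)).
have -> : 'D_x (fun y : E6 R => y) p = x by rewrite deriveE// diff_val.
have -> : mink p (unormal x) = mink x (unormal p) by rewrite !mink_unormal minkC (minkC p dt); ring.
rewrite /Defs.proj (unormalE x) mink_dt.
move: (unormal p) (mink x (unormal p)) => n k.
by apply/rowP => j; rewrite ![in LHS]mxE ![in RHS]mxE; field.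
Qed.

End Retraction.

(** Three instances of the third hypothesis determine [k x y z], just as the metric determines its
    Levi-Civita connection. *)
Lemma koszul (T : Type) (R : realFieldType) (k s : T -> T -> T -> R) :
  (forall w x z, k w x z = k x w z) -> (forall w x z, s w x z = s x w z) ->
  (forall w x z, k w x z + k w z x = s w x z + s w z x) ->
  forall x y z, k x y z = s x y z.
Proof.
move=> ks ss E x y z; have := E x y z; have := E y x z; have := E z x y.
rewrite (ks y x z) (ks z x y) (ks z y x) (ss y x z) (ss z x y) (ss z y x).
by lra.
Qed.

(* Stated for abstract scalars, because [rewrite] and [lra] would try to unfold the
   iterated derivatives to which these two identities are applied. *)
Lemma swap_second (R : zmodType) (a b b' c d d' : R) :
  a + b = c + d -> b = b' -> d = d' -> a + b' = c + d'.
Proof. by move=> E <- <-. Qed.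

Lemma cancel_third (R : realFieldType) (t t' u u' a a' b b' : R) :
  t + a = u + b -> t' + a' = u' + b' -> t = t' -> u = u' -> a - a' = b - b'.
Proof. by move=> E E' tt uu; move: E E'; rewrite tt uu; lra. Qed.

(** * Maps that pull back the metric to the same form *)

Section SameMetric.
Context {R : realType}.
Variables (O : set (E6 R)) (K S : E6 R -> E6 R).
Hypotheses (oO : open O) (sK : smooth_on O K) (sS : smooth_on O S).
Hypothesis KS : forall p, O p -> forall x z,
  mink ('D_x K p) ('D_z K p) = mink ('D_x S p) ('D_z S p).
Implicit Types (p w x y z : E6 R).

Let sD (F : E6 R -> E6 R) x : smooth_on O F -> smooth_on O ('D_x F).
Proof. exact: smooth_derive. Qed.

(** Differentiating the common form gives the sums required by [koszul], and second derivatives are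
    symmetric. *)
Lemma same_metric_D2 p x y z : O p ->
  mink ('D_x ('D_y K) p) ('D_z K p) = mink ('D_x ('D_y S) p) ('D_z S p).
Proof.
move=> Op; have sym (F : E6 R -> E6 R) (sF : smooth_on O F) a b :
  'D_a ('D_b F) p = 'D_b ('D_a F) p by exact: (derive_comm_smooth oO a b sF Op).
apply: (koszul (k := fun a b c => mink ('D_a ('D_b K) p) ('D_c K p))
  (s := fun a b c => mink ('D_a ('D_b S) p) ('D_c S p))) => a b c.
- exact: (congr1 (fun v => mink v _) (sym K sK a b)).
- exact: (congr1 (fun v => mink v _) (sym S sS a b)).
have e := etrans (esym (derive_mink a (sD b sK) (sD c sK) Op))
  (etrans (near_eq_deriveU a oO Op (fun q Oq => KS Oq b c))
    (derive_mink a (sD b sS) (sD c sS) Op)).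
exact: (swap_second e (minkC _ _) (minkC _ _)).
Qed.

(* The Gauss equation: the third derivatives cancel by symmetry. *)
Lemma same_metric_gauss p w x y z : O p ->
  mink ('D_x ('D_y K) p) ('D_w ('D_z K) p) - mink ('D_w ('D_y K) p) ('D_x ('D_z K) p) =
  mink ('D_x ('D_y S) p) ('D_w ('D_z S) p) - mink ('D_w ('D_y S) p) ('D_x ('D_z S) p).
Proof.
move=> Op.
have e a b := etrans (esym (derive_mink a (sD b (sD y sK)) (sD z sK) Op))
  (etrans (near_eq_deriveU a oO Op (fun q Oq => same_metric_D2 b y z Oq))
    (derive_mink a (sD b (sD y sS)) (sD z sS) Op)).
exact: (cancel_third (e w x) (e x w)
  (congr1 (fun v => mink v _) (derive_comm_smooth oO w x (sD y sK) Op))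
  (congr1 (fun v => mink v _) (derive_comm_smooth oO w x (sD y sS) Op))).
Qed.

End SameMetric.

Lemma exists_orth3 {R : realType} (a b c : E6 R) :
  exists2 x : E6 R, x != 0 & [/\ mink x a = 0, mink x b = 0 & mink x c = 0].
Proof.
pose A : 'M[R]_(6, 3) := \matrix_(i, j) ((if i == 0 then -1 else 1) * (nth 0 [:: a; b; c] j) 0 i).
have mA x j : (x *m A) 0 j = mink x (nth 0 [:: a; b; c] j).
  by rewrite mxE minkE; apply: eq_bigr => i _; rewrite mxE; ring.
have : kermx A != 0.
  rewrite -mxrank_eq0 mxrank_ker subn_eq0 -ltnNge.
  by apply: leq_ltn_trans (rank_leq_col A) _.
move=> /rowV0Pn[x /sub_kermxP xA x0]; exists x => //.
have e (j : nat) : (j < 3)%N -> mink x (nth 0 [:: a; b; c] j) = 0.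
  by move=> j3; have := mA x (Ordinal j3); rewrite xA mxE.
by split; [exact: (e 0)|exact: (e 1)|exact: (e 2)].
Qed.

(** * Rigidity at a point, as linear algebra *)

Section PointwiseRigidity.
Context {R : realType}.
Variables (N N' : E6 R) (L : E6 R -> E6 R) (B C : E6 R -> E6 R -> E6 R).
Implicit Types (w x y z v : E6 R).
Hypotheses (LD : forall x y, L (x + y) = L x + L y) (LZ : forall a x, L (a *: x) = a *: L x).
Hypotheses (NN : mink N N = 1) (Ndt : mink N dt = 0)
  (NN' : mink N' N' = 1) (Ndt' : mink N' dt = 0).
Hypotheses (LL : forall x y, mink (L x) (L y) = mink x y - mink x N * mink y N)
  (LN' : forall x, mink (L x) N' = 0).
Hypotheses (BL : forall x y z, mink (B x y) (L z) = mink (C x y) z - mink (C x y) N * mink z N)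
  (BN : forall x y, mink (B x y) N' = - (mink (L x) (L y) + mink (L x) dt * mink (L y) dt))
  (CN : forall x y, mink (C x y) N =
     - (mink x y - mink x N * mink y N + mink x dt * mink y dt))
  (gauss : forall w x y z, mink (B x y) (B w z) - mink (B w y) (B x z) =
     mink (C x y) (C w z) - mink (C w y) (C x z)).

(** The derivative [L] kills the normal [N]; sending [N] to [N'] instead turns it into a linear
    isometry of E^6_1. *)
Definition normal_ext v : E6 R := L v + mink v N *: N'.
Local Notation A := normal_ext.

Lemma normal_extD x y : A (x + y) = A x + A y.
Proof. by rewrite /normal_ext LD minkDl scalerDl addrACA. Qed.

Lemma normal_extZ a x : A (a *: x) = a *: A x.
Proof. by rewrite /normal_ext LZ minkZl -scalerA scalerDr. Qed.

Lemma mink_normal_ext x y : mink (A x) (A y) = mink x y.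
Proof.
rewrite /normal_ext !minkDl !minkDr (minkZl (mink x N)) (minkZl (mink x N)) !(minkZr (mink y N)).
by rewrite LL LN' NN' (minkC N') LN'; ring.
Qed.

Let w_ (i : 'I_6) : E6 R := A (delta_mx 0 i).

Let w_orth i j : i != j -> mink (w_ i) (w_ j) = 0.
Proof.
move=> ij; rewrite mink_normal_ext minkE big1// => k _; rewrite !mxE eqxx/=.
have [->|_] := eqVneq k i; last by rewrite mulr0 mul0r.
by rewrite (negbTE ij) mulr0.
Qed.

Let w_nn i : mink (w_ i) (w_ i) != 0.
Proof.
rewrite mink_normal_ext minkE (bigD1 i)//= big1 => [|k ki]; last first.
  by rewrite !mxE (negbTE ki) andbF mulr0.
rewrite !mxE !eqxx !mulr1 addr0.
by case: (i == 0); rewrite ?oppr_eq0 oner_neq0.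
Qed.

Lemma normal_ext_eq0 x : (forall y, mink x (A y) = 0) -> x = 0.
Proof. by move=> xA; apply: (frame_eq0 w_orth w_nn) => i; exact: xA. Qed.

Lemma normal_ext_surj x : exists v, x = A v.
Proof.
rewrite (frame_expand w_orth w_nn x).
elim/big_rec: _ => [|i y _ [v ->]].
  by exists 0; rewrite -[in RHS](scale0r (0 : E6 R)) normal_extZ scale0r.
by exists ((mink x (w_ i) / mink (w_ i) (w_ i)) *: delta_mx 0 i + v);
  rewrite normal_extD normal_extZ.
Qed.

Lemma L_normal : L N = 0.
Proof.
apply: normal_ext_eq0 => y; rewrite /normal_ext minkDr (minkZr (mink y N)) LN' LL NN.
by rewrite (minkC N); ring.
Qed.

Let s' x y := mink (L x) (L y) + mink (L x) dt * mink (L y) dt.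
Let s x y := mink x y - mink x N * mink y N + mink x dt * mink y dt.

(** The products of [B x y] with the values of [L] are those of the part of [C x y] orthogonal to
    [N], and its product with [N'] is - s' x y. *)
Let BE x y : B x y = A (C x y - (mink (C x y) N + s' x y) *: N).
Proof.
apply/eqP; rewrite -subr_eq0; apply/eqP; apply: normal_ext_eq0 => z.
rewrite minkDl minkNl mink_normal_ext /normal_ext minkDr (minkZr (mink z N)) BL BN.
rewrite minkDl minkNl (minkZl (mink (C x y) N + s' x y)) -/(s' x y) (minkC N); ring.
Qed.

Let CE x y : mink (C x y) N = - s x y. Proof. exact: CN. Qed.

Let BB x y w z : mink (B x y) (B w z) = mink (C x y) (C w z) - s x y * s w z + s' x y * s' w z.
Proof.
rewrite !BE mink_normal_ext !minkDl !minkDr !minkNl !minkNr.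
set k := _ + s' x y; set l := _ + s' w z.
rewrite !(minkZl k) !(minkZr l) NN (minkC N (C w z)) /k /l !CE; ring.
Qed.

(** The contributions of the tangential parts are equal, so Gauss says that the second fundamental
    forms [s] and [s'] have the same two by two minors. *)
Let gauss_s w x y z : s' x y * s' w z - s' w y * s' x z = s x y * s w z - s w y * s x z.
Proof. by have := gauss w x y z; rewrite !BB; lra. Qed.

Let s_dt y : s dt y = 0.
Proof. by rewrite /s mink_dtdt (minkC dt N) Ndt (minkC dt y); ring. Qed.

(** [dt] lies in the kernel of [s]. For v with L v nonzero and orthogonal to dt and to L dt, s'(dt,
    v) = 0 and s'(v, v) > 0, and equality of minors reduces to s'(dt, y) s'(v, v) = 0. *)
Let s'_dt y : s' dt y = 0.
Proof.
(* Orthogonality to [N'] ensures that [z] is a value of [L], because its preimage under [A] then has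
   no component along [N]. *)
have [z z0 [zdt zN zL]] := exists_orth3 dt N' (L dt).
have [v zE] := normal_ext_surj z.
have vN : mink v N = 0.
  move: zN; rewrite zE /normal_ext minkDl (minkZl (mink v N)) LN' NN'; lra.
have zLv : z = L v by rewrite zE /normal_ext vN scale0r addr0.
have svv : 0 < s' v v.
  rewrite /s' -zLv zdt mulr0 addr0; apply: mink_spacelike => //.
  by move: zdt; rewrite mink_dt => /eqP; rewrite oppr_eq0 => /eqP.
have sdv : s' dt v = 0 by rewrite /s' -zLv minkC zL zdt mulr0 addr0.
have := gauss_s v dt y v; rewrite !s_dt sdv !(mul0r, mulr0) !subr0.
by move/eqP; rewrite mulf_eq0 (gt_eqF svv) orbF => /eqP.
Qed.

Lemma rigidity_dt : exists e, [/\ e ^+ 2 = 1, L dt = e *: dt,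
  (forall x, mink (L x) dt = e * mink x dt) & forall x y, B x y = A (C x y)].
Proof.
(* s'(dt, y) = 0 for all y says that this vector is orthogonal to every L y; it is orthogonal to
   [N'] as well. *)
have E : L dt + mink (L dt) dt *: dt = 0.
  apply: normal_ext_eq0 => y; rewrite /normal_ext minkDl (minkZl (mink (L dt) dt)).
  rewrite !minkDr !(minkZr (mink y N)) LN' (minkC dt N') Ndt' (minkC dt (L y)).
  by have := s'_dt y; rewrite /s'; lra.
pose e := - mink (L dt) dt.
have Le : L dt = e *: dt by rewrite scaleNr; apply/eqP; rewrite -subr_eq0 opprK E.
have e2 : e ^+ 2 = 1.
  have := LL dt dt; rewrite Le (minkZl e) (minkZr e) mink_dtdt (minkC dt N) Ndt expr2; lra.
have Ldt x : mink (L x) dt = e * mink x dt.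
  have := LL x dt; rewrite Le (minkZr e) (minkC dt N) Ndt mulr0 subr0 => <-.
  by rewrite mulrA -expr2 e2 mul1r.
exists e; split=> // x y; rewrite BE CE.
have -> : s' x y = s x y.
  rewrite /s' LL !Ldt /s.
  rewrite (_ : e * _ * _ = e ^+ 2 * (mink x dt * mink y dt)); last by ring.
  by rewrite e2 mul1r.
by rewrite addNr scale0r subr0.
Qed.

End PointwiseRigidity.

Section SphereValued.
Context {R : realType} {V : normedModType R}.
Variables (U : set V) (J : V -> E6 R).
Hypotheses (oU : open U) (sJ : smooth_on U J) (JS : forall p, U p -> RxS4 (J p)).

Lemma derive_unormal_comp p x : U p -> 'D_x (fun q => unormal (J q)) p = unormal ('D_x J p).
Proof.
move=> Up.
have dN := smooth_differentiable (smooth_unormal_map (R := R)) (I : setT (J p)).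
refine (etrans (derive_compE x (smooth_differentiable sJ Up) dN) _).
exact: derive_unique (is_derive_unormal _ _).
Qed.

Lemma smooth_unormal_comp : smooth_on U (fun q => unormal (J q)).
Proof.
have s := smoothD_rV oU sJ (smoothZ oU (smooth_mink oU sJ (smooth_cst U dt)) (smooth_cst U dt)).
by apply: (smooth_ext oU _ s) => q _; rewrite unormalE.
Qed.

Lemma sphere_D1 p x : U p -> mink ('D_x J p) (unormal (J p)) = 0.
Proof.
move=> Up.
have E := near_eq_deriveU x oU Up (fun q Uq => (RxS4P (J q)).1 (JS Uq)).
have D := derive_mink x sJ smooth_unormal_comp Up.
have Z : 'D_x (fun=> 1 : R) p = 0 by exact: derive_cst.
have := etrans (esym D) (etrans E Z).
rewrite derive_unormal_comp//; move: ('D_x J p) => v.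
rewrite !mink_unormal (minkC (J p) v).
by move: (mink v dt) (mink (J p) dt) (mink v (J p)) => a b c; lra.
Qed.

Lemma sphere_D2 p x y : U p -> mink ('D_x ('D_y J) p) (unormal (J p)) =
  - (mink ('D_x J p) ('D_y J p) + mink ('D_x J p) dt * mink ('D_y J p) dt).
Proof.
move=> Up.
have E := near_eq_deriveU x oU Up (fun q Uq => sphere_D1 y Uq).
have D := derive_mink x (smooth_derive y sJ) smooth_unormal_comp Up.
have Z : 'D_x (fun=> 0 : R) p = 0 by exact: derive_cst.
have := etrans (esym D) (etrans E Z).
rewrite derive_unormal_comp//; move: ('D_x ('D_y J) p) => w.
by move: ('D_x J p) ('D_y J p) => a b; rewrite (mink_unormal b a) (minkC b a); lra.
Qed.

End SphereValued.

Lemma pD0_ball_cst {R : realType} (g : E2 R -> R) (U : set (E2 R)) q0 r :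
  smooth_on U g -> (forall i q, U q -> pD i g q = 0) -> ball q0 r `<=` U ->
  forall q, ball q0 r q -> g q = g q0.
Proof.
move=> sg Dg rU.
apply: derive0_ball_cst => [y /rU Uy|y v /rU Uy]; first exact: smooth_differentiable Uy.
by rewrite (derive_pD v (smooth_differentiable sg Uy)) !Dg// !scaler0 addr0.
Qed.

(** * An isometry of R x S^4 along a parametrized surface *)

Section IsometryAlongMap.
Context {R : realType}.
Variables (F G : E6 R -> E6 R) (O : set (E6 R)).
Hypotheses (oO : open O) (SO : @RxS4 R `<=` O) (sF : smooth_on O F) (sG : smooth_on O G).
Hypotheses (GS : forall p, RxS4 p -> RxS4 (G p)) (FG : forall p, RxS4 p -> F (G p) = p).
Hypothesis F_metric : forall p, RxS4 p -> forall x y,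
  tangent_RxS4 p x -> tangent_RxS4 p y -> mink ('D_x F p) ('D_y F p) = mink x y.
Implicit Types (p w x z v : E6 R).

Let Om := @off_axis R.
Let oOm : open Om := @off_axis_open R.
Let S := @retract R.
Let sS : smooth_on Om S := @smooth_retract R.
Let SS p : Om p -> RxS4 (S p). Proof. exact: retract_RxS4. Qed.

Definition retract_comp : E6 R -> E6 R := fun y => G (retract y).
Local Notation K := retract_comp.

Let sK : smooth_on Om K.
Proof.
by apply: (smooth_comp_rV oOm oO _ sS sG) => p /SS/SO.
Qed.
Let KS p : Om p -> RxS4 (K p). Proof. by move=> /SS/GS. Qed.

(** [F \o K] is the retraction, and [F] preserves the metric on the vectors tangent to R x S^4,
    among which are the derivatives of [K]. *)
Lemma retract_comp_metric p : Om p -> forall x z,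
  mink ('D_x K p) ('D_z K p) = mink ('D_x S p) ('D_z S p).
Proof.
move=> Op x z.
have E v : 'D_v S p = 'D_('D_v K p) F (K p).
  have FK y : Om y -> S y = (F \o K) y by move=> Oy; rewrite /= /K FG//; exact: SS.
  refine (etrans (near_eq_deriveU v oOm Op FK) _).
  exact: (derive_compE v (smooth_differentiable sK Op) (smooth_differentiable sF (SO (KS Op)))).
have T v : tangent_RxS4 (K p) ('D_v K p) by exact: (sphere_D1 oOm sK KS v Op).
exact: (etrans (esym (F_metric (KS Op) (T x) (T z)))
  (esym (f_equal2 (fun a b => mink a b) (E x) (E z)))).
Qed.

(** For [p] on R x S^4, the linear isometry of E^6_1 that extends the derivative of [G] on the
    tangent space. *)
Definition isometry_frame p v := normal_ext (unormal p) (unormal (K p)) (fun x => 'D_x K p) v.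

Section AtPoint.
Variable p : E6 R.
Hypothesis Sp : RxS4 p.
Let Op : Om p := RxS4_off_axis Sp.
Let N := unormal p.
Let N' := unormal (K p).
Let L x := 'D_x K p.
Let NN : mink N N = 1.
Proof. by rewrite mink_unormal mink_unormal_dt mul0r addr0 minkC; exact/RxS4P. Qed.
Let NN' : mink N' N' = 1.
Proof.
by rewrite mink_unormal mink_unormal_dt mul0r addr0 minkC; exact/RxS4P/KS.
Qed.
Let LD x y : L (x + y) = L x + L y.
Proof.
have := derive_lin (smooth_differentiable sK Op) 1 x y; rewrite !scale1r; exact.
Qed.
Let LZ (a : R) x : L (a *: x) = a *: L x.
Proof.
have D0 : L 0 = 0 by have := LD 0 0; rewrite addr0 => /eqP; rewrite -subr_eq subrr => /eqP.
by have := derive_lin (smooth_differentiable sK Op) a x 0; rewrite addr0 -/(L _) => ->;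
  rewrite -/(L 0) D0 addr0.
Qed.
Let Sx x : 'D_x S p = x - mink x N *: N. Proof. exact: derive_retract. Qed.
Let PP x y : mink (x - mink x N *: N) (y - mink y N *: N) = mink x y - mink x N * mink y N.
Proof.
rewrite minkDl !minkDr !minkNl !minkNr (minkZl (mink x N)) (minkZl (mink x N)).
by rewrite !(minkZr (mink y N)) NN (minkC N); ring.
Qed.
Let Pdt x : mink (x - mink x N *: N) dt = mink x dt.
Proof.
by rewrite minkDl minkNl (minkZl (mink x N)) mink_unormal_dt mulr0 subr0.
Qed.
Let LL x y : mink (L x) (L y) = mink x y - mink x N * mink y N.
Proof.
exact: (etrans (retract_comp_metric Op x y)
  (etrans (f_equal2 (fun a b => mink a b) (Sx x) (Sx y)) (PP x y))).
Qed.
Let LN' x : mink (L x) N' = 0.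
Proof. exact: (sphere_D1 oOm sK KS x Op). Qed.

Lemma isometry_frameD x y : isometry_frame p (x + y) = isometry_frame p x + isometry_frame p y.
Proof. exact: (normal_extD N N' LD). Qed.

Lemma isometry_frameZ a x : isometry_frame p (a *: x) = a *: isometry_frame p x.
Proof. exact: (normal_extZ N N' LZ). Qed.

Lemma mink_isometry_frame x y : mink (isometry_frame p x) (isometry_frame p y) = mink x y.
Proof. exact: (mink_normal_ext NN' LL LN'). Qed.

Lemma isometry_frame_normal : isometry_frame p N = N'.
Proof.
rewrite /isometry_frame /normal_ext NN scale1r.
by rewrite [X in X + _ = _](L_normal NN NN' LL LN') add0r.
Qed.

Lemma isometry_frame_rigid : exists e, [/\ e ^+ 2 = 1, isometry_frame p dt = e *: dt,
  (forall x, mink ('D_x K p) dt = e * mink x dt) &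
  forall x y, 'D_x ('D_y K) p = isometry_frame p ('D_x ('D_y S) p)].
Proof.
have BL x y z : mink ('D_x ('D_y K) p) (L z)
    = mink ('D_x ('D_y S) p) z - mink ('D_x ('D_y S) p) N * mink z N.
  refine (etrans (same_metric_D2 oOm sK sS retract_comp_metric x y z Op) _).
  refine (etrans (congr1 (fun v => mink _ v) (Sx z)) _).
  by rewrite minkDr minkNr (minkZr (mink z N)) mulrC.
have BN x y : mink ('D_x ('D_y K) p) N' = - (mink (L x) (L y) + mink (L x) dt * mink (L y) dt).
  exact: (sphere_D2 oOm sK KS x y Op).
have CN x y : mink ('D_x ('D_y S) p) N =
     - (mink x y - mink x N * mink y N + mink x dt * mink y dt).
  have Sid : S p = p := retract_id Sp.
  by have := sphere_D2 oOm sS SS x y Op; rewrite !Sx PP !Pdt Sid.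
have [e [e2 Ldt Le BC]] := rigidity_dt LD LZ NN (mink_unormal_dt p) NN' (mink_unormal_dt _)
  LL LN' BL BN CN (fun w x y z => same_metric_gauss oOm sK sS retract_comp_metric w x y z Op).
exists e; split=> //.
by rewrite /isometry_frame /normal_ext (minkC dt) mink_unormal_dt scale0r addr0; exact: Ldt.
Qed.

End AtPoint.

Section AlongMap.
Variables (U : set (E2 R)) (f : E2 R -> E6 R).
Hypotheses (oU : open U) (sf : smooth_on U f) (fS : forall q, U q -> RxS4 (f q)).
Implicit Types (q : E2 R) (i : 'I_2).

Let fO q : U q -> Om (f q). Proof. by move=> /fS/RxS4_off_axis. Qed.

Let chain (h : E6 R -> E6 R) i q : smooth_on Om h -> U q ->
  pD i (fun y => h (f y)) q = 'D_(pD i f q) h (f q).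
Proof.
move=> sh Uq; rewrite !pD_deriveE.
exact: (derive_compE _ (smooth_differentiable sf Uq) (smooth_differentiable sh (fO Uq))).
Qed.

Let scomp (h : E6 R -> E6 R) : smooth_on Om h -> smooth_on U (fun y => h (f y)).
Proof. by move=> sh; exact: (smooth_comp_rV oU oOm fO sf sh). Qed.

Let sKf : smooth_on U (fun y => K (f y)). Proof. exact: scomp. Qed.

Let sn v : smooth_on U (fun y => mink v (unormal (f y))).
Proof. exact: (smooth_mink oU (smooth_cst U v) (smooth_unormal_comp oU sf)). Qed.

Let Dn v i q : U q -> pD i (fun y => mink v (unormal (f y))) q = mink v (unormal (pD i f q)).
Proof.
move=> Uq; rewrite !pD_deriveE.
refine (etrans (derive_mink _ (smooth_cst U v) (smooth_unormal_comp oU sf) Uq) _).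
by rewrite (derive_unormal_comp sf _ Uq) derive_cst mink0l add0r.
Qed.

Let sKN v : smooth_on U (fun y => mink v (unormal (f y)) *: unormal (K (f y))).
Proof. exact: (smoothZ oU (sn v) (smooth_unormal_comp oU sKf)). Qed.

Lemma smooth_isometry_frame v : smooth_on U (fun y => isometry_frame (f y) v).
Proof. exact: (smoothD_rV oU (scomp (smooth_derive v sK)) (sKN v)). Qed.

(* [v = 'D_v S + <v, N> N] along [RxS4]; differentiating this along [f] determines
   ['D_F ('D_v S)], where [F] is a partial derivative of [f]. *)
Let D2_retract v i q : U q -> 'D_(pD i f q) ('D_v S) (f q) =
  - (mink v (unormal (pD i f q)) *: unormal (f q) + mink v (unormal (f q)) *: unormal (pD i f q)).
Proof.
move=> Uq; have sSN : smooth_on U (fun y => mink v (unormal (f y)) *: unormal (f y)).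
  exact: (smoothZ oU (sn v) (smooth_unormal_comp oU sf)).
have sDS := scomp (smooth_derive v sS).
have E y : U y -> 'D_v S (f y) + mink v (unormal (f y)) *: unormal (f y) = v.
  by move=> Uy; rewrite (derive_retract v (fS Uy)) subrK.
have := pD_ext i oU E Uq; rewrite pD_cst (pD_add i sDS sSN Uq).
rewrite (pDZ i (sn v) (smooth_unormal_comp oU sf) Uq) Dn//.
have -> : pD i (fun y => unormal (f y)) q = unormal (pD i f q).
  by rewrite !pD_deriveE (derive_unormal_comp sf _ Uq).
by rewrite (chain i (smooth_derive v sS) Uq) => /eqP; rewrite addr_eq0 => /eqP.
Qed.

Lemma pD_orth_unormal_comp i q : U q -> mink (pD i f q) (unormal (f q)) = 0.
Proof. by move=> Uq; rewrite pD_deriveE; exact: (sphere_D1 oU sf fS _ Uq). Qed.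

Lemma isometry_frame_pD i q : U q -> isometry_frame (f q) (pD i f q) = pD i (fun y => K (f y)) q.
Proof.
move=> Uq; rewrite (chain i sK Uq) /isometry_frame /normal_ext pD_orth_unormal_comp//.
by rewrite scale0r addr0.
Qed.

(** Write A for the frame. Its derivative contains D^2 K, which is A applied to D^2 of the
    retraction, and the derivative of the normal at K f, which is A applied to that of the normal at
    f because A dt = dt or - dt. The terms cancel by [D2_retract]. *)
Lemma pD_isometry_frame v i q : U q -> pD i (fun y => isometry_frame (f y) v) q = 0.
Proof.
move=> Uq; have Sq := fS Uq.
have [e [e2 Adt Ldt D2]] := isometry_frame_rigid Sq.
have sDK := scomp (smooth_derive v sK).
refine (etrans (pD_add i sDK (sKN v) Uq) _).
rewrite (pDZ i (sn v) (smooth_unormal_comp oU sKf) Uq) Dn// (chain i (smooth_derive v sK) Uq).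
rewrite D2 D2_retract//.
have -> : pD i (fun y => unormal (K (f y))) q = isometry_frame (f q) (unormal (pD i f q)).
  rewrite unormalE isometry_frameD// isometry_frameZ// Adt isometry_frame_pD//.
  rewrite pD_deriveE (derive_unormal_comp sKf _ Uq) -pD_deriveE unormalE.
  by rewrite (chain i sK Uq) Ldt scalerA mulrC.
rewrite -scaleN1r isometry_frameZ// isometry_frameD// !isometry_frameZ//.
by rewrite (isometry_frame_normal Sq) scaleN1r addNr.
Qed.

(** With A constant on a ball, <K f, A w> - <f, w> is constant as well. It vanishes for w orthogonal
    to dt, since A sends the normal of R x S^4 at f to the one at K f; only a time translation is
    left. *)
Lemma isometry_local (s1 s2 s3 s4 s5 : E6 R) q0 : spatial_frame s1 s2 s3 s4 s5 -> U q0 ->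
  exists (B : set (E2 R)) (e a : R) (e1 e2 e3 e4 e5 : E6 R), [/\ open B /\ B q0, e ^+ 2 = 1, spatial_frame e1 e2 e3 e4 e5 &
    forall q, B q -> G (f q) = lc e1 e2 e3 e4 e5 (a + e * f q 0 0) (mink (f q) s1)
      (mink (f q) s2) (mink (f q) s3) (mink (f q) s4) (mink (f q) s5)].
Proof.
move=> [s1dt s2dt s3dt s4dt s5dt s11 s22 s33 s44 s55 s12 s13 s14 s15 s23 s24 s25 s34 s35 s45] Uq0.
have /nbhs_ballP[r /= r0 rU] : nbhs q0 U by exact: open_nbhs_nbhs.
have S0 := fS Uq0; pose A := isometry_frame (f q0).
have [e [e2 Adt Ldt _]] := isometry_frame_rigid S0.
have Ac v q : ball q0 r q -> isometry_frame (f q) v = A v.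
  move=> rq; apply/rowP => j.
  have sV := smooth_isometry_frame v.
  have sVj := (smooth_rVP oU _).1 sV j.
  apply: (pD0_ball_cst sVj _ rU rq) => i y Uy.
  have dV := smooth_differentiable sV Uy.
  rewrite pD_deriveE -(derive_rV (f := fun y => isometry_frame (f y) v)); last exact: diff_derivable.
  by rewrite -pD_deriveE pD_isometry_frame// mxE.
have AA x y : mink (A x) (A y) = mink x y by exact: mink_isometry_frame.
have Axdt x : mink (A x) dt = e * mink x dt.
  have := AA x dt; rewrite {2}/A Adt (minkZr e) => <-.
  by rewrite mulrA -expr2 e2 mul1r.
pose k w := mink (K (f q0)) (A w) - mink (f q0) w.
have kc w q : ball q0 r q -> mink (K (f q)) (A w) = mink (f q) w + k w.
  move=> rq.
  pose g y := mink (K (f y)) (A w) + (- 1) * mink (f y) w.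
  have s1' := smooth_mink oU sKf (smooth_cst U (A w)).
  have s2' := smooth_mink oU sf (smooth_cst U w).
  have s3' := smoothM oU (smooth_cst U (- 1 : R)) s2'.
  have sb (h : E2 R -> R) : smooth_on U h -> smooth_on (ball q0 r) h.
    by move=> sh n; exact: Ck_sub rU (sh n).
  have Dg i y : ball q0 r y -> pD i g y = 0.
    move=> ry; have Uy := rU _ ry; rewrite /g (pD_add i s1' s3' Uy).
    rewrite (pDM i (smooth_cst U (- 1 : R)) s2' Uy) pD_cst mul0r add0r mulN1r.
    have Dm (h : E2 R -> E6 R) z : smooth_on U h -> pD i (fun y => mink (h y) z) y = mink (pD i h y) z.
      move=> sh; rewrite !pD_deriveE (derive_mink _ sh (smooth_cst U z) Uy).
      by rewrite derive_cst mink0r addr0.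
    by rewrite !Dm// -isometry_frame_pD// Ac// AA subrr.
  have := pD0_ball_cst (sb _ (smoothD oU s1' s3')) Dg (fun _ => id) rq.
  rewrite /g /k; move: (mink (K (f q)) _) (mink (K (f q0)) _) (mink (f q) w) (mink (f q0) w).
  by move=> x1 x2 x3 x4; lra.
have k0 w : mink w dt = 0 -> k w = 0.
  move=> wdt; apply/eqP; rewrite /k subr_eq0; apply/eqP.
  have -> : K (f q0) = A (unormal (f q0)) - mink (K (f q0)) dt *: dt.
    by rewrite /A (isometry_frame_normal S0) unormalE addrK.
  rewrite minkDl minkNl AA minkZl (minkC dt) Axdt wdt !mulr0 subr0.
  by rewrite minkC mink_unormal wdt mul0r addr0 minkC.
have fr : spatial_frame (A s1) (A s2) (A s3) (A s4) (A s5).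
  by split; rewrite ?AA ?Axdt ?s1dt ?s2dt ?s3dt ?s4dt ?s5dt ?mulr0.
exists (ball q0 r), e, (- e * k dt), (A s1), (A s2), (A s3), (A s4), (A s5); split => //.
  by split; [exact: ball_open|exact: ballxx].
move=> q rq; have Sq := fS (rU _ rq).
have -> : G (f q) = K (f q) by rewrite /K (retract_id Sq).
rewrite [LHS](spatial_frame_expand fr). rewrite !kc// (k0 _ s1dt) (k0 _ s2dt) (k0 _ s3dt)
  (k0 _ s4dt) (k0 _ s5dt) !addr0; apply: lc_eq => //.
have := kc dt q rq; rewrite {1}/A Adt (minkZr e) (mink_dt (f q)) => E.
have -> : mink (K (f q)) dt = e * (e * mink (K (f q)) dt).
  by rewrite mulrA -expr2 e2 mul1r.
by rewrite E; ring.
Qed.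

End AlongMap.
End IsometryAlongMap.

(** * The equivalence *)

Section StandardFrame.
Context {R : realType}.

Lemma dt_row6 : dt = row6 1 0 0 0 0 0 :> E6 R.
Proof. by apply/rowP; apply: forall_ord6; rewrite !mxE -!val_eqE /= inordK. Qed.

Let s1 : E6 R := row6 0 1 0 0 0 0.
Let s2 : E6 R := row6 0 0 1 0 0 0.
Let s3 : E6 R := row6 0 0 0 1 0 0.
Let s4 : E6 R := row6 0 0 0 0 1 0.
Let s5 : E6 R := row6 0 0 0 0 0 1.

Lemma standard_frame : spatial_frame s1 s2 s3 s4 s5.
Proof. by split; rewrite ?dt_row6 mink_row6; ring. Qed.

Lemma lc_standard a0 a1 a2 a3 a4 a5 : lc s1 s2 s3 s4 s5 a0 a1 a2 a3 a4 a5 = row6 a0 a1 a2 a3 a4 a5.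
Proof.
rewrite /lc dt_row6; apply/rowP; apply: forall_ord6; rewrite !mxE !inordK//=; ring.
Qed.

Lemma model_surfaceE b1 b2 b3 q :
  model_surface b1 b2 b3 q = trig_model s1 s2 s3 s4 s5 0 (- b1) b1 b2 b3 q.
Proof.
rewrite trig_modelE lc_standard /row6 /model_surface add0r.
by rewrite (mulrAC _ _^-1) [X in [:: _; _; X; _; _; _]](mulrAC _ _^-1).
Qed.

Lemma model_surface_coords e1 e2 e3 e4 e5 (a t b1 b2 b3 : R) q :
  let m := model_surface b1 b2 b3 q in
  lc e1 e2 e3 e4 e5 (a + t * m 0 0) (mink m s1) (mink m s2) (mink m s3) (mink m s4) (mink m s5)
  = trig_model e1 e2 e3 e4 e5 a (t * - b1) b1 b2 b3 q.
Proof.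
rewrite /= model_surfaceE trig_modelE lc_standard !mink_row6 trig_modelE mxE /=.
by apply: lc_eq; ring.
Qed.

End StandardFrame.

Section Backward.
Context {R : realType} {M : surface R}.
Variables (phi : M -> E6 R) (b1 b2 b3 : R).
Hypotheses (hphi : spacelike_surface phi) (hT : T_nowhere_zero phi).
Hypotheses (b3n : b3 != 0) (bE : b2 ^+ 2 + b3 ^+ 2 = (b1 ^+ 2 + 2)^-1).
Hypothesis cong : congruent_to_local phi (model_surface b1 b2 b3).
Implicit Types (q : E2 R).

(** In the chart [d] the immersion is the inverse [G] of the isometry, applied to the model,
    composed with the transition to the coordinates of the congruence; [isometry_local] trades [G]
    for a new frame. *)
Lemma congruent_local_model d q0 : atlas d -> chart_cod d q0 ->
  exists (U : set (E2 R)) (h : E2 R -> E2 R) (e1 e2 e3 e4 e5 : E6 R) (a t : R),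
  [/\ open U /\ U q0, smooth_on U h /\ (forall q v, U q -> 'D_v h q = 0 -> v = 0),
    spatial_frame e1 e2 e3 e4 e5, t ^+ 2 = b1 ^+ 2 &
    forall q, U q -> local_expr phi d q = trig_model e1 e2 e3 e4 e5 a t b1 b2 b3 (h q)].
Proof.
move=> ad cq0; have [F [G [Om [hOm hFG FGS GF Fm]]] cF] := cong.
have [opO SO] := hOm; have [sF sG] := hFG.
have [c [cc cp Fc]] := cF (chart_from d q0).
have [scd sdc] := cc d ad; have dc : compatible d c by split.
have q0dc : transition_dom d c q0 by [].
have bb : (- b1) ^+ 2 = b1 ^+ 2 by rewrite sqrrN.
have sf : smooth_on setT (model_surface b1 b2 b3).
  by apply: (smooth_ext openT _ (smooth_trig_model _ _ _ _ _ 0 (- b1) b1 b2 b3)) => q _;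
    rewrite model_surfaceE.
have fS q : [set: E2 R] q -> RxS4 (model_surface b1 b2 b3 q).
  by move=> _; rewrite model_surfaceE; apply: trig_model_RxS4 => //; exact: standard_frame.
have [B [e [a [e1 [e2 [e3 [e4 [e5 [[oB Bq] ee fr GE]]]]]]]]] :=
  isometry_local opO SO sF sG (fun p Sp => (FGS p Sp).2) (fun p Sp => (GF p Sp).2) Fm
    openT sf fS standard_frame (I : [set: E2 R] (transition d c q0)).
pose U := transition_dom d c `&` [set q | B (transition d c q)].
have oU' := @transition_dom_open _ _ d c.
have oU : open U.
  rewrite openE => q [Uq Bq']; rewrite /interior; apply: filterI.
    exact: open_nbhs_nbhs.
  have cont : {for q, continuous (transition d c)} by exact: (sdc 0 q Uq).
  by apply: cont; exact: open_nbhs_nbhs.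
exists U, (transition d c), e1, e2, e3, e4, e5, a, (e * - b1); split => //.
- split; first by move=> n; apply: Ck_sub (sdc n) => q [].
  by move=> q v [Uq _]; exact: transition_inj.
- by rewrite exprMn ee mul1r.
move=> q [Uq Bq']; have [_ hc hE _] := transition_domP Uq.
rewrite -model_surface_coords -GE// -(Fc _ hc) (GF _ (hphi.1 _)).1.
by rewrite /local_expr /= hE.
Qed.

Lemma congruent_mean_curvature d q : atlas d -> chart_cod d q ->
  (forall i, nabla_perp (local_expr phi d) i (mean_curvature (local_expr phi d)) q = 0) /\
  mink (mean_curvature (local_expr phi d) q) dt = 0.
Proof.
move=> ad cq.
have [U [h [e1 [e2 [e3 [e4 [e5 [a [t [[oU Uq] [sh h_inj] fr tE fE]]]]]]]]]] :=
  congruent_local_model ad cq.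
pose g := trig_model e1 e2 e3 e4 e5 a t b1 b2 b3.
have sg : smooth_on setT g by exact: smooth_trig_model.
have gS y : [set: E2 R] y -> RxS4 (g y) by move=> _; exact: trig_model_RxS4.
have gp y : [set: E2 R] y -> forall v : E2 R, v != 0 -> 0 < mink ('D_v g y) ('D_v g y).
  by move=> _ v vn; exact: trig_model_pos.
have hU y : U y -> [set: E2 R] (h y) by [].
have HE y (Uy : U y) := mean_curvature_reparam openT sg gS gp oU sh hU h_inj fE Uy.
split=> [i|]; last by rewrite HE//; exact: trig_model_Hdt.
rewrite (nabla_perp_reparam openT sg gS gp oU sh hU h_inj fE i _ HE Uq).
  by rewrite !trig_model_PMCV// !scaler0 addr0.
exact: smooth_mean_curvature_trig.
Qed.

Theorem congruent_biconservative_PMCV : biconservative phi /\ PMCV phi.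
Proof.
have hp : PMCV phi by move=> d ad q cq i; exact: (congruent_mean_curvature ad cq).1.
split=> // d ad q cq.
apply/(biconservative_at (@chart_cod_open _ _ d) (chart_smooth hphi ad)
  (@chart_RxS4 _ _ _ hphi d) (chart_pos hphi ad) (hp d ad) cq (hT ad cq)).
exact: (congruent_mean_curvature ad cq).2.
Qed.

End Backward.

Unset Implicit Arguments.

Theorem theorem6p5 (R : realType) (M : surface R) (phi : M -> E6 R)
  (hphi : spacelike_surface phi)
  (hT : T_nowhere_zero phi)
  (hH : H_nonzero phi) :
  (biconservative phi /\ PMCV phi) <->
  (exists b1 b2 b3 : R,
    [/\ b1 != 0, b2 != 0, b3 != 0,
        b2 ^+ 2 + b3 ^+ 2 = (b1 ^+ 2 + 2)^-1 &
        congruent_to_local phi (model_surface b1 b2 b3)]).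
Proof.
split=> [[hb hp]|[b1 [b2 [b3 [_ _ b3n bE cong]]]]].
  exact: biconservative_PMCV_congruent.
exact: congruent_biconservative_PMCV cong.
Qed.
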